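(* Let $d\ge 1$ be an integer, let $0<\alpha\le d+1$, and let $1\le p,q\le\infty$. Then the following conditions are equivalent: (1) $K_\alpha:L^p\to L^q$ is compact; (2) $p,q$ satisfy one of the following: (a) $p=1$ and $q<\frac{d+1}{\alpha}$; (b) $1<p<\frac{d+1}{d+1-\alpha}$ and $\frac1q>\frac1p+\frac{\alpha}{d+1}-1$; (c) $p=\frac{d+1}{d+1-\alpha}$ and $q<\infty$; (d) $\frac{d+1}{d+1-\alpha}<p\le\infty$.
   Context: $\mathbb{B}^d$ is the open unit ball of $\mathbb{C}^d$ with Lebesgue measure $dv$ normalized so that $v(\mathbb{B}^d)=1$; $\langle z,w\rangle=\sum_j z_j\overline{w_j}$; $L^p=L^p(\mathbb{B}^d,dv)$. For $\alpha\in\mathbb{R}$ and $f\in L^1(\mathbb{B}^d,dv)$, $$K_\alpha f(z)=\int_{\mathbb{B}^d}\frac{f(w)}{(1-\langle z,w\rangle)^\alpha}\,dv(w),\qquad z\in\mathbb{B}^d$$ (principal branch of the power). Conventions: $1/\infty=0$, and $\frac{d+1}{d+1-\alpha}=\infty$ when $\alpha=d+1$. *)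

(* Defs.v *)
From HB Require Import structures.
From mathcomp Require Import all_boot all_order all_algebra.
From mathcomp Require Import all_classical all_reals all_analysis.
From mathcomp Require Import measurable_realfun ess_sup_inf complex.

Set Implicit Arguments.
Unset Strict Implicit.
Unset Printing Implicit Defensive.

Import Order.TTheory GRing.Theory Num.Theory.
Import numFieldNormedType.Exports.
Import ComplexField.Normc.

Local Open Scope classical_set_scope.
Local Open Scope ring_scope.
Local Open Scope complex_scope.

Local Notation cRe := (@complex.Re _).
Local Notation cIm := (@complex.Im _).

Section complex_borel.
Context {R : realType}.

Definition complex_pair (z : R[i]) : R * R := (cRe z, cIm z).
Definition pair_complex (u : R * R) : R[i] := u.1 +i* u.2.

HB.instance Definition _ := isPointed.Build R[i] 0.

Definition complex_measurable : set (set R[i]) :=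
  preimage_set_system setT complex_pair measurable.

Let complex_sigma_algebra : sigma_algebra setT complex_measurable.
Proof. exact/sigma_algebra_preimage/sigma_algebra_measurable. Qed.

Let complex_measurable0 : complex_measurable set0.
Proof. by case: complex_sigma_algebra. Qed.

Let complex_measurableC A :
  complex_measurable A -> complex_measurable (~` A).
Proof.
by case: complex_sigma_algebra => _ + _ => /(_ A) /[apply]; rewrite setTD.
Qed.

Let complex_measurable_bigcup (F : (set R[i])^nat) :
  (forall i, complex_measurable (F i)) ->
  complex_measurable (\bigcup_i F i).
Proof. by case: complex_sigma_algebra => _ _; exact. Qed.

(* The Borel sigma-algebra of C, identified with R * R. *)
HB.instance Definition _ := @isMeasurable.Build default_measure_display R[i]
  complex_measurable complex_measurable0 complex_measurableC
  complex_measurable_bigcup.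

Lemma measurable_complex_pair : measurable_fun setT complex_pair.
Proof. by move=> _ A mA; exists A. Qed.

Lemma measurable_pair_complex : measurable_fun setT pair_complex.
Proof.
move=> _ _ [A mA <-]; rewrite !setTI -comp_preimage.
by rewrite (_ : _ \o _ = id)//; apply/funext => -[].
Qed.

Lemma measurable_fun_complexP d (T : measurableType d) (f : T -> R[i]) :
  measurable_fun setT f <->
  measurable_fun setT (cRe \o f) /\ measurable_fun setT (cIm \o f).
Proof.
split=> [mf|[mRe mIm]].
  have mpf : measurable_fun setT (complex_pair \o f).
    exact: measurableT_comp measurable_complex_pair mf.
  split.
  - exact: (measurableT_comp measurable_fst mpf).
  - exact: (measurableT_comp measurable_snd mpf).
rewrite (_ : f = pair_complex \o (fun x => (cRe (f x), cIm (f x)))).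
  apply: (measurableT_comp measurable_pair_complex).
  exact: measurable_fun_pair.
by apply/funext => x /=; case: (f x).
Qed.

Lemma measurable_normc : measurable_fun setT (@normc R).
Proof.
have [mRe mIm] := (measurable_fun_complexP (@id R[i])).1 (@measurable_id _ _ _).
rewrite (_ : @normc R = fun z =>
  (Num.sqrt (cRe z ^+ 2 + cIm z ^+ 2))); last first.
  by apply/funext => -[].
apply: (measurableT_comp (continuous_measurable_fun (@sqrt_continuous R))) => //.
by apply: measurable_funD; apply: measurable_funX.
Qed.

Lemma measurable_funB_complex d (T : measurableType d) (f g : T -> R[i]) :
  measurable_fun setT f -> measurable_fun setT g ->
  measurable_fun setT (fun x => f x - g x).
Proof.
move=> /measurable_fun_complexP[fr fi] /measurable_fun_complexP[gr gi].
apply/measurable_fun_complexP; split.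
- rewrite (_ : _ \o _ = (cRe \o f) \- (cRe \o g)).
    exact: measurable_funB.
  by apply/funext => x /=; case: (f x); case: (g x).
- rewrite (_ : _ \o _ = (cIm \o f) \- (cIm \o g)).
    exact: measurable_funB.
  by apply/funext => x /=; case: (f x); case: (g x).
Qed.

End complex_borel.

Section complex_Lp.
Context d {T : measurableType d} {R : realType}.
Variable mu : {measure set T -> \bar R}.
Implicit Types (p : \bar R) (f g h : T -> R[i]).

Definition cintegral (D : set T) f : R[i] :=
  Rintegral mu D (cRe \o f) +i* Rintegral mu D (cIm \o f).

Definition cLnorm p f : \bar R := Lnorm mu p (fun x => (normc (f x))%:E).

Lemma cLnorm_triangle p f g h : (1 <= p)%E ->
  measurable_fun setT f -> measurable_fun setT g -> measurable_fun setT h ->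
  (cLnorm p (f \- h)%R <=
   cLnorm p (f \- g)%R + cLnorm p (g \- h)%R)%E.
Proof.
move=> p1 mf mg mh.
pose u x := normc (f x - g x); pose v x := normc (g x - h x).
have mu' : measurable_fun setT u.
  exact: (measurableT_comp measurable_normc (measurable_funB_complex mf mg)).
have mv : measurable_fun setT v.
  exact: (measurableT_comp measurable_normc (measurable_funB_complex mg mh)).
have mw : measurable_fun setT (fun x => normc (f x - h x)).
  exact: (measurableT_comp measurable_normc (measurable_funB_complex mf mh)).
have n0 (z : R[i]) : 0 <= normc z by case: z => a b; exact: sqrtr_ge0.
have wuv x : normc (f x - h x) <= u x + v x.
  by rewrite /u /v -(subrKA (g x)); exact: le_normcD.
apply: le_trans (eminkowski mu mu' mv p1).
rewrite /cLnorm unlock; case: p p1 => [r r1|_|//].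
- have r0 : 0 <= r by exact: le_trans ler01 r1.
  have mE (k : T -> R) : measurable_fun setT k ->
      measurable_fun setT (fun x => `|(k x)%:E| `^ r)%E.
    move=> mk; apply: (measurableT_comp (measurable_poweR r)).
    by apply: measurableT_comp => //; exact/measurable_EFinP.
  apply: gt0_ler_poweR.
  + by rewrite invr_ge0.
  + by rewrite in_itv/= leey integral_ge0// => x _; exact: poweR_ge0.
  + by rewrite in_itv/= leey integral_ge0// => x _; exact: poweR_ge0.
  + apply: ge0_le_integral => //.
    * by move=> x _; exact: poweR_ge0.
    * exact: mE mw.
    * exact: (mE _ (measurable_funD mu' mv)).
    * move=> x _; apply: gt0_ler_poweR => //.
      - by rewrite in_itv/= leey lee_fin normr_ge0.
      - by rewrite in_itv/= leey lee_fin normr_ge0.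
      - by rewrite lee_fin /= !ger0_norm ?addr_ge0 ?n0 ?wuv.
- case: ifPn => // _; apply: le_ess_sup; apply/nearW => x /=.
  by rewrite lee_fin !ger0_norm ?addr_ge0 ?n0 ?wuv.
Qed.


Lemma cLnorm_ge0 p f : (0 <= cLnorm p f)%E.
Proof. exact: Lnorm_ge0. Qed.

Lemma cLnormBC p f g : cLnorm p (f \- g) = cLnorm p (g \- f).
Proof.
apply: eq_Lnorm => x /=; congr EFin.
by rewrite -(opprB (g x)) normcN.
Qed.

Lemma cLnormBxx p f : (1 <= p)%E -> cLnorm p (f \- f) = 0%E.
Proof.
move=> p1; rewrite -[RHS](@Lnorm0 _ _ _ mu p); last first.
  by rewrite gt_eqF// (lt_le_trans _ p1).
by apply: eq_Lnorm => x /=; rewrite subrr normc0.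
Qed.

Lemma cLnormB_eq0 p f g : (1 <= p)%E ->
  measurable_fun setT f -> measurable_fun setT g ->
  cLnorm p (f \- g) = 0%E -> f = g %[ae mu].
Proof.
move=> p1 mf mg /Lnorm_eq0_eq0 h.
have {h} := h _ (lt_le_trans lte01 p1).
have m : measurable_fun setT (fun x => (normc ((f \- g) x))%:E).
  apply/measurable_EFinP.
  exact: (measurableT_comp measurable_normc (measurable_funB_complex mf mg)).
move=> /(_ m); apply: filterS => x /= /(_ I) [/eq0_normc fg0] _.
by apply/eqP; rewrite -subr_eq0; apply/eqP.
Qed.

(* L^p(T, mu; C) for 1 <= p <= +oo: a.e.-classes of measurable functions
   T -> C with finite L^p norm, under the metric induced by that norm. *)
Definition cLp p (p1 : (1 <= p)%E) : Type :=
  {f : {mfun_ mu, T >-> R[i]} | `[< (cLnorm p f < +oo)%E >]}.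

Definition cLp_fun p (p1 : (1 <= p)%E) (f : cLp p1) : T -> R[i] := sval f.

Section cLp_metric.
Variables (p : \bar R) (p1 : (1 <= p)%E).

HB.instance Definition _ := Choice.copy (cLp p1)
  {f : {mfun_ mu, T >-> R[i]} | `[< (cLnorm p f < +oo)%E >]}.

Implicit Types F G H : cLp p1.

Lemma measurable_cLp F : measurable_fun setT (cLp_fun F).
Proof. exact: measurable_funPT. Qed.

Lemma cLnorm_cLp_lty F : (cLnorm p (cLp_fun F) < +oo)%E.
Proof. by apply/asboolP; exact: (svalP F). Qed.

Definition cLp_dist F G : R := fine (cLnorm p (cLp_fun F \- cLp_fun G)).

Lemma cLp_distE F G :
  (cLp_dist F G)%:E = cLnorm p (cLp_fun F \- cLp_fun G).
Proof.
rewrite /cLp_dist fineK// ge0_fin_numE ?cLnorm_ge0//.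
have m0 : measurable_fun setT (fun _ : T => 0 : R[i]) by [].
apply: le_lt_trans (cLnorm_triangle p1 (measurable_cLp F) m0 (measurable_cLp G)) _.
rewrite (cLnormBC p (fun=> 0)) lte_add_pinfty//.
- rewrite (_ : _ \- _ = cLp_fun F) ?cLnorm_cLp_lty//.
  by apply/funext => x /=; rewrite subr0.
- rewrite (_ : _ \- _ = cLp_fun G) ?cLnorm_cLp_lty//.
  by apply/funext => x /=; rewrite subr0.
Qed.

Let cLp_distxx F : cLp_dist F F = 0.
Proof. by rewrite /cLp_dist cLnormBxx. Qed.

Let cLp_dist_eq0 F G : cLp_dist F G = 0 -> F = G.
Proof.
move=> FG0; apply/val_inj; rewrite -[LHS]reprK -[RHS]reprK; apply/eqP/ae_eqP.
apply: (cLnormB_eq0 p1 (measurable_cLp F) (measurable_cLp G)).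
by rewrite -cLp_distE FG0.
Qed.

Let cLp_distC F G : cLp_dist F G = cLp_dist G F.
Proof. by rewrite /cLp_dist cLnormBC. Qed.

Let cLp_dist_triangle G F H : cLp_dist F H <= cLp_dist F G + cLp_dist G H.
Proof.
rewrite -lee_fin EFinD !cLp_distE.
by apply: cLnorm_triangle => //; exact: measurable_cLp.
Qed.

HB.instance Definition _ := @isMetric.Build R (cLp p1)
  cLp_dist cLp_distxx cLp_dist_eq0 cLp_distC cLp_dist_triangle.

End cLp_metric.

(* The map K on functions, defined up to mu-a.e. equality, induces a map
   L^p -> L^q sending the unit ball to a relatively compact set. *)
Definition compact_operator p q (p1 : (1 <= p)%E) (q1 : (1 <= q)%E)
    (K : (T -> R[i]) -> (T -> R[i])) : Prop :=
  exists2 K' : cLp p1 -> cLp q1,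
    (forall F, cLp_fun (K' F) = K (cLp_fun F) %[ae mu]) &
    precompact (K' @` [set F | (cLnorm p (cLp_fun F) <= 1)%E]).

End complex_Lp.

Section complex_power.
Context {R : realType}.

(* Principal argument, in ]- pi, pi] for z != 0. *)
Definition carg (z : R[i]) : R :=
  let t := acos (cRe z / normc z) in if 0 <= cIm z then t else - t.

Definition cLog (z : R[i]) : R[i] := ln (normc z) +i* carg z.

Definition cexp (z : R[i]) : R[i] :=
  (expR (cRe z))%:C * (cos (cIm z) +i* sin (cIm z)).

Definition cpow (z : R[i]) (a : R) : R[i] := cexp (a%:C * cLog z).

End complex_power.

Section lebesgue_complex_space.
Context {R : realType}.

Definition cons_complex n 
    (u : n.-tuple R[i] * measurableTypeR R * measurableTypeR R) : n.+1.-tuple R[i] :=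
  [tuple of (u.1.2 +i* u.2) :: u.1.1].

Lemma measurable_cons_complex n : measurable_fun setT (@cons_complex n).
Proof.
apply: (@measurable_cons _ _ _ _ (fun u => u.1.2 +i* u.2) _ (fun u => u.1.1)).
  apply/measurable_fun_complexP; split; last exact: measurable_snd.
  exact: (measurableT_comp measurable_snd measurable_fst).
exact: (measurableT_comp measurable_fst measurable_fst).
Qed.

Section successor.
Variables (n : nat) (m : {measure set (n.-tuple R[i]) -> \bar R}).

Let leb : {sigma_finite_measure set (measurableTypeR R) -> \bar R} :=
  @lebesgue_measure R.

Let leb_re : {measure set (n.-tuple R[i] * measurableTypeR R)%type -> \bar R} :=
  product_measure1 m leb.

Let leb_im : {measure set
    (n.-tuple R[i] * measurableTypeR R * measurableTypeR R)%type -> \bar R} :=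
  product_measure1 leb_re leb.

Definition lebesgue_step : set (n.+1.-tuple R[i]) -> \bar R :=
  pushforward leb_im (@cons_complex n).

Let lebesgue_step0 : lebesgue_step set0 = 0%E.
Proof. by rewrite /lebesgue_step /pushforward preimage_set0 measure0. Qed.

Let lebesgue_step_ge0 A : (0 <= lebesgue_step A)%E.
Proof. by rewrite /lebesgue_step /pushforward measure_ge0. Qed.

Let lebesgue_step_sigma_additive : semi_sigma_additive lebesgue_step.
Proof.
move=> F mF tF mUF; rewrite /lebesgue_step /pushforward preimage_bigcup.
have mpre A : measurable A -> measurable (@cons_complex n @^-1` A).
  by move=> mA; rewrite -[X in measurable X]setTI; exact: measurable_cons_complex.
apply: measure_semi_sigma_additive.
- by move=> k; exact: mpre.
- apply/trivIsetP => /= i j _ _ ij; rewrite -preimage_setI.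
  by move/trivIsetP : tF => /(_ _ _ _ _ ij) ->//; rewrite preimage_set0.
- by rewrite -preimage_bigcup; exact: mpre.
Qed.

HB.instance Definition _ := isMeasure.Build _ _ _ lebesgue_step
  lebesgue_step0 lebesgue_step_ge0 lebesgue_step_sigma_additive.

End successor.

(* Lebesgue measure on C^n = R^(2n), as an iterated product measure adjoining the
   real and imaginary parts of one coordinate at a time. *)
Fixpoint lebesgue_complex (n : nat) : {measure set (n.-tuple R[i]) -> \bar R} :=
  match n with
  | 0 => \d_ [tuple]
  | n'.+1 => lebesgue_step (lebesgue_complex n')
  end.

End lebesgue_complex_space.

Section ball.
Context {R : realType}.
Variable d : nat.
Implicit Types z w : d.-tuple R[i].

Definition cdot z w : R[i] := \sum_(j < d) tnth z j * (tnth w j)^*.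

Definition unit_ball : set (d.-tuple R[i]) :=
  [set z | \sum_(j < d) normc (tnth z j) ^+ 2 < 1].

Lemma measurable_unit_ball : measurable unit_ball.
Proof.
rewrite [X in measurable X](_ : _ =
  (fun z => \sum_(j < d) normc (tnth z j) ^+ 2) @^-1` `]-oo, 1[); last first.
  by apply/seteqP; split => z; rewrite /= in_itv.
rewrite -[X in measurable X]setTI.
apply: (_ : measurable_fun setT _) => //.
apply: measurable_sum => j; apply: measurable_funX.
exact: (measurableT_comp measurable_normc (measurable_tnth j)).
Qed.

(* Lebesgue measure restricted to the unit ball, normalized so that the ball has
   measure 1; L^p(B^d, dv) is thus L^p of C^d for this measure. *)
Definition ball_measure : {measure set (d.-tuple R[i]) -> \bar R} :=
  mscale (NngNum (fine_ge0 (measure_ge0 (lebesgue_complex d) unit_ball)))%:num^-1%:nng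
    (mrestr (lebesgue_complex d) measurable_unit_ball).

Definition K_op (alpha : R) (f : d.-tuple R[i] -> R[i])
    (z : d.-tuple R[i]) : R[i] :=
  cintegral ball_measure unit_ball (fun w => f w / cpow (1 - cdot z w) alpha).

(* (d + 1) / (d + 1 - alpha); it is +oo for alpha = d + 1, as 0^-1 = +oo in \bar R. *)
Definition critical_exponent (alpha : R) : \bar R :=
  ((d.+1%:R)%:E / (d.+1%:R - alpha)%:E)%E.

End ball.

(* Main.v *)
(* Write N = d + 1; condition (2) says exactly that 1/p + alpha/N - 1 < 1/q.

   If it holds, strictness leaves room for some s > 0 such that the positive
   operator with kernel |1 - <z,w>|^-(alpha+s) is still bounded from L^p to L^q,
   by a Young-type estimate resting on the Forelli-Rudin bounds (for q < p, a
   power of the distance to the sphere is split off first).  Moving the kernel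
   off its singularity, to (1 + h - <z,w>)^-alpha, changes K f by at most a
   multiple of h^s times that operator applied to |f|.  The moved kernel is
   Lipschitz in z, so up to a small uniform error the image of the unit ball is
   described by rounded values at finitely many points.  The image under K is
   thus totally bounded in L^q, which is complete.

   If it fails, take indicators, normalized in L^p, of boxes of size e in the
   first coordinate and sqrt e in the others, near a point of the sphere.  On
   such a box the real part of the kernel is at least a multiple of e^-alpha,
   so when e2 is small compared with e1 the images of the two test functions
   stay at a fixed positive distance, and no cluster point can exist as e
   tends to 0. *)
From HB Require Import structures.
Require Import Defs.
From mathcomp Require Import all_boot all_order all_algebra.
From mathcomp Require Import all_classical all_reals all_analysis.
From mathcomp Require Import measurable_realfun ess_sup_inf complex.
From mathcomp Require Import ring lra.

Set Implicit Arguments.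
Unset Strict Implicit.
Unset Printing Implicit Defensive.

Import Order.TTheory GRing.Theory Num.Theory.
Import numFieldNormedType.Exports.
Import ComplexField.Normc.

Local Open Scope classical_set_scope.
Local Open Scope ring_scope.

Local Notation cRe := (@complex.Re _).
Local Notation cIm := (@complex.Im _).

(** * Lebesgue measure of boxes in C^n *)

(** The exponent N reflects the geometry of the kernel: in the ball, |1 - <z,w>| < t confines one
    complex coordinate of w to width O(t) and the d - 1 others to width O(sqrt t), so its volume is
    O(t^2 t^(d-1)) = O(t^N). The factor h^s comes from an interpolation. With x = 1 - <z,w>, moving
    the kernel costs |x|^-alpha times O(min(h/|x|, 1)), which is at most O((h/|x|)^s) for 0 < s <=
    1: any small s will do, so the exponent alpha + s can stay within the room left by the
    condition. For necessity, the image of the normalized indicator of the box of size e is at least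
    a multiple of e^g on that box, with g = N (1 - 1/p) - alpha, so its L^q norm is at least a
    multiple of e^(g + N/q). Failure of the condition means g + N/q <= 0. At equality this lower
    bound merely stays away from 0, so blow-up of norms cannot be the argument, and two images have
    to be separated from each other. *)

Section sigma_finite_pack.
Context d (T : measurableType d) (R : realType) (m : {measure set T -> \bar R}).
Hypothesis m_sigma_finite : sigma_finite setT m.

Let m' : set T -> \bar R := m.
HB.instance Definition _ := Measure.on m'.
HB.instance Definition _ :=
  Measure_isSigmaFinite.Build d T R m' m_sigma_finite.

(** The set function is [m] itself. [lebesgue_complex] and [ball_measure] carry only a measure
    structure, whereas sections and Tonelli ask for sigma-finiteness as a structure. *)
Definition sigma_finite_pack : {sigma_finite_measure set T -> \bar R} := m'.

End sigma_finite_pack.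

Section product_slices.
Context d1 d2 (T1 : measurableType d1) (T2 : measurableType d2) (R : realType).

Lemma sigma_finite_product_measure1
    (m1 : {sigma_finite_measure set T1 -> \bar R})
    (m2 : {sigma_finite_measure set T2 -> \bar R}) :
  sigma_finite setT (product_measure1 m1 m2).
Proof.
have /sigma_finiteP[F [TF ndF Foo]] := sigma_finiteT m1.
have /sigma_finiteP[G [TG ndG Goo]] := sigma_finiteT m2.
exists (fun n => F n `*` G n).
  rewrite -setXTT TF TG; apply/seteqP; split => -[x y] /=; last first.
    by move=> [n _ []/= ? ?]; split; exists n.
  move=> [/= [n _ Fnx] [k _ Gky]]; exists (maxn n k) => //; split.
  - by move: x Fnx; exact/subsetPset/ndF/leq_maxl.
  - by move: y Gky; exact/subsetPset/ndG/leq_maxr.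
move=> k; have [? ?] := Foo k; have [? ?] := Goo k.
split; first exact: measurableX.
by rewrite product_measure1E// lte_mul_pinfty// ge0_fin_numE.
Qed.

Definition product_sigma_finite (m1 : {sigma_finite_measure set T1 -> \bar R})
    (m2 : {sigma_finite_measure set T2 -> \bar R}) :
  {sigma_finite_measure set (T1 * T2)%type -> \bar R} :=
  @sigma_finite_pack _ _ _ (product_measure1 m1 m2 : {measure set _ -> \bar R})
    (sigma_finite_product_measure1 m1 m2).

(** [product_measure1] is an integral over the first factor of the measures of sections; Tonelli for
    the indicator of [A] exchanges the two factors. *)
Lemma product_measure1_ysection (m1 : {sigma_finite_measure set T1 -> \bar R})
    (m2 : {sigma_finite_measure set T2 -> \bar R}) (A : set (T1 * T2)) :
  measurable A ->
  product_measure1 m1 m2 A = (\int[m2]_y m1 (ysection A y))%E.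
Proof.
move=> mA; have := indic_fubini_tonelli m1 m2 mA.
by rewrite indic_fubini_tonelli_FE // indic_fubini_tonelli_GE.
Qed.

End product_slices.

Section step_slices.
Context {R : realType}.
Variables (n : nat) (m : {sigma_finite_measure set (n.-tuple R[i]) -> \bar R}).
Let leb : {sigma_finite_measure set (measurableTypeR R) -> \bar R} :=
  @lebesgue_measure R.
Local Open Scope ereal_scope.

Lemma measurable_cons_complex_preimage (A : set (n.+1.-tuple R[i])) :
  measurable A -> measurable (@cons_complex R n @^-1` A).
Proof.
by move=> mA; rewrite -[X in measurable X]setTI; exact: measurable_cons_complex.
Qed.

(** Here the new coordinate is integrated innermost, which suits a set that is thin in it.
    [lebesgue_step_head] integrates it outermost, so that an induction hypothesis applies to the
    sections in the other coordinates. *)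
Lemma lebesgue_step_tail (A : set (n.+1.-tuple R[i])) : measurable A ->
  lebesgue_step m A =
  \int[m]_u \int[leb]_x leb [set y | A (cons_complex (u, x, y))].
Proof.
move=> mA; have mD := measurable_cons_complex_preimage mA.
rewrite /lebesgue_step /pushforward.
pose f := leb \o xsection (@cons_complex R n @^-1` A).
have mf : measurable_fun setT f by exact: measurable_fun_xsection.
have f0 z : 0 <= f z by [].
transitivity (\int[m]_u fubini_F leb f u).
  exact: (@fubini_tonelli1 _ _ _ _ R m leb f mf f0).
apply: eq_integral => u _; rewrite /fubini_F; apply: eq_integral => x _.
by rewrite /f /= /xsection /=; congr (leb _); apply/seteqP; split => y /=;
  rewrite inE.
Qed.

Lemma lebesgue_step_head (A : set (n.+1.-tuple R[i])) : measurable A ->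
  lebesgue_step m A =
  \int[leb]_y \int[leb]_x m [set u | A (cons_complex (u, x, y))].
Proof.
move=> mA; have mD := measurable_cons_complex_preimage mA.
rewrite /lebesgue_step /pushforward.
have /= -> := @product_measure1_ysection _ _ _ _ R (product_sigma_finite m leb) leb _ mD.
apply: eq_integral => y _.
have /= -> := @product_measure1_ysection _ _ _ _ R m leb _ (measurable_ysection y mD).
apply: eq_integral => x _.
congr (m _); apply/seteqP; split => u; rewrite /ysection /=.
  by move=> /set_mem /set_mem.
by move=> Au; apply/mem_set/mem_set.
Qed.

End step_slices.

Section boxes.
Context {R : realType}.
Local Notation leb := (@lebesgue_measure R).

Lemma measurable_Re_tnth n (i : 'I_n) :
  measurable_fun setT (fun w : n.-tuple R[i] => cRe (tnth w i)).
Proof. by have [] := (measurable_fun_complexP (fun w : n.-tuple R[i] => tnth w i)).1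
  (measurable_tnth i). Qed.

Lemma measurable_Im_tnth n (i : 'I_n) :
  measurable_fun setT (fun w : n.-tuple R[i] => cIm (tnth w i)).
Proof. by have [] := (measurable_fun_complexP (fun w : n.-tuple R[i] => tnth w i)).1
  (measurable_tnth i). Qed.

Definition cbox n (a b l : nat -> R) : set (n.-tuple R[i]) :=
  [set w | forall i : 'I_n, `|cRe (tnth w i) - a i| <= l i /\
                            `|cIm (tnth w i) - b i| <= l i].
Arguments cbox : clear implicits.

Lemma measurable_cbox n (a b l : nat -> R) : measurable (cbox n a b l).
Proof.
have mle (f : n.-tuple R[i] -> R) (c e : R) : measurable_fun setT f ->
    measurable [set w | `|f w - c| <= e].
  move=> mf; rewrite -[X in measurable X]setTI.
  rewrite (_ : [set w | _] = (fun w => `|f w - c|) @^-1` `]-oo, e]).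
    have mg : measurable_fun setT (fun w => `|f w - c|).
      by exact: (measurableT_comp (@normr_measurable R setT) (measurable_funB mf (measurable_cst c))).
    exact: mg.
  by apply/seteqP; split => w; rewrite /= in_itv.
rewrite (_ : cbox n a b l = \bigcap_(i in [set: 'I_n])
    ([set w | `|cRe (tnth w i) - a i| <= l i] `&`
     [set w | `|cIm (tnth w i) - b i| <= l i])); last first.
  by apply/seteqP; split => [w H i _|w H i]; [exact: H|exact: H].
apply: fin_bigcap_measurable => [|i _]; first exact: finite_finset.
apply: measurableI; apply: mle; [exact: measurable_Re_tnth|exact: measurable_Im_tnth].
Qed.

Lemma interval_center (x c l : R) : (`[c - l, c + l]%classic x) = (`|x - c| <= l).
Proof. by rewrite /= in_itv /= ler_distl. Qed.

Lemma lebesgue_measure_center (c l : R) : 0 <= l ->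
  leb `[c - l, c + l]%classic = (2 * l)%:E.
Proof.
move=> l0; rewrite lebesgue_measure_itv /= lte_fin.
case: ltP => h; first by rewrite -EFinD; congr EFin; ring.
by congr EFin; lra.
Qed.

Lemma preimage_cons_cbox n (a b l : nat -> R) :
  @cons_complex R n @^-1` cbox n.+1 a b l =
  (cbox n (a \o S) (b \o S) (l \o S) `*` `[a 0 - l 0, a 0 + l 0]) `*`
  `[b 0 - l 0, b 0 + l 0].
Proof.
apply/seteqP; split => [[[u x] y] /= H|[[u x] y] /= [[H1 H2] H3] i].
  split; last by have [_] := H ord0; rewrite tnth0 /= in_itv /= ler_distl.
  split; last by have [+ _] := H ord0; rewrite tnth0 /= in_itv /= ler_distl.
  by move=> i /=; have := H (lift ord0 i); rewrite tnthS.
have [j ->|->] := unliftP ord0 i; first by rewrite tnthS; exact: H1.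
by move: H2 H3; rewrite tnth0 /= !in_itv /= !ler_distl.
Qed.

Lemma lebesgue_complex_cbox n (a b l : nat -> R) : (forall i, 0 <= l i) ->
  lebesgue_complex n (cbox n a b l) = (\prod_(i < n) (2 * l i) ^+ 2)%:E.
Proof.
elim: n a b l => [|n IHn] a b l l0.
  rewrite big_ord0 /= /dirac /= indicE mem_set //.
  by case.
rewrite /= /lebesgue_step /pushforward preimage_cons_cbox.
pose m : {measure set (n.-tuple R[i] * measurableTypeR R)%type -> \bar R} :=
  product_measure1 (lebesgue_complex n) leb.
set I := `[a 0 - _, _]%classic; set J := `[b 0 - _, _]%classic.
set Q := cbox _ _ _ _.
have mQ : measurable Q by exact: measurable_cbox.
have mI : measurable (I : set (measurableTypeR R)) by exact: measurable_itv.
have mJ : measurable (J : set (measurableTypeR R)) by exact: measurable_itv.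
have mQI : measurable (Q `*` (I : set (measurableTypeR R))) by exact: measurableX.
transitivity (lebesgue_complex n Q * leb I * leb J)%E.
  rewrite -[X in (X * _)%E](product_measure1E (lebesgue_complex n) leb)//.
  exact: (product_measure1E m leb).
rewrite /I /J /Q.
have /= -> := lebesgue_measure_center (a 0%N) (l0 0%N).
have /= -> := lebesgue_measure_center (b 0%N) (l0 0%N).
rewrite IHn; last by move=> i; exact: l0.
rewrite big_ord_recl /= -!EFinM; congr EFin.
by rewrite -mulrA -expr2 mulrC.
Qed.

End boxes.
Arguments cbox {R} n a b l.

(* No measurability of f is needed: the integral of a nonnegative function is
   a supremum over the simple functions below it. *)
Lemma ge0_le_integral_mono d (T : measurableType d) (R : realType)
    (mu : {measure set T -> \bar R}) (D : set T) (f g : T -> \bar R) :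
  (forall x, D x -> 0 <= f x)%E -> (forall x, D x -> f x <= g x)%E ->
  (\int[mu]_(x in D) f x <= \int[mu]_(x in D) g x)%E.
Proof.
move=> f0 fg; rewrite !ge0_integralE//; last first.
  by move=> x Dx; exact: le_trans (f0 _ Dx) (fg _ Dx).
apply: le_ereal_sup => _ [h hf <-]; exists h => //= x; apply: le_trans (hf x) _.
rewrite /patch; case: ifPn => // /set_mem; exact: fg.
Qed.

(** * Slices of Lebesgue measure on C^n and the volume of slabs *)

Section lebesgue_complex_slices.
Context {R : realType}.
Local Notation leb := (@lebesgue_measure R).

Lemma sigma_finite_lebesgue_complex n :
  sigma_finite setT (@lebesgue_complex R n).
Proof.
exists (fun k => cbox n (fun=> 0) (fun=> 0) (fun=> k%:R)).
  apply/esym/seteqP; split => // w _ /=.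
  pose M := \sum_(i < n) (`|cRe (tnth w i)| + `|cIm (tnth w i)|).
  exists (Num.bound M) => // i; rewrite !subr0.
  have MB : M < (Num.bound M)%:R.
    by apply: le_lt_trans (archi_boundP _); rewrite ?ler_norm// sumr_ge0.
  have : `|cRe (tnth w i)| + `|cIm (tnth w i)| <= M.
    by rewrite /M (bigD1 i)//= lerDl sumr_ge0.
  have := normr_ge0 (cRe (tnth w i)); have := normr_ge0 (cIm (tnth w i)).
  by move: MB; lra.
move=> k; split; first exact: measurable_cbox.
by rewrite lebesgue_complex_cbox// ltry.
Qed.

Definition lebesgue_complex_sf n :
    {sigma_finite_measure set (n.-tuple R[i]) -> \bar R} :=
  sigma_finite_pack (@sigma_finite_lebesgue_complex n).

Lemma lebesgue_complex_tail n (A : set (n.+1.-tuple R[i])) : measurable A ->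
  lebesgue_complex n.+1 A =
  (\int[lebesgue_complex n]_u \int[leb]_x leb [set y | A (cons_complex (u, x, y))])%E.
Proof. exact: (lebesgue_step_tail (lebesgue_complex_sf n)). Qed.

Lemma lebesgue_complex_head n (A : set (n.+1.-tuple R[i])) : measurable A ->
  lebesgue_complex n.+1 A =
  (\int[leb]_y \int[leb]_x lebesgue_complex n [set u | A (cons_complex (u, x, y))])%E.
Proof. exact: (lebesgue_step_head (lebesgue_complex_sf n)). Qed.

Lemma measurable_section_tail n (A : set (n.+1.-tuple R[i])) x y :
  measurable A -> measurable [set u : n.-tuple R[i] | A (cons_complex (u, x, y))].
Proof.
move=> mA; have mD := measurable_cons_complex_preimage mA.
rewrite (_ : [set u | _] = ysection (ysection (@cons_complex R n @^-1` A) y) x).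
  exact/measurable_ysection/measurable_ysection.
apply/seteqP; split => u; rewrite /ysection /=.
  by move=> Au; apply/mem_set/mem_set.
by move=> /set_mem /set_mem.
Qed.

Lemma measurable_section_head n (A : set (n.+1.-tuple R[i])) u x :
  measurable A -> measurable [set y : measurableTypeR R | A (cons_complex (u, x, y))].
Proof.
move=> mA; have mD := measurable_cons_complex_preimage mA.
rewrite (_ : [set y | _] = xsection (@cons_complex R n @^-1` A) (u, x)).
  exact/measurable_xsection.
apply/seteqP; split => y; rewrite /xsection /=.
  by move=> Au; apply/mem_set.
by move=> /set_mem.
Qed.

Lemma le_integral_indic d (T : measurableType d)
    (mu : {measure set T -> \bar R}) (D : set T) (f : T -> \bar R) (M : R) :
  measurable D -> 0 <= M -> (forall x, 0 <= f x)%E ->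
  (forall x, D x -> f x <= M%:E)%E -> (forall x, ~ D x -> f x = 0)%E ->
  (\int[mu]_x f x <= M%:E * mu D)%E.
Proof.
move=> mD M0 f0 fD fND.
rewrite -(integral_cst mu mD) [leRHS]integral_mkcond.
apply: ge0_le_integral_mono => // x _; rewrite /patch; case: ifPn => [/set_mem|].
  exact: fD.
by move=> /negP xD; rewrite fND// => Dx; apply: xD; exact: mem_set.
Qed.

(** Once one point (x0, y0) of the set is known, the whole set lies in the square of half side [rho]
    centred there. *)
Lemma lebesgue_square_section (rho : R) (B : R -> R -> Prop) : 0 <= rho ->
  (forall x y x' y', B x y -> B x' y' -> `|x - x'| <= rho /\ `|y - y'| <= rho) ->
  (forall x, measurable [set y : measurableTypeR R | B x y]) ->
  (\int[leb]_x leb [set y | B x y] <= ((2 * rho) ^+ 2)%:E)%E.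
Proof.
move=> rho0 Brho mB.
have [[x0 [y0 B0]]|noB] := pselect (exists x y, B x y); last first.
  rewrite integral0_eq ?lee_fin ?sqr_ge0// => x _.
  rewrite (_ : [set y | _] = set0) ?measure0//.
  by apply/seteqP; split => // y By; apply: noB; exists x, y.
have -> : ((2 * rho) ^+ 2)%:E = ((2 * rho)%:E * leb `[(x0 - rho)%R, (x0 + rho)%R]%classic)%E.
  by rewrite lebesgue_measure_center// -EFinM expr2.
apply: le_integral_indic => //; first by rewrite mulr_ge0.
- move=> x _; rewrite -(lebesgue_measure_center y0 rho0).
  apply: le_measure; rewrite ?inE; [exact: mB|exact: measurable_itv|].
  by move=> y By; rewrite interval_center; have [_] := Brho _ _ _ _ By B0.
- move=> x xI; rewrite (_ : [set y | _] = set0) ?measure0//.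
  apply/seteqP; split => // y By; apply: xI; rewrite interval_center.
  by have [] := Brho _ _ _ _ By B0.
Qed.

Lemma lebesgue_complex_cbox_cst n (a b : nat -> R) (l : R) : 0 <= l ->
  lebesgue_complex n (cbox n a b (fun=> l)) = (((2 * l) ^+ 2) ^+ n)%:E.
Proof.
by move=> l0; rewrite lebesgue_complex_cbox// prodr_const card_ord.
Qed.

Section slab.
Variables (l rho : R).
Hypotheses (l0 : 0 <= l) (rho0 : 0 <= rho).

Lemma lebesgue_complex_slab0 n (a b : nat -> R) (A : set (n.+1.-tuple R[i])) :
  measurable A ->
  (forall w, A w -> forall i, i != ord0 -> `|cRe (tnth w i) - a i| <= l /\
                                       `|cIm (tnth w i) - b i| <= l) ->
  (forall w w', A w -> A w' -> (forall i, i != ord0 -> tnth w i = tnth w' i) ->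
    `|cRe (tnth w ord0) - cRe (tnth w' ord0)| <= rho /\
    `|cIm (tnth w ord0) - cIm (tnth w' ord0)| <= rho) ->
  (lebesgue_complex n.+1 A <= (((2 * l) ^+ 2) ^+ n * (2 * rho) ^+ 2)%:E)%E.
Proof.
move=> mA Abox Arho; rewrite lebesgue_complex_tail// mulrC EFinM.
rewrite -(lebesgue_complex_cbox_cst n (a \o S) (b \o S) l0).
apply: le_integral_indic => //; [exact: measurable_cbox|exact: sqr_ge0| | |].
- by move=> u; exact: integral_ge0.
- move=> u _; apply: lebesgue_square_section => //.
    move=> x y x' y' Axy Axy'.
    have := Arho _ _ Axy Axy'; rewrite !tnth0 /=; apply.
    by move=> i; have [i' ->|->] := unliftP ord0 i; rewrite ?eqxx// !tnthS.
  by move=> x; exact: measurable_section_head.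
- move=> u ub; apply: integral0_eq => x _.
  rewrite (_ : [set y | _] = set0) ?measure0//.
  apply/seteqP; split => // y Axy; apply: ub => i.
  have := Abox _ Axy (lift ord0 i); rewrite tnthS /=; exact.
Qed.

(* A set whose coordinates other than the j-th lie in a box, and whose sections
   in the j-th coordinate have diameter at most rho. *)
Lemma lebesgue_complex_slab n (j : 'I_n.+1) (a b : nat -> R)
    (A : set (n.+1.-tuple R[i])) : measurable A ->
  (forall w, A w -> forall i, i != j -> `|cRe (tnth w i) - a i| <= l /\
                                       `|cIm (tnth w i) - b i| <= l) ->
  (forall w w', A w -> A w' -> (forall i, i != j -> tnth w i = tnth w' i) ->
    `|cRe (tnth w j) - cRe (tnth w' j)| <= rho /\
    `|cIm (tnth w j) - cIm (tnth w' j)| <= rho) ->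
  (lebesgue_complex n.+1 A <= (((2 * l) ^+ 2) ^+ n * (2 * rho) ^+ 2)%:E)%E.
Proof.
elim: n j a b A => [|n IHn] j a b A mA Abox Arho.
  by move: Abox Arho; rewrite (ord1 j); exact: lebesgue_complex_slab0.
(* If the thin coordinate is not the head, the head ranges over a square of half side [l], and every
   section in the tail is a slab with thin coordinate [j']. *)
have [j' jE|jE] := unliftP ord0 j; last first.
  by move: Abox Arho; rewrite jE; exact: lebesgue_complex_slab0.
set M := ((2 * l) ^+ 2) ^+ n * (2 * rho) ^+ 2.
have M0 : 0 <= M by rewrite mulr_ge0 ?exprn_ge0 ?mulr_ge0.
have sec (u : n.+1.-tuple R[i]) x y (Au : A (cons_complex (u, x, y))) :
    `|x - a 0%N| <= l /\ `|y - b 0%N| <= l.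
  by have := Abox _ Au ord0; rewrite jE tnth0 /=; apply.
have sec0 x y : ~ (`|x - a 0%N| <= l /\ `|y - b 0%N| <= l) ->
    lebesgue_complex n.+1 [set u | A (cons_complex (u, x, y))] = 0%E.
  move=> H; rewrite (_ : [set u | _] = set0) ?measure0//.
  by apply/seteqP; split => // u /sec.
have inner y : (\int[leb]_x lebesgue_complex n.+1 [set u | A (cons_complex (u, x, y))]
    <= (M * (2 * l))%:E)%E.
  rewrite EFinM -(lebesgue_measure_center (a 0%N) l0).
  apply: le_integral_indic => //.
    move=> x _; apply: (IHn j' (a \o S) (b \o S)).
    - exact: measurable_section_tail.
    - move=> w Aw i ij; have := Abox _ Aw (lift ord0 i).
      by rewrite jE (inj_eq lift_inj) tnthS /=; apply.
    - move=> w w' Aw Aw' ww'; have := Arho _ _ Aw Aw'.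
      rewrite jE !tnthS /=; apply => i; have [i' ->|->] := unliftP ord0 i.
        by rewrite (inj_eq lift_inj) !tnthS; exact: ww'.
      by rewrite !tnth0.
  by move=> x; rewrite interval_center => xI; apply: sec0 => -[].
rewrite lebesgue_complex_head//.
have -> : ((2 * l) ^+ 2) ^+ n.+1 * (2 * rho) ^+ 2 = (M * (2 * l)) * (2 * l).
  by rewrite /M exprS; ring.
rewrite EFinM -(lebesgue_measure_center (b 0%N) l0).
apply: le_integral_indic => //.
- by rewrite mulr_ge0// mulr_ge0.
- by move=> y; exact: integral_ge0.
- move=> y; rewrite interval_center => yJ; apply: integral0_eq => x _.
  by apply: sec0 => -[].
Qed.

End slab.
End lebesgue_complex_slices.

(** * The inner product and the ball *)

Section complex_norm.
Context {R : realType}.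
Implicit Types z w : R[i].

Lemma normc_ge0 z : 0 <= normc z.
Proof. by case: z => a b; exact: sqrtr_ge0. Qed.

Lemma normc_sqE z : normc z ^+ 2 = cRe z ^+ 2 + cIm z ^+ 2.
Proof. by case: z => a b /=; rewrite sqr_sqrtr// addr_ge0 ?sqr_ge0. Qed.

Lemma normc_Re z : `|cRe z| <= normc z.
Proof.
by rewrite -ler_sqr ?nnegrE ?normc_ge0// normc_sqE real_normK ?num_real// lerDl sqr_ge0.
Qed.

Lemma normc_Im z : `|cIm z| <= normc z.
Proof.
by rewrite -ler_sqr ?nnegrE ?normc_ge0// normc_sqE real_normK ?num_real// lerDr sqr_ge0.
Qed.

Lemma normc_ReIm z : normc z <= `|cRe z| + `|cIm z|.
Proof.
rewrite -ler_sqr ?nnegrE ?normc_ge0 ?addr_ge0// normc_sqE sqrrD !real_normK ?num_real//.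
have := mulr_ge0 (normr_ge0 (cRe z)) (normr_ge0 (cIm z)); lra.
Qed.

Lemma normc_conjc z : normc (conjc z) = normc z.
Proof. by case: z => a b /=; rewrite sqrrN. Qed.

Lemma normc_sum (I : Type) (s : seq I) (F : I -> R[i]) :
  normc (\sum_(i <- s) F i) <= \sum_(i <- s) normc (F i).
Proof.
elim: s => [|i s IH]; first by rewrite !big_nil normc0.
by rewrite !big_cons (le_trans (le_normcD _ _))// lerD2l.
Qed.

Lemma cReD z w : cRe (z + w) = cRe z + cRe w. Proof. by case: z; case: w. Qed.
Lemma cImD z w : cIm (z + w) = cIm z + cIm w. Proof. by case: z; case: w. Qed.
Lemma cReN z : cRe (- z) = - cRe z. Proof. by case: z. Qed.
Lemma cImN z : cIm (- z) = - cIm z. Proof. by case: z. Qed.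

Lemma cRe_sum (I : Type) (s : seq I) (F : I -> R[i]) :
  cRe (\sum_(i <- s) F i) = \sum_(i <- s) cRe (F i).
Proof. by elim: s => [|i s IH]; rewrite ?big_nil// !big_cons cReD IH. Qed.

Lemma cIm_sum (I : Type) (s : seq I) (F : I -> R[i]) :
  cIm (\sum_(i <- s) F i) = \sum_(i <- s) cIm (F i).
Proof. by elim: s => [|i s IH]; rewrite ?big_nil// !big_cons cImD IH. Qed.

End complex_norm.

Section cdot_theory.
Context {R : realType} {d : nat}.
Implicit Types z w : d.-tuple R[i].

Definition sqn z : R := \sum_(j < d) normc (tnth z j) ^+ 2.

Lemma sqn_ge0 z : 0 <= sqn z.
Proof. by apply: sumr_ge0 => i _; exact: sqr_ge0. Qed.

Lemma unit_ballP z : unit_ball z = (sqn z < 1) :> Prop.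
Proof. by []. Qed.

(** On the unit sphere this is the square of the nonisotropic metric. *)
Definition kap z w : R := normc (1 - cdot z w).

Lemma cRe_cdot z w : cRe (cdot z w) =
  \sum_(j < d) (cRe (tnth z j) * cRe (tnth w j) + cIm (tnth z j) * cIm (tnth w j)).
Proof.
rewrite /cdot cRe_sum; apply: eq_bigr => j _.
by case: (tnth z j) => a b; case: (tnth w j) => a' b' /=; ring.
Qed.

Lemma cIm_cdot z w : cIm (cdot z w) =
  \sum_(j < d) (cIm (tnth z j) * cRe (tnth w j) - cRe (tnth z j) * cIm (tnth w j)).
Proof.
rewrite /cdot cIm_sum; apply: eq_bigr => j _.
by case: (tnth z j) => a b; case: (tnth w j) => a' b' /=; ring.
Qed.

Lemma normc_cdot z w : normc (cdot z w) <= \sum_(j < d) normc (tnth z j) * normc (tnth w j).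
Proof.
apply: le_trans (normc_sum _ _) _; apply: ler_sum => j _.
by rewrite normcM normc_conjc.
Qed.

Lemma normc_cdot_half z w : normc (cdot z w) <= (sqn z + sqn w) / 2.
Proof.
apply: le_trans (normc_cdot _ _) _; rewrite /sqn -big_split /= mulr_suml.
apply: ler_sum => j _; set a := normc _; set b := normc _.
have := sqr_ge0 (a - b); rewrite sqrrB; lra.
Qed.

Lemma cRe1B_ge z w : 1 - (sqn z + sqn w) / 2 <= cRe (1 - cdot z w).
Proof.
rewrite cReD cReN /=.
have := normc_cdot_half z w; have := normc_Re (cdot z w).
have := ler_norm (cRe (cdot z w)); lra.
Qed.

Lemma cRe1B_gt0 z w : unit_ball z -> unit_ball w -> 0 < cRe (1 - cdot z w).
Proof. by rewrite !unit_ballP => zB wB; have := cRe1B_ge z w; lra. Qed.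

Lemma cRe_le_kap z w : cRe (1 - cdot z w) <= kap z w.
Proof. exact: le_trans (ler_norm _) (normc_Re _). Qed.

Lemma kap_gt0 z w : unit_ball z -> unit_ball w -> 0 < kap z w.
Proof. by move=> zB wB; exact: lt_le_trans (cRe1B_gt0 zB wB) (cRe_le_kap _ _). Qed.

(** The bound does not depend on [w]: for fixed [z] in the ball the kernel is bounded, which gives
    integrability, and in [Tb_weight] a power of [kap] can be traded for a weight in [z]. *)
Lemma kap_ge z w : unit_ball w -> (1 - sqn z) / 2 <= kap z w.
Proof.
rewrite unit_ballP => wB; apply: le_trans (cRe_le_kap _ _).
by have := cRe1B_ge z w; lra.
Qed.

Lemma kap_le2 z w : unit_ball z -> unit_ball w -> kap z w <= 2.
Proof.
rewrite !unit_ballP => zB wB; apply: le_trans (le_normcD _ _) _.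
rewrite normcN; have := normc_cdot_half z w.
suff -> : normc (1 : R[i]) = 1 by lra.
exact: normc1.
Qed.

Lemma kapC z w : kap z w = kap w z.
Proof.
rewrite /kap -[RHS]normc_conjc; congr normc.
apply/eqP; rewrite eq_complex; apply/andP; split; apply/eqP.
  have -> (u : R[i]) : cRe (conjc u) = cRe u by case: u.
  rewrite !cReD !cReN !cRe_cdot; congr (_ - _).
  by apply: eq_bigr => j _; ring.
have -> (u : R[i]) : cIm (conjc u) = - cIm u by case: u.
rewrite !cImD !cImN !cIm_cdot /= !add0r; congr (- _).
by rewrite -sumrN; apply: eq_bigr => j _; ring.
Qed.

(** The left side is at most |w - z|^2 = |z|^2 + |w|^2 - 2 Re <z,w>, and in the ball this is at most
    2 Re (1 - <z,w>). *)
Lemma dist_coord z w (j : 'I_d) : unit_ball z -> unit_ball w ->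
  (cRe (tnth w j) - cRe (tnth z j)) ^+ 2 + (cIm (tnth w j) - cIm (tnth z j)) ^+ 2
  <= 2 * kap z w.
Proof.
rewrite !unit_ballP => zB wB.
apply: le_trans (_ : 2 * cRe (1 - cdot z w) <= _); last first.
  by rewrite ler_pM2l//; exact: cRe_le_kap.
apply: le_trans (_ : sqn z + sqn w - 2 * cRe (cdot z w) <= _); last first.
  by rewrite cReD cReN /=; lra.
rewrite cRe_cdot /sqn -big_split /= mulr_sumr -sumrB.
rewrite (bigD1 j)//=.
have S0 : 0 <= \sum_(i < d | i != j) (normc (tnth z i) ^+ 2 + normc (tnth w i) ^+ 2 -
    2 * (cRe (tnth z i) * cRe (tnth w i) + cIm (tnth z i) * cIm (tnth w i))).
  apply: sumr_ge0 => i _; rewrite !normc_sqE.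
  have := sqr_ge0 (cRe (tnth z i) - cRe (tnth w i)).
  have := sqr_ge0 (cIm (tnth z i) - cIm (tnth w i)).
  by rewrite !sqrrB; lra.
rewrite -[leLHS]addr0; apply: lerD => //.
by rewrite !normc_sqE; lra.
Qed.

Lemma measurable_cdot d' (T : measurableType d') (f g : T -> d.-tuple R[i]) :
  measurable_fun setT f -> measurable_fun setT g ->
  measurable_fun setT (fun x => cdot (f x) (g x)).
Proof.
move=> mf mg; apply/measurable_fun_complexP; split.
  rewrite (_ : _ \o _ = (fun x => \sum_(j < d)
    (cRe (tnth (f x) j) * cRe (tnth (g x) j) + cIm (tnth (f x) j) * cIm (tnth (g x) j)))).
    apply: measurable_sum => j; apply: measurable_funD; apply: measurable_funM.
    - exact: measurableT_comp (measurable_Re_tnth j) mf.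
    - exact: measurableT_comp (measurable_Re_tnth j) mg.
    - exact: measurableT_comp (measurable_Im_tnth j) mf.
    - exact: measurableT_comp (measurable_Im_tnth j) mg.
  by apply/funext => x /=; rewrite cRe_cdot.
rewrite (_ : _ \o _ = (fun x => \sum_(j < d)
    (cIm (tnth (f x) j) * cRe (tnth (g x) j) - cRe (tnth (f x) j) * cIm (tnth (g x) j)))).
  apply: measurable_sum => j; apply: measurable_funB; apply: measurable_funM.
  - exact: measurableT_comp (measurable_Im_tnth j) mf.
  - exact: measurableT_comp (measurable_Re_tnth j) mg.
  - exact: measurableT_comp (measurable_Re_tnth j) mf.
  - exact: measurableT_comp (measurable_Im_tnth j) mg.
by apply/funext => x /=; rewrite cIm_cdot.
Qed.

Lemma measurable_kap d' (T : measurableType d') (f g : T -> d.-tuple R[i]) :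
  measurable_fun setT f -> measurable_fun setT g ->
  measurable_fun setT (fun x => kap (f x) (g x)).
Proof.
move=> mf mg; apply: (measurableT_comp measurable_normc).
by apply: measurable_funB_complex => //; exact: measurable_cdot.
Qed.

Lemma measurable_sqn : measurable_fun setT sqn.
Proof.
apply: measurable_sum => j; apply: measurable_funX.
exact: (measurableT_comp measurable_normc (measurable_tnth j)).
Qed.

End cdot_theory.

(** * Volume of the ball and of the sublevel sets of |1 - <z,w>| *)

Section ball_volume.
Context {R : realType}.
Local Notation leb := (@lebesgue_measure R).

Lemma unit_ball_coord d (w : d.-tuple R[i]) (j : 'I_d) :
  unit_ball w -> normc (tnth w j) < 1.
Proof.
rewrite unit_ballP /sqn (bigD1 j)//= => wB.
have S0 : 0 <= \sum_(i < d | i != j) normc (tnth w i) ^+ 2.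
  by apply: sumr_ge0 => i _; exact: sqr_ge0.
rewrite -(@ltr_pXn2r _ 2) ?nnegrE ?normc_ge0 ?expr1n//; lra.
Qed.

Lemma sub_unit_ball_cbox d :
  @unit_ball R d `<=` cbox d (fun=> 0) (fun=> 0) (fun=> 1).
Proof.
move=> w wB i; rewrite !subr0; have := unit_ball_coord i wB.
have := normc_Re (tnth w i); have := normc_Im (tnth w i); split; lra.
Qed.

Lemma lebesgue_complex_ball_le d : (lebesgue_complex d (@unit_ball R d) <= (4 ^+ d)%:E)%E.
Proof.
rewrite (_ : 4 = (2 * 1) ^+ 2 :> R); last by rewrite mulr1 -natrX.
rewrite -(lebesgue_complex_cbox_cst d (fun=> 0) (fun=> 0) ler01).
apply: le_measure; rewrite ?inE; [exact: measurable_unit_ball|exact: measurable_cbox|].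
exact: sub_unit_ball_cbox.
Qed.

Lemma lebesgue_complex_ball_gt0 d : (0 < lebesgue_complex d (@unit_ball R d))%E.
Proof.
pose l : R := (2 * d.+1%:R)^-1.
have l0 : 0 < l by rewrite invr_gt0 mulr_gt0// ltr0n.
apply: (@lt_le_trans _ _ (lebesgue_complex d (cbox d (fun=> 0) (fun=> 0) (fun=> l)))).
  by rewrite lebesgue_complex_cbox_cst 1?ltW// lte_fin exprn_gt0// exprn_gt0// mulr_gt0.
apply: le_measure; rewrite ?inE; [exact: measurable_cbox|exact: measurable_unit_ball|].
move=> w wb; rewrite unit_ballP /sqn.
apply: (@le_lt_trans _ _ (\sum_(j < d) (2 * l ^+ 2))).
  apply: ler_sum => j _; rewrite normc_sqE; have [] := wb j; rewrite !subr0 => h1 h2.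
  have sq (x : R) : `|x| <= l -> x ^+ 2 <= l ^+ 2.
    by move=> xl; rewrite -(real_normK (num_real x)) lerXn2r// ?nnegrE// ltW.
  by have := sq _ h1; have := sq _ h2; lra.
rewrite big_const_ord iter_addr_0 -[ltLHS]mulr_natl /l.
have d0 : 0 < d.+1%:R :> R by rewrite ltr0n.
have dd : d%:R = d.+1%:R - 1 :> R by rewrite -addn1 natrD; lra.
have d1 : 1 <= d.+1%:R :> R by rewrite ler1n.
rewrite dd exprVn mulrA ltr_pdivrMr ?mul1r ?exprn_gt0 ?mulr_gt0//; nra.
Qed.

Lemma ball_measureE d (A : set (d.-tuple R[i])) :
  ball_measure d A =
  ((fine (lebesgue_complex d (@unit_ball R d)))^-1%:E *
    lebesgue_complex d (A `&` @unit_ball R d))%E.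
Proof. by []. Qed.

Local Notation V d := (fine (lebesgue_complex d (@unit_ball R d))).

Lemma ball_volume_fin d : lebesgue_complex d (@unit_ball R d) = (V d)%:E.
Proof.
rewrite fineK// ge0_fin_numE//.
by rewrite (le_lt_trans (lebesgue_complex_ball_le d))// ltry.
Qed.

Lemma ball_volume_gt0 d : 0 < V d.
Proof. by rewrite -lte_fin -ball_volume_fin lebesgue_complex_ball_gt0. Qed.

Lemma ball_measureT d : ball_measure d [set: d.-tuple R[i]] = 1%E.
Proof.
rewrite ball_measureE setTI [X in (_ * X)%E]ball_volume_fin -EFinM mulVf//.
by rewrite gt_eqF// ball_volume_gt0.
Qed.

Lemma ball_measure_le d (A : set (d.-tuple R[i])) (M : R) :
  (lebesgue_complex d (A `&` @unit_ball R d) <= M%:E)%E ->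
  (ball_measure d A <= ((V d)^-1 * M)%:E)%E.
Proof.
by move=> AM; rewrite ball_measureE EFinM lee_pmul2l// ?lte_fin ?invr_gt0 ?ball_volume_gt0.
Qed.

Lemma measurable_kap_lt d (z : d.-tuple R[i]) (t : R) :
  measurable [set w | kap z w < t].
Proof.
rewrite -[X in measurable X]setTI.
rewrite (_ : [set w | _] = (fun w => kap z w) @^-1` `]-oo, t[).
  have mk : measurable_fun setT (fun w => kap z w) by exact: measurable_kap.
  by apply: mk => //; exact: measurable_itv.
by apply/seteqP; split => w; rewrite /= in_itv.
Qed.

(** Changing w_j alone changes <z,w> by z_j times the conjugate of the change. So on [kap z w < t]
    the coordinate j has width of order t / |z_j|, against sqrt t in [dist_coord]. *)
Lemma cdot_sub_coord d (z w w' : d.-tuple R[i]) (j : 'I_d) :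
  (forall i, i != j -> tnth w i = tnth w' i) ->
  normc (tnth z j) * normc (tnth w j - tnth w' j) <= kap z w + kap z w'.
Proof.
move=> ww'; rewrite -[X in _ * X]normc_conjc -normcM.
have -> : tnth z j * conjc (tnth w j - tnth w' j) = (1 - cdot z w') - (1 - cdot z w).
  have -> : 1 - cdot z w' - (1 - cdot z w) = cdot z w - cdot z w' by ring.
  rewrite /cdot (bigD1 j)//= [X in _ + _ - X](bigD1 j)//=.
  under eq_bigr => i ij do rewrite (ww' i ij).
  rewrite opprD addrACA subrr addr0 -mulrBr; congr (_ * _).
  by case: (tnth w j) => a b; case: (tnth w' j) => a' b' /=; rewrite opprD.
by apply: le_trans (le_normcD _ _) _; rewrite normcN addrC.
Qed.

(** [kap z w <= 1/2] forces |<z,w>| >= 1/2, and |<z,w>| is at most the sum of the |z_j|. *)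
Lemma kap_large_coord n (z w : n.+1.-tuple R[i]) : unit_ball w -> kap z w <= 2^-1 ->
  exists j, (2 * n.+1%:R)^-1 <= normc (tnth z j).
Proof.
move=> wB kw; apply: contrapT => noj.
have zj j : normc (tnth z j) < (2 * n.+1%:R)^-1.
  by rewrite ltNge; apply/negP => h; apply: noj; exists j.
have n0 : 0 < n.+1%:R :> R by rewrite ltr0n.
have : normc (cdot z w) < 2^-1.
  apply: le_lt_trans (normc_cdot _ _) _.
  apply: (@le_lt_trans _ _ (\sum_(j < n.+1) normc (tnth z j))).
    apply: ler_sum => j _; rewrite ler_piMr ?normc_ge0//.
    exact: ltW (unit_ball_coord j wB).
  apply: (@lt_le_trans _ _ (\sum_(j < n.+1) (2 * n.+1%:R)^-1)).
    by apply: ltr_sum => // ; apply/hasP; exists ord0 => //; rewrite mem_index_enum.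
  rewrite big_const_ord iter_addr_0 -[leLHS]mulr_natl invfM mulrCA mulfV ?mulr1//.
have : normc (1 : R[i]) <= kap z w + normc (cdot z w).
  by rewrite -{1}(subrK (cdot z w) 1); exact: le_normcD.
have -> : normc (1 : R[i]) = 1 by exact: normc1.
by move: kw; lra.
Qed.

(** A coordinate where |z_j| is large contributes an area of order t^2, each of the [n] others an
    area of order t. That is the first summand of [C]. The second serves t > 1/2, where (2 t)^(n+2)
    >= 1 and the volume of the whole ball suffices. *)
Lemma kap_volume n : exists2 C : R, 0 < C &
  forall (z : n.+1.-tuple R[i]) (t : R), unit_ball z -> 0 < t ->
  (ball_measure n.+1 [set w | kap z w < t]%R <= (C * t ^+ n.+2)%:E)%E.
Proof.
have n0 : 0 < n.+1%:R :> R by rewrite ltr0n.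
pose C := 8 ^+ n * (8 * n.+1%:R) ^+ 2 + 4 ^+ n.+1 * 2 ^+ n.+2 : R.
have C1 : 0 < 8 ^+ n * (8 * n.+1%:R) ^+ 2 :> R.
  by rewrite mulr_gt0// exprn_gt0// mulr_gt0.
have C2 : 0 < 4 ^+ n.+1 * 2 ^+ n.+2 :> R by rewrite mulr_gt0// exprn_gt0.
exists ((V n.+1)^-1 * C); first by rewrite mulr_gt0 ?invr_gt0 ?ball_volume_gt0// addr_gt0.
move=> z t zB t0; rewrite -mulrA; apply: ball_measure_le.
have [t1|t1] := leP t 2^-1; last first.
  apply: (@le_trans _ _ (lebesgue_complex n.+1 (@unit_ball R n.+1))).
    apply: le_measure; rewrite ?inE; last by move=> w [].
    - by apply: measurableI; [exact: measurable_kap_lt|exact: measurable_unit_ball].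
    - exact: measurable_unit_ball.
  apply: le_trans (lebesgue_complex_ball_le _) _; rewrite lee_fin /C mulrDl.
  apply: (@le_trans _ _ (4 ^+ n.+1 * 2 ^+ n.+2 * t ^+ n.+2)); last first.
    by rewrite lerDr mulr_ge0 ?exprn_ge0// ltW.
  rewrite -mulrA -exprMn ler_peMr ?exprn_ge0// exprn_ege1//.
  by move: t1; lra.
have [[w0 [/= w0t w0B]]|noA] := pselect (exists w, kap z w < t /\ unit_ball w); last first.
  rewrite (_ : _ `&` _ = set0).
    by rewrite measure0 lee_fin mulr_ge0 ?exprn_ge0 1?ltW// addr_gt0.
  by apply/seteqP; split => // w [/= wt wB]; apply: noA; exists w.
have [j zj] := kap_large_coord w0B (ltW (lt_le_trans w0t t1)).
have zj0 : 0 < normc (tnth z j).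
  by apply: lt_le_trans zj; rewrite invr_gt0 mulr_gt0.
have l0 : 0 <= Num.sqrt (2 * t) by exact: sqrtr_ge0.
have rho0 : 0 <= 4 * n.+1%:R * t by rewrite !mulr_ge0// ltW.
pose a k : R := cRe (nth 0 z k); pose b k : R := cIm (nth 0 z k).
have nthE (i : 'I_n.+1) : nth 0 z i = tnth z i by rewrite (tnth_nth 0).
apply: le_trans (_ : _ <= (((2 * Num.sqrt (2 * t)) ^+ 2) ^+ n *
    (2 * (4 * n.+1%:R * t)) ^+ 2)%:E)%E _.
  apply: (@lebesgue_complex_slab _ _ _ l0 rho0 n j a b).
  - by apply: measurableI; [exact: measurable_kap_lt|exact: measurable_unit_ball].
  - move=> w [/= wt wB] i _; rewrite /a /b nthE.
    have := dist_coord i zB wB.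
    set x := _ - _; set y := _ - _ => xy.
    have sq (r s : R) : r ^+ 2 + s ^+ 2 <= 2 * kap z w -> `|r| <= Num.sqrt (2 * t).
      move=> rs; rewrite -sqrtr_sqr ler_sqrt ?mulr_ge0//; last exact: ltW.
      by have := sqr_ge0 s; move: rs wt; lra.
    by split; [exact: sq xy|apply: (sq _ x); rewrite addrC].
  - move=> w w' [/= wt wB] [/= wt' wB'] ww'.
    have H := cdot_sub_coord z ww'.
    have D : normc (tnth w j - tnth w' j) <= 4 * n.+1%:R * t.
      apply: (@le_trans _ _ (2 * t / normc (tnth z j))).
        rewrite ler_pdivlMr// mulrC; move: H wt wt'; lra.
      rewrite ler_pdivrMr//.
      have -> : 2 * t = 4 * n.+1%:R * t * (2 * n.+1%:R)^-1.
        by field; rewrite gt_eqF.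
      by rewrite ler_wpM2l.
    split; apply: le_trans D; [have := normc_Re (tnth w j - tnth w' j)|
      have := normc_Im (tnth w j - tnth w' j)];
    by rewrite ?cReD ?cReN ?cImD ?cImN.
rewrite lee_fin /C [leRHS]mulrDl.
have -> : (2 * Num.sqrt (2 * t)) ^+ 2 = 8 * t.
  by rewrite exprMn sqr_sqrtr ?mulr_ge0 ?ltW//; ring.
have -> : (8 * t) ^+ n * (2 * (4 * n.+1%:R * t)) ^+ 2 =
    8 ^+ n * (8 * n.+1%:R) ^+ 2 * t ^+ n.+2.
  by rewrite exprMn -(addn2 n) exprD; ring.
by rewrite lerDl mulr_ge0 ?exprn_ge0// ltW.
Qed.

End ball_volume.

(** * Integrals of negative powers *)

Section negative_powers.
Context {R : realType}.

Lemma nneseries_geometric_le (a r : R) : 0 <= a -> 0 <= r < 1 ->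
  (\sum_(k <oo) (a * r ^+ k)%:E <= (a / (1 - r))%:E)%E.
Proof.
move=> a0 /andP[r0 r1]; apply: lime_le.
  by apply: is_cvg_nneseries => k _ _; rewrite lee_fin mulr_ge0 ?exprn_ge0.
apply: nearW => n; rewrite sumEFin lee_fin.
have -> : \sum_(0 <= k < n) a * r ^+ k = series (geometric a r) n by [].
rewrite geometric_seriesE ?lt_eqF//= ler_pM2r ?invr_gt0 ?subr_gt0//.
by rewrite ler_piMr// gerBl exprn_ge0.
Qed.

Lemma powR_half_lt1 (r : R) : 0 < r -> (2^-1 : R) `^ r < 1.
Proof.
move=> r0; have : (2^-1 : R) `^ r < 1 `^ r.
  by apply: gt0_ltr_powR; rewrite ?nnegrE//; lra.
by rewrite powR1.
Qed.

Lemma dyadic_scale (g : R) : 0 < g -> g <= 2 ->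
  exists k : nat, 2^-1 ^+ k < g <= 2 * 2^-1 ^+ k.
Proof.
move=> g0 g2.
have ex : exists k : nat, 2^-1 ^+ k < g.
  exists (Num.bound g^-1).
  rewrite exprVn -[ltRHS]invrK ltf_pV2 ?posrE ?invr_gt0 ?exprn_gt0//.
  apply: (@lt_trans _ _ (Num.bound g^-1)%:R).
    by apply: archi_boundP; rewrite invr_ge0 ltW.
  by rewrite -natrX ltr_nat ltn_expl.
case: (ex_minnP ex) => -[|k] hk kmin; first by exists 0%N; rewrite hk expr0 mulr1.
exists k.+1; rewrite hk /= exprS mulrA mulfV// mul1r leNgt.
by apply/negP => /kmin; rewrite ltnn.
Qed.

(** Dyadic decomposition: where 2^-k < g <= 2 * 2^-k, the k-th term alone dominates g^-s. The bounds
    on the sublevel sets then sum to a geometric series of ratio 2^-(sigma - s). *)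
Lemma integral_neg_power_le d (T : measurableType d)
    (mu : {measure set T -> \bar R}) (D : set T) (g : T -> R) (C sigma s : R) :
  measurable D -> measurable_fun setT g -> 0 <= C -> 0 <= s -> s < sigma ->
  (forall x, D x -> 0 < g x <= 2) ->
  (forall t, 0 < t -> (mu (D `&` [set x | g x < t])%R <= (C * t `^ sigma)%:E)%E) ->
  (\int[mu]_(x in D) (g x `^ (- s))%:E <=
    (C * 4 `^ sigma / (1 - 2^-1 `^ (sigma - s)))%:E)%E.
Proof.
move=> mD mg C0 s0 ss gD muD.
pose b k : R := 2^-1 ^+ k.
have b0 k : 0 < b k by rewrite exprn_gt0.
(* The factor 4, rather than 2, places the layer g <= 2 * b k inside a strict sublevel set. *)
pose A k := D `&` [set x | g x < 4 * b k].
have mA k : measurable (A k).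
  apply: measurableI => //; rewrite -[X in measurable X]setTI.
  rewrite (_ : [set x | _] = g @^-1` `]-oo, 4 * b k[).
    by apply: mg => //; exact: measurable_itv.
  by apply/seteqP; split => w; rewrite /= in_itv.
pose f k (x : T) : \bar R := (b k `^ (- s) * \1_(A k) x)%:E.
have f0 k x : (0 <= f k x)%E by rewrite lee_fin mulr_ge0 ?powR_ge0.
apply: (@le_trans _ _ (\int[mu]_(x in D) \sum_(k <oo) f k x)%E).
  apply: ge0_le_integral_mono => x Dx; first by rewrite lee_fin powR_ge0.
  have /andP[g0 g2] := gD x Dx.
  have [k /andP[kg gk]] := dyadic_scale g0 g2.
  apply: le_trans (nneseries_lim_ge k.+1 _) => //.
  rewrite big_nat_recr//= -[leLHS]add0e; apply: leeD; first by rewrite sume_ge0.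
  rewrite /f indicE mem_set; last by split => //=; move: gk (b0 k); rewrite /b; lra.
  rewrite mulr1 lee_fin !powRN lef_pV2 ?posrE ?powR_gt0//.
  by apply: ge0_ler_powR => //; rewrite ?nnegrE; exact: ltW.
rewrite integral_nneseries//; last first.
  by move=> k; apply/measurable_EFinP/measurable_funM => //; exact: measurable_indic.
have r1 : 0 <= (2^-1 : R) `^ (sigma - s) < 1.
  by rewrite powR_ge0 powR_half_lt1// subr_gt0.
apply: le_trans (nneseries_geometric_le _ r1); last by rewrite mulr_ge0 ?powR_ge0.
apply: lee_nneseries => [k _ _|k _]; first exact: integral_ge0.
under eq_integral do rewrite /f EFinM.
rewrite ge0_integralZl ?lee_fin ?powR_ge0//; last first.
  by apply/measurable_EFinP; exact: measurable_indic.
rewrite integral_indic// setIidl; last by move=> x [].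
apply: (@le_trans _ _ ((b k `^ (- s))%:E * (C * (4 * b k) `^ sigma)%:E)%E).
  by apply: lee_wpmul2l; [rewrite lee_fin powR_ge0|apply: muD; rewrite mulr_gt0].
rewrite -EFinM lee_fin powRM//; last exact: ltW.
have -> : (2^-1 `^ (sigma - s)) ^+ k = b k `^ sigma * b k `^ (- s) :> R.
  rewrite -powRD; last by apply/implyP => _; rewrite gt_eqF.
  by rewrite -powR_mulrn ?powR_ge0// powRAC powR_mulrn.
by rewrite le_eqVlt; apply/orP; left; apply/eqP; ring.
Qed.

End negative_powers.

Section ball_integrals.
Context {R : realType}.
Local Notation leb := (@lebesgue_measure R).

(** Below the exponent n + 2 the integral stays bounded as [z] approaches the sphere; [kap_volume]
    is exactly the sublevel estimate with sigma = n + 2. *)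
Lemma forelli_rudin n (s : R) : 0 <= s -> s < n.+2%:R -> exists2 C : R, 0 < C &
  forall z : n.+1.-tuple R[i], unit_ball z ->
  (\int[ball_measure n.+1]_(w in @unit_ball R n.+1) (kap z w `^ (- s))%:E <= C%:E)%E.
Proof.
move=> s0 sn; have [C C0 HC] := @kap_volume R n.
exists (C * 4 `^ n.+2%:R / (1 - 2^-1 `^ (n.+2%:R - s))).
  rewrite divr_gt0 ?mulr_gt0 ?powR_gt0// subr_gt0.
  by rewrite powR_half_lt1// subr_gt0.
move=> z zB; apply: integral_neg_power_le => //.
- exact: measurable_unit_ball.
- exact: measurable_kap.
- exact: ltW.
- by move=> w wB; rewrite kap_gt0// kap_le2.
- move=> t t0; rewrite powR_mulrn; last exact: ltW.
  apply: le_trans (HC z t zB t0); apply: le_measure; rewrite ?inE//.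
    by apply: measurableI; [exact: measurable_unit_ball|exact: measurable_kap_lt].
  exact: measurable_kap_lt.
Qed.

(** For y and y0 of the same sign, (y - y0)^2 <= |y^2 - y0^2| < t, so on each half-line the set lies
    in an interval of half length sqrt t. *)
Lemma sqr_shell_measure (A t : R) : 0 < t ->
  (leb [set y : measurableTypeR R | (A - t < y ^+ 2 < A)%R] <= (4 * Num.sqrt t)%:E)%E.
Proof.
move=> t0; set S := [set y | _].
have mS : measurable S.
  rewrite -[S]setTI (_ : S = (fun y : R => y ^+ 2) @^-1` `]A - t, A[).
    have mf : measurable_fun setT (fun y : measurableTypeR R => y ^+ 2).
      exact: measurable_funX.
    by apply: mf => //; exact: measurable_itv.
  by apply/seteqP; split => w; rewrite /S /= in_itv.
have half (P : set (measurableTypeR R)) : measurable P ->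
    (forall x y, P x -> P y -> 0 <= x * y) ->
    (leb (S `&` P) <= (2 * Num.sqrt t)%:E)%E.
  move=> mP Psgn.
  have [[y0 [S0 P0]]|no] := pselect (exists y, S y /\ P y); last first.
    rewrite (_ : _ `&` _ = set0).
      by rewrite measure0 lee_fin mulr_ge0 ?sqrtr_ge0.
    by apply/seteqP; split => // w [/= wS wP]; apply: no; exists w.
  rewrite -(lebesgue_measure_center y0 (sqrtr_ge0 t)).
  apply: le_measure; rewrite ?inE; [exact: measurableI|exact: measurable_itv|].
  move=> y [Sy Py]; rewrite interval_center -sqrtr_sqr ler_sqrt; last exact: ltW.
  have := Psgn _ _ Py P0; move: Sy S0; rewrite /S /= => /andP[y1 y2] /andP[y3 y4] yy.
  have [yle|yle] := leP (y ^+ 2) (y0 ^+ 2).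
    by have : y ^+ 2 <= y * y0; [|rewrite sqrrB; lra]; nra.
  by have : y0 ^+ 2 <= y * y0; [|rewrite sqrrB; lra]; nra.
have -> : S = (S `&` `[0, +oo[) `|` (S `&` `]-oo, 0[).
  rewrite -setIUr -[LHS]setIT; congr (_ `&` _).
  apply/seteqP; split => // y _ /=; rewrite !in_itv /= andbT.
  by have [|] := leP 0 y; [left|right].
apply: le_trans (measureU2 _ _ _) _; try exact: measurableI.
have -> : (4 * Num.sqrt t)%:E = ((2 * Num.sqrt t)%:E + (2 * Num.sqrt t)%:E)%E.
  by rewrite -EFinD; congr EFin; ring.
apply: leeD; apply: half; try exact: measurable_itv.
- by move=> x y; rewrite /= !in_itv /= !andbT; exact: mulr_ge0.
- by move=> x y; rewrite /= !in_itv /= => x0 y0; rewrite mulr_le0// ltW.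
Qed.

(** The true order is t. Slicing along the imaginary part of the first coordinate gives sqrt t
    uniformly in the slice, and some positive power is all that the weight in [Tb_weight]
    requires. *)
Lemma shell_volume n : exists2 C : R, 0 < C & forall t : R, 0 < t ->
  (ball_measure n.+1 ([set w : n.+1.-tuple R[i] | 1 - sqn w < t])%R <=
    (C * Num.sqrt t)%:E)%E.
Proof.
exists ((fine (lebesgue_complex n.+1 (@unit_ball R n.+1)))^-1 * (8 * 4 ^+ n)).
  by rewrite mulr_gt0 ?invr_gt0 ?ball_volume_gt0// mulr_gt0// exprn_gt0.
move=> t t0; rewrite -mulrA; apply: ball_measure_le.
set A := _ `&` _.
have mA : measurable A.
  apply: measurableI; last exact: measurable_unit_ball.
  rewrite -[X in measurable X]setTI.
  rewrite (_ : [set w | _] = (@sqn R n.+1) @^-1` `]1 - t, +oo[).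
    by apply: (@measurable_sqn R n.+1) => //; exact: measurable_itv.
  by apply/seteqP; split => w; rewrite /= in_itv /= andbT; lra.
have sqn_cons (u : n.-tuple R[i]) (x y : R) :
    sqn (cons_complex (u, x, y)) = x ^+ 2 + y ^+ 2 + sqn u.
  rewrite /sqn big_ord_recl tnth0 normc_sqE /=; congr (_ + _).
  by apply: eq_bigr => i _; rewrite tnthS.
rewrite lebesgue_complex_tail//.
have -> : (8 * 4 ^+ n * Num.sqrt t)%:E =
   (((4 * Num.sqrt t) * (2 * 1))%:E *
    lebesgue_complex n (cbox n (fun=> 0%R) (fun=> 0%R) (fun=> 1%R)))%E.
  rewrite lebesgue_complex_cbox_cst// -EFinM; congr EFin.
  rewrite mulr1 (_ : (2:R) ^+ 2 = 4); [ring|by rewrite -natrX].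
have out (u : n.-tuple R[i]) x y : A (cons_complex (u, x, y)) ->
    cbox n (fun=> 0) (fun=> 0) (fun=> 1) u /\ `|x| <= 1.
  move=> [_ uB]; split.
    move=> i; have := sub_unit_ball_cbox uB (lift ord0 i).
    by rewrite tnthS.
  by have [] := sub_unit_ball_cbox uB ord0; rewrite tnth0 /= subr0.
apply: le_integral_indic => //.
- exact: measurable_cbox.
- by move=> u; exact: integral_ge0.
- move=> u _; rewrite EFinM -(lebesgue_measure_center 0 ler01).
  apply: le_integral_indic => //.
  + move=> x _; apply: le_trans (sqr_shell_measure (1 - x ^+ 2 - sqn u) t0).
    apply: le_measure; rewrite ?inE.
    * exact: measurable_section_head.
    * rewrite -[X in measurable X]setTI.
      rewrite (_ : [set y | _] = (fun y : R => y ^+ 2) @^-1`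
          `]1 - x ^+ 2 - sqn u - t, 1 - x ^+ 2 - sqn u[).
        have mf : measurable_fun setT (fun y : measurableTypeR R => y ^+ 2).
          exact: measurable_funX.
        by apply: mf => //; exact: measurable_itv.
      by apply/seteqP; split => w; rewrite /= in_itv.
    * move=> y [/=]; rewrite unit_ballP sqn_cons => h1 h2.
      by apply/andP; split; lra.
  + move=> x; rewrite interval_center subr0 => xI.
    rewrite (_ : [set y | _] = set0) ?measure0//.
    by apply/seteqP; split => // y /out[].
- move=> u ub; apply: integral0_eq => x _.
  rewrite (_ : [set y | _] = set0) ?measure0//.
  by apply/seteqP; split => // y /out[].
Qed.

Lemma shell_integral n (s : R) : 0 <= s -> s < 2^-1 -> exists2 C : R, 0 < C &
  (\int[ball_measure n.+1]_(w in @unit_ball R n.+1) ((1 - sqn w) `^ (- s))%:E <= C%:E)%E.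
Proof.
move=> s0 sn; have [C C0 HC] := shell_volume n.
exists (C * 4 `^ 2^-1 / (1 - 2^-1 `^ (2^-1 - s))).
  rewrite divr_gt0 ?mulr_gt0 ?powR_gt0// subr_gt0.
  by rewrite powR_half_lt1// subr_gt0.
have mg : measurable_fun setT (fun w : n.+1.-tuple R[i] => 1 - sqn w).
  by apply: measurable_funB => //; exact: measurable_sqn.
apply: integral_neg_power_le => //.
- exact: measurable_unit_ball.
- exact: ltW.
- by move=> w; rewrite unit_ballP => wB; have := sqn_ge0 w; lra.
- move=> t t0; rewrite powR12_sqrt; last exact: ltW.
  have mS : measurable [set w : n.+1.-tuple R[i] | 1 - sqn w < t].
    rewrite -[X in measurable X]setTI.
    rewrite (_ : [set w | _] = (fun w => 1 - sqn w) @^-1` `]-oo, t[).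
      by apply: mg => //; exact: measurable_itv.
    by apply/seteqP; split => w; rewrite /= in_itv.
  apply: le_trans (HC t t0); apply: le_measure; rewrite ?inE//.
  by apply: measurableI => //; exact: measurable_unit_ball.
Qed.

End ball_integrals.

(** * The kernel *)

Section lipschitz.
Context {R : realType}.

Lemma derive_lipschitz (f df : R -> R) (a b K : R) : a <= b ->
  (forall x : R, a <= x <= b -> is_derive x (1 : R) f (df x)) ->
  (forall x, a <= x <= b -> `|df x| <= K) -> `|f b - f a| <= K * (b - a).
Proof.
move=> ab fdf dfK.
have [||c] := @MVT_segment R f df a b ab.
- by move=> x; rewrite in_itv /= => /andP[xa xb]; apply: fdf; rewrite !ltW.
- apply: derivable_within_continuous => x; rewrite in_itv /= => xab.
  by exact: (@ex_derive _ _ _ _ _ _ _ (fdf x xab)).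
rewrite in_itv /= => cab ->; rewrite normrM [X in _ * X]ger0_norm ?subr_ge0//.
by rewrite ler_wpM2r ?subr_ge0 ?dfK.
Qed.

Lemma derive_lipschitzT (f df : R -> R) (K : R) :
  (forall x : R, is_derive x (1 : R) f (df x)) -> (forall x, `|df x| <= K) ->
  forall x y, `|f x - f y| <= K * `|x - y|.
Proof.
move=> fdf dfK x y.
have [xy|/ltW xy] := leP x y.
  rewrite distrC [X in _ * X]distrC [X in _ * X]ger0_norm ?subr_ge0//.
  exact: (@derive_lipschitz f df).
rewrite [X in _ * X]ger0_norm ?subr_ge0//.
exact: (@derive_lipschitz f df).
Qed.

Lemma cos_lipschitz (x y : R) : `|cos x - cos y| <= `|x - y|.
Proof.
rewrite -[leRHS]mul1r; apply: (@derive_lipschitzT _ (fun x => - sin x)) => z.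
by rewrite normrN ler_norml sin_geN1 sin_le1.
Qed.

Lemma sin_lipschitz (x y : R) : `|sin x - sin y| <= `|x - y|.
Proof.
rewrite -[leRHS]mul1r; apply: (@derive_lipschitzT _ cos) => z.
by rewrite ler_norml cos_geN1 cos_le1.
Qed.

Lemma atan_lipschitz (x y : R) : `|atan x - atan y| <= `|x - y|.
Proof.
rewrite -[leRHS]mul1r; apply: (@derive_lipschitzT _ (fun x => (1 + x ^+ 2)^-1)) => z.
have z1 : 0 < 1 + z ^+ 2 by rewrite ltr_pwDl// sqr_ge0.
by rewrite gtr0_norm ?invr_gt0// invf_le1// lerDl sqr_ge0.
Qed.

Lemma expR_dist (x y : R) : `|expR x - expR y| <= Num.max (expR x) (expR y) * `|x - y|.
Proof.
wlog xy : x y / x <= y.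
  move=> H; have [|/ltW] := leP x y; first exact: H.
  by move=> /H; rewrite distrC maxC [X in _ * X]distrC.
have exy : expR x <= expR y by rewrite ler_expR.
rewrite max_r// distrC [X in _ * X]distrC !ger0_norm ?subr_ge0//.
have := expR_ge1Dx (x - y); rewrite expRD expRN => H.
have e0 := expR_gt0 y.
have : expR y * (1 + (x - y)) <= expR y * (expR x / expR y) by rewrite ler_pM2l.
by rewrite mulrCA mulfV ?mulr1 ?gt_eqF//; lra.
Qed.

Lemma ln_dist_le (x y e : R) : 0 < e -> e <= x -> e <= y -> `|ln x - ln y| <= `|x - y| / e.
Proof.
move=> e0 ex ey.
wlog xy : x y ex ey / x <= y.
  move=> H; have [|/ltW] := leP x y; first exact: H.
  by move=> /H; rewrite distrC [X in _ <= X / _]distrC; apply.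
have x0 : 0 < x by lra.
have y0 : 0 < y by lra.
rewrite distrC [X in _ <= X / _]distrC !ger0_norm ?subr_ge0 ?ler_ln ?posrE//.
rewrite -ln_div ?posrE//.
have -> : y / x = 1 + (y - x) / x by field; rewrite gt_eqF.
apply: le_trans (le_ln1Dx _) _.
  by apply: (@lt_le_trans _ _ 0); [lra|apply: divr_ge0; lra].
by rewrite ler_wpM2l ?subr_ge0// lef_pV2 ?posrE.
Qed.

(** Inversion is discontinuous at 0; writing x^-1 as x * (x^2)^-1, valid at 0 too since 0^-1 = 0,
    reduces it to the measurability of real powers. *)
Lemma measurable_invr : measurable_fun [set: R] (fun x : R => x^-1).
Proof.
rewrite (_ : (fun x => _) = fun x : R => x * (x ^+ 2) `^ (-1)).
  apply: measurable_funM => //.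
  by apply: (measurableT_comp (measurable_powR (-1))); exact: measurable_funX.
apply/funext => x; rewrite powR_inv1 ?sqr_ge0//.
have [->|x0] := eqVneq x 0; first by rewrite invr0 mul0r.
by rewrite expr2 invfM mulrA mulfV// mul1r.
Qed.

End lipschitz.

Section kernel.
Context {R : realType}.
Variable alpha : R.
Hypothesis alpha0 : 0 <= alpha.
Implicit Types a b : R.

Local Notation mo a b := (Num.sqrt (a ^+ 2 + b ^+ 2)).

(** For a > 0, [kerR] and [kerI] are the real and imaginary parts of (a + i b)^-alpha for the
    principal branch (see [cpowV]): in the right half-plane the argument is atan (b / a). *)
Definition kerR a b : R := mo a b `^ (- alpha) * cos (alpha * atan (b / a)).
Definition kerI a b : R := - (mo a b `^ (- alpha) * sin (alpha * atan (b / a))).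

Lemma modulus_gt0 a b : 0 < a -> 0 < mo a b.
Proof. by move=> a0; rewrite sqrtr_gt0 ltr_wpDr ?sqr_ge0// exprn_gt0. Qed.

Lemma le_modulus a b : 0 < a -> a <= mo a b.
Proof.
move=> a0; rewrite -[leLHS](gtr0_norm a0) -sqrtr_sqr ler_sqrt ?lerDl ?sqr_ge0//.
by rewrite addr_ge0 ?sqr_ge0.
Qed.

Lemma norm_le_modulus a b : `|b| <= mo a b.
Proof. by rewrite -sqrtr_sqr ler_sqrt ?lerDr ?sqr_ge0// addr_ge0 ?sqr_ge0. Qed.

(** Both angles have the same cosine, by cos (atan t) = 1 / sqrt (1 + t^2), and the sign of b
    selects the branch of [acos]. *)
Lemma carg_atan a b : 0 < a -> carg (Complex a b) = atan (b / a).
Proof.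
move=> a0; rewrite /carg /=.
have -> : a / mo a b = cos (atan (b / a)).
  rewrite cos_atan; have -> : 1 + (b / a) ^+ 2 = (a ^+ 2 + b ^+ 2) / a ^+ 2.
    by field; rewrite gt_eqF.
  rewrite sqrtrM ?addr_ge0 ?sqr_ge0// sqrtrV ?sqr_ge0// sqrtr_sqr gtr0_norm//.
  by rewrite invfM invrK mulrC.
have [t1 t2] := (atan_gtNpi2 (b / a), atan_ltpi2 (b / a)).
have p0 := @pi_gt0 R.
case: ifPn => [b0|]; last rewrite -ltNge => b0.
  have : atan 0 <= atan (b / a) by apply: le_atan; rewrite divr_ge0// ltW.
  by rewrite atan0 => t0; rewrite cosK// in_itv /= t0 /=; lra.
have : atan (b / a) <= atan 0.
  by apply: le_atan; rewrite mulr_le0_ge0 ?invr_ge0 ?ltW.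
by rewrite atan0 => t0; rewrite cosKN ?opprK//; apply/andP; split; lra.
Qed.

Lemma cpowV a b : 0 < a ->
  (cpow (Complex a b) alpha)^-1 = Complex (kerR a b) (kerI a b).
Proof.
move=> a0; apply: mulr1_eq.
have m0 := modulus_gt0 b a0.
rewrite /cpow /cLog /cexp carg_atan//= !mul0r subr0 addr0.
rewrite /kerR /kerI powRN /powR gt_eqF//.
set e := expR _; set t := alpha * _.
have e0 : e != 0 by rewrite gt_eqF// expR_gt0.
apply/eqP; rewrite eq_complex /= !mul0r !subr0 !addr0; apply/andP; split; apply/eqP.
  have -> : e * cos t * (e^-1 * cos t) - e * sin t * - (e^-1 * sin t) =
    (e / e) * (cos t ^+ 2 + sin t ^+ 2) by ring.
  by rewrite cos2Dsin2 mulfV// mulr1.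
by ring.
Qed.

Lemma ker_sqr a b : kerR a b ^+ 2 + kerI a b ^+ 2 = (mo a b `^ (- alpha)) ^+ 2.
Proof.
rewrite /kerR /kerI; set e := _ `^ _; set t := alpha * _.
have -> : (e * cos t) ^+ 2 + (- (e * sin t)) ^+ 2 = e ^+ 2 * (cos t ^+ 2 + sin t ^+ 2).
  by ring.
by rewrite cos2Dsin2 mulr1.
Qed.

Lemma ker_normE a b : normc (Complex (kerR a b) (kerI a b)) = mo a b `^ (- alpha).
Proof. by rewrite /= ker_sqr sqrtr_sqr ger0_norm// powR_ge0. Qed.

(* |e^A cos B - e^A' cos B'| + |e^A sin B - e^A' sin B'| is controlled by
   |A - A'| + |B - B'|; here A = - alpha ln |x| and B = alpha arg x. *)
Lemma ker_dist a b a' b' (M dl dt : R) : 0 < a -> 0 < a' ->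
  mo a b `^ (- alpha) <= M -> mo a' b' `^ (- alpha) <= M ->
  `|ln (mo a b) - ln (mo a' b')| <= dl ->
  `|atan (b / a) - atan (b' / a')| <= dt ->
  `|kerR a b - kerR a' b'| <= M * (alpha * (dl + dt)) /\
  `|kerI a b - kerI a' b'| <= M * (alpha * (dl + dt)).
Proof.
move=> a0 a0' eM eM' Hl Ht.
have m0 := modulus_gt0 b a0; have m0' := modulus_gt0 b' a0'.
have ee : `|mo a b `^ (- alpha) - mo a' b' `^ (- alpha)| <= M * (alpha * dl).
  rewrite /powR !gt_eqF//; apply: le_trans (expR_dist _ _) _.
  apply: ler_pM => //.
    by rewrite ge_max; move: eM eM'; rewrite /powR !gt_eqF// => -> ->.
  by rewrite !mulNr opprK addrC -mulrBr normrM ger0_norm// distrC ler_wpM2l.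
have e0 : 0 <= mo a b `^ (- alpha) by exact: powR_ge0.
have e0' : 0 <= mo a' b' `^ (- alpha) by exact: powR_ge0.
have tt : `|alpha * atan (b / a) - alpha * atan (b' / a')| <= alpha * dt.
  by rewrite -mulrBr normrM ger0_norm// ler_wpM2l.
(* [f] will be cos and sin; the product rule separates the change of modulus from the change of
   angle. *)
have gen (f : R -> R) : (forall x, `|f x| <= 1) -> (forall x y, `|f x - f y| <= `|x - y|) ->
    `|mo a b `^ (- alpha) * f (alpha * atan (b / a)) -
      mo a' b' `^ (- alpha) * f (alpha * atan (b' / a'))| <= M * (alpha * (dl + dt)).
  move=> f1 flip; set e := _ `^ _; set e' := _ `^ _; set t := alpha * _; set t' := alpha * _.
  have -> : e * f t - e' * f t' = (e - e') * f t + e' * (f t - f t') by ring.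
  have -> : M * (alpha * (dl + dt)) = M * (alpha * dl) + M * (alpha * dt) by ring.
  apply: le_trans (ler_normD _ _) _; apply: lerD.
    by rewrite normrM -[leRHS]mulr1; apply: ler_pM.
  rewrite normrM ger0_norm//; apply: ler_pM => //.
  exact: le_trans (flip _ _) tt.
split.
  by apply: gen; [move=> x; rewrite ler_norml cos_geN1 cos_le1|exact: cos_lipschitz].
rewrite /kerI -opprD normrN.
by apply: gen; [move=> x; rewrite ler_norml sin_geN1 sin_le1|exact: sin_lipschitz].
Qed.

Lemma modulus_dist a b a' b' : `|mo a b - mo a' b'| <= `|a - a'| + `|b - b'|.
Proof.
have tri (x y x' y' : R) : mo x y <= mo x' y' + (`|x - x'| + `|y - y'|).
  have /= H := @le_normcD R (Complex x' y') (Complex (x - x') (y - y')).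
  have Ex : x' + (x - x') = x by ring.
  have Ey : y' + (y - y') = y by ring.
  rewrite Ex Ey in H.
  apply: le_trans H _; rewrite lerD2l.
  exact: (normc_ReIm (Complex (x - x') (y - y'))).
rewrite ler_norml; apply/andP; split.
  by have := tri a' b' a b; rewrite (distrC a') (distrC b'); lra.
by have := tri a b a' b'; lra.
Qed.

(** The derivative of t -> atan (b / t) is -b / (t^2 + b^2). For t >= a its absolute value is at
    most 1 / |a + i b|, because |b| <= |a + i b|. *)
Lemma atan_shift a b (h : R) : 0 < a -> 0 <= h ->
  `|atan (b / a) - atan (b / (a + h))| <= h / mo a b.
Proof.
move=> a0 h0; have m0 := modulus_gt0 b a0.
have -> : h / mo a b = (mo a b)^-1 * (a + h - a) by ring.
rewrite distrC; apply: (@derive_lipschitz R (fun t => atan (b / t))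
  (fun t => (1 + (b / t) ^+ 2)^-1 * (b * - t ^- 2))).
- by rewrite lerDl.
- move=> t /andP[ta _]; have t0 : 0 < t by lra.
  have tn0 : id t != 0 by rewrite gt_eqF.
  have di := is_deriveZ b (is_deriveV tn0 (is_derive_id t (1 : R))).
  have := @is_derive1_comp _ atan (fun y => b * y^-1) t _ _ (is_derive1_atan (b / t)) di.
  have -> // : b *: (- t ^- 2)%:A = b * - t ^- 2 by rewrite /GRing.scale /= mulr1.
- move=> t /andP[ta _]; have t0 : 0 < t by lra.
  have -> : (1 + (b / t) ^+ 2)^-1 * (b * - t ^- 2) = - (b / (t ^+ 2 + b ^+ 2)).
    by field; apply/andP; split; rewrite gt_eqF// ltr_wpDr ?sqr_ge0 ?exprn_gt0.
  rewrite normrN normrM normfV [X in _ / X]ger0_norm ?addr_ge0 ?sqr_ge0//.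
  rewrite ler_pdivrMr; last by rewrite ltr_wpDr ?sqr_ge0// exprn_gt0.
  apply: (@le_trans _ _ (mo a b)); first exact: norm_le_modulus.
  rewrite mulrC ler_pdivlMr// -expr2 sqr_sqrtr ?addr_ge0 ?sqr_ge0// lerD2r.
  by apply: lerXn2r; rewrite ?nnegrE; lra.
Qed.

(** A shift to the right moves both the logarithm of the modulus and the argument by at most h /
    |x|, and it does not decrease the modulus. So [M] in [ker_dist] can be the unshifted |x|^-alpha,
    and the relative error is of order h / |x|. *)
Lemma ker_shift a b (h : R) : 0 < a -> 0 <= h ->
  normc (Complex (kerR a b - kerR (a + h) b) (kerI a b - kerI (a + h) b)) <=
  4 * alpha * mo a b `^ (- alpha) * (h / mo a b).
Proof.
move=> a0 h0; have m0 := modulus_gt0 b a0.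
have ah0 : 0 < a + h by rewrite ltr_wpDr.
have mah : mo a b <= mo (a + h) b.
  rewrite ler_sqrt ?addr_ge0 ?sqr_ge0// lerD2r.
  by apply: lerXn2r; rewrite ?nnegrE; lra.
have m0' : 0 < mo (a + h) b by exact: lt_le_trans m0 mah.
have [//||||H1 H2] := @ker_dist a b (a + h) b (mo a b `^ (- alpha))
    (h / mo a b) (h / mo a b) a0 ah0.
- rewrite !powRN lef_pV2 ?posrE ?powR_gt0//.
  by apply: ge0_ler_powR => //; rewrite nnegrE; lra.
- apply: le_trans (ln_dist_le m0 _ _) _ => //.
  rewrite ler_wpM2r ?invr_ge0 ?sqrtr_ge0//.
  apply: le_trans (modulus_dist _ _ _ _) _.
  by rewrite subrr normr0 addr0 opprD addrA subrr add0r normrN ger0_norm.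
- exact: atan_shift.
by apply: le_trans (normc_ReIm _) _; move: H1 H2 => /=; lra.
Qed.

Lemma ker_lipschitz (h M : R) : 0 < h -> exists2 L : R, 0 <= L &
  forall a b a' b', h <= a -> h <= a' -> `|b| <= M -> `|b'| <= M ->
  `|kerR a b - kerR a' b'| <= L * (`|a - a'| + `|b - b'|) /\
  `|kerI a b - kerI a' b'| <= L * (`|a - a'| + `|b - b'|).
Proof.
(* The power of [h] bounds the kernel; the first [h^-1] bounds the variation of the logarithm, and
   the remaining sum that of b / a, hence of the argument. *)
move=> h0; pose L := h `^ (- alpha) * (alpha * (h^-1 + (h^-1 + `|M| / h ^+ 2))).
exists L.
  by rewrite mulr_ge0 ?powR_ge0// mulr_ge0// !addr_ge0// ?divr_ge0 ?sqr_ge0// invr_ge0 ltW.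
move=> a b a' b' ha ha' bM bM'.
have a0 : 0 < a by lra.
have a0' : 0 < a' by lra.
set D := `|a - a'| + `|b - b'|.
have D0 : 0 <= D by rewrite addr_ge0.
have ma := le_modulus b a0; have ma' := le_modulus b' a0'.
have pw x : h <= x -> x `^ (- alpha) <= h `^ (- alpha).
  move=> hx; have x0 : 0 < x by lra.
  rewrite !powRN lef_pV2 ?posrE ?powR_gt0//.
  by apply: ge0_ler_powR => //; rewrite nnegrE; lra.
have [||||H1 H2] := @ker_dist a b a' b' (h `^ (- alpha))
    (D / h) (D / h + `|M| * D / h ^+ 2) a0 a0'.
- by apply: pw; lra.
- by apply: pw; lra.
- apply: le_trans (@ln_dist_le _ _ _ h h0 _ _) _; [lra|lra|].
  by rewrite ler_wpM2r ?modulus_dist// invr_ge0 ltW.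
- apply: le_trans (atan_lipschitz _ _) _.
  have -> : b / a - b' / a' = (b - b') / a + b' * (a' - a) / (a * a').
    by field; rewrite !gt_eqF.
  apply: le_trans (ler_normD _ _) _; apply: lerD.
    rewrite normrM normfV (gtr0_norm a0); apply: ler_pM => //.
    - by rewrite invr_ge0 ltW.
    - by rewrite /D lerDr.
    - by rewrite lef_pV2.
  rewrite !normrM normfV (gtr0_norm (mulr_gt0 a0 a0')).
  apply: ler_pM => //.
  - by rewrite invr_ge0 ltW// mulr_gt0.
  - apply: ler_pM => //; first exact: le_trans bM' (ler_norm _).
    by rewrite /D distrC lerDl.
  - rewrite lef_pV2 ?posrE ?mulr_gt0 ?exprn_gt0// expr2.
    by apply: ler_pM => //; exact: ltW.
have LE : h `^ (- alpha) * (alpha * (D / h + (D / h + `|M| * D / h ^+ 2))) = L * D.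
  by rewrite /L; ring.
by rewrite -LE.
Qed.

Lemma measurable_kerRI d (T : measurableType d) (f g : T -> R) :
  measurable_fun setT f -> measurable_fun setT g ->
  measurable_fun setT (fun x => kerR (f x) (g x)) /\
  measurable_fun setT (fun x => kerI (f x) (g x)).
Proof.
move=> mf mg.
have mm : measurable_fun setT (fun x => mo (f x) (g x) `^ (- alpha)).
  apply: (measurableT_comp (measurable_powR (- alpha))).
  apply: (measurableT_comp (continuous_measurable_fun (@sqrt_continuous R))).
  by apply: measurable_funD; apply: measurable_funX.
have mt : measurable_fun setT (fun x => alpha * atan (g x / f x)).
  apply: measurable_funM => //.
  apply: (measurableT_comp (continuous_measurable_fun (@continuous_atan R))).
  by apply: measurable_funM => //; exact: measurableT_comp measurable_invr mf.
split; last apply: (measurableT_comp (@oppr_measurable R setT)); apply: measurable_funM => //.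
  exact: (measurableT_comp (continuous_measurable_fun (@continuous_cos R)) mt).
exact: (measurableT_comp (continuous_measurable_fun (@continuous_sin R)) mt).
Qed.

End kernel.

(** * Positive operators *)

Section ball_measure_theory.
Context {R : realType} {d : nat}.
Local Notation T := (d.-tuple R[i]).
Local Notation mu := (@ball_measure R d).
Local Notation B := (@unit_ball R d).

Lemma sigma_finite_ball_measure : sigma_finite setT mu.
Proof.
exists (fun=> setT) => [|i]; first by rewrite bigcup_const.
by split => //; rewrite ball_measureT ltry.
Qed.

Definition ball_measure_sf : {sigma_finite_measure set T -> \bar R} :=
  sigma_finite_pack sigma_finite_ball_measure.

Lemma ball_measure_setC : mu (~` B) = 0%E.
Proof. by rewrite ball_measureE setICl measure0 mule0. Qed.

Lemma ae_unit_ball (P : T -> Prop) : (forall x, B x -> P x) -> \forall x \ae mu, P x.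
Proof.
move=> BP; have : mu.-negligible (~` [set x | P x]); last by [].
exists (~` B); split.
- apply: measurableC; exact: measurable_unit_ball.
- exact: ball_measure_setC.
- by move=> x /= nP Bx; apply: nP; exact: BP.
Qed.

Lemma ball_integralE (f : T -> \bar R) : measurable_fun setT f -> (forall x, 0 <= f x)%E ->
  (\int[mu]_(x in B) f x = \int[mu]_x f x)%E.
Proof.
move=> mf f0.
have mB : measurable (~` B) by apply: measurableC; exact: measurable_unit_ball.
rewrite [RHS](@ge0_negligible_integral _ _ _ mu setT (~` B))//; last exact: ball_measure_setC.
by rewrite setTD setCK.
Qed.

Lemma ball_tonelli (h : T * T -> \bar R) : measurable_fun setT h -> (forall x, 0 <= h x)%E ->
  (\int[mu]_(z in B) \int[mu]_(w in B) h (z, w) =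
   \int[mu]_(w in B) \int[mu]_(z in B) h (z, w))%E.
Proof.
move=> mh h0.
have m1 z : measurable_fun setT (fun w => h (z, w)) by exact: measurableT_comp.
have m2 w : measurable_fun setT (fun z => h (z, w)) by exact: measurableT_comp.
have mF := @measurable_fun_fubini_tonelli_F _ _ _ _ R ball_measure_sf h mh h0.
have mG := @measurable_fun_fubini_tonelli_G _ _ _ _ R ball_measure_sf h mh h0.
under eq_integral => z _ do rewrite ball_integralE//.
under [RHS]eq_integral => w _ do rewrite ball_integralE//.
rewrite !ball_integralE//.
- exact: (@fubini_tonelli _ _ _ _ R ball_measure_sf ball_measure_sf h mh h0).
- by move=> w; exact: integral_ge0.
- by move=> z; exact: integral_ge0.
Qed.

Lemma measurable_ball_integral (h : T * T -> \bar R) :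
  measurable_fun setT h -> (forall x, 0 <= h x)%E ->
  measurable_fun setT (fun z => \int[mu]_(w in B) h (z, w))%E.
Proof.
move=> mh h0.
rewrite (_ : (fun z => _) = fubini_F ball_measure_sf h).
  exact: (@measurable_fun_fubini_tonelli_F _ _ _ _ R ball_measure_sf h mh h0).
apply/funext => z; rewrite ball_integralE//.
exact: measurableT_comp.
Qed.

Lemma measurable_kap_pair (s : R) :
  measurable_fun setT (fun x : T * T => kap x.1 x.2 `^ s).
Proof. by apply: (measurableT_comp (measurable_powR s)); exact: measurable_kap. Qed.

(** Extended-real values allow the norm estimates to be proved before any finiteness is known. *)
Definition Tb (beta : R) (f : T -> R) (z : T) : \bar R :=
  (\int[mu]_(w in B) (f w * kap z w `^ (- beta))%:E)%E.

Lemma Tb_ge0 beta f z : (forall w, 0 <= f w) -> (0 <= Tb beta f z)%E.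
Proof. by move=> f0; apply: integral_ge0 => w _; rewrite lee_fin mulr_ge0 ?powR_ge0. Qed.

Lemma measurable_Tb_pair beta (f : T -> R) : measurable_fun setT f ->
  measurable_fun setT (fun x : T * T => (f x.2 * kap x.1 x.2 `^ (- beta))%:E).
Proof.
move=> mf; apply/measurable_EFinP/measurable_funM; last exact: measurable_kap_pair.
exact: measurableT_comp mf measurable_snd.
Qed.

Lemma measurable_Tb beta (f : T -> R) : measurable_fun setT f -> (forall w, 0 <= f w) ->
  measurable_fun setT (Tb beta f).
Proof.
move=> mf f0; apply: (measurable_ball_integral (measurable_Tb_pair beta mf)) => x.
by rewrite lee_fin mulr_ge0 ?powR_ge0.
Qed.

End ball_measure_theory.

(** * A pointwise Young inequality with three weights *)

Section amgm.
Context {R : realType}.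

(** The tangent to exp at the mean [m] lies below exp, and the weighted combination of its three
    values is e^m. *)
Lemma expR_convex3 (t1 t2 t3 y1 y2 y3 : R) : 0 <= t1 -> 0 <= t2 -> 0 <= t3 ->
  t1 + t2 + t3 = 1 ->
  expR (t1 * y1 + t2 * y2 + t3 * y3) <= t1 * expR y1 + t2 * expR y2 + t3 * expR y3.
Proof.
move=> h1 h2 h3 h; set m := t1 * y1 + t2 * y2 + t3 * y3.
have tang y : expR m * (1 + (y - m)) <= expR y.
  have := expR_ge1Dx (y - m); rewrite expRD expRN => H.
  have : expR m * (1 + (y - m)) <= expR m * (expR y / expR m).
    by rewrite ler_pM2l ?expR_gt0.
  by rewrite mulrCA mulfV ?mulr1// gt_eqF// expR_gt0.
have a1 := ler_wpM2l h1 (tang y1).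
have a2 := ler_wpM2l h2 (tang y2).
have a3 := ler_wpM2l h3 (tang y3).
apply: le_trans (lerD (lerD a1 a2) a3).
have -> : t1 * (expR m * (1 + (y1 - m))) + t2 * (expR m * (1 + (y2 - m))) +
    t3 * (expR m * (1 + (y3 - m))) =
    expR m * ((t1 + t2 + t3) + (m - (t1 + t2 + t3) * m)) by rewrite /m; ring.
by rewrite h mul1r subrr addr0 mulr1.
Qed.

(** By the two exponent relations, f k = (f^p k^r)^t1 (f^p)^t2 (k^r)^t3. Dividing the first factor
    by M and applying the weighted arithmetic-geometric inequality gives the bound; the free M can
    later be tuned to each point z. *)
Lemma young3 (f k M t1 t2 t3 p r : R) : 0 <= f -> 0 < k -> 0 < M ->
  0 <= t1 -> 0 <= t2 -> 0 <= t3 -> t1 + t2 + t3 = 1 ->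
  p * (t1 + t2) = 1 -> r * (t1 + t3) = 1 ->
  f * k <= M `^ t1 * (t1 * (f `^ p * k `^ r / M) + t2 * f `^ p + t3 * k `^ r).
Proof.
move=> f0 k0 M0 h1 h2 h3 h hp hr.
have [f1|fN0] := eqVneq f 0.
  rewrite f1 mul0r mulr_ge0 ?powR_ge0// !addr_ge0// mulr_ge0 ?powR_ge0//.
  by rewrite divr_ge0 ?mulr_ge0 ?powR_ge0 ?(ltW M0).
have fp : 0 < f by rewrite lt_def fN0.
rewrite -{1}(lnK fp) -{1}(lnK k0) -expRD /powR !gt_eqF//.
have -> : expR (p * ln f) * expR (r * ln k) / M = expR (p * ln f + r * ln k - ln M).
  by rewrite !expRD expRN lnK.
have -> : ln f + ln k = t1 * ln M + (t1 * (p * ln f + r * ln k - ln M) +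
   t2 * (p * ln f) + t3 * (r * ln k)).
  transitivity ((p * (t1 + t2)) * ln f + (r * (t1 + t3)) * ln k); last by ring.
  by rewrite hp hr !mul1r.
by rewrite [leLHS]expRD ler_pM2l ?expR_gt0// expR_convex3.
Qed.

End amgm.

Section boundedness.
Context {R : realType} {n : nat}.
Local Notation T := (n.+1.-tuple R[i]).
Local Notation mu := (@ball_measure R n.+1).
Local Notation B := (@unit_ball R n.+1).
Local Notation N := (n.+2%:R : R).
Local Open Scope ereal_scope.

Lemma measurable_kapl (s : R) (z : T) (D : set T) :
  measurable_fun D (fun w => (kap z w `^ s)%:E).
Proof.
apply/measurable_EFinP; apply: measurable_funTS.
by apply: (measurableT_comp (measurable_powR s)); exact: measurable_kap.
Qed.

Variable f : T -> R.
Hypotheses (mf : measurable_fun setT f) (f0 : forall w, (0 <= f w)%R).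

Lemma measurable_powR_fun (p : R) (D : set T) : measurable_fun D (fun w => (f w `^ p)%:E).
Proof.
apply/measurable_EFinP; apply: measurable_funTS.
exact: (measurableT_comp (measurable_powR p) mf).
Qed.

(** [young3] integrated in [w]. The bound 2 on the integral of f^p is the one that
    [cLnorm_le1_power] supplies for the unit ball of L^p. *)
Lemma Tb_young_bound (z : T) (beta M t1 t2 t3 p r C : R) :
  B z -> (0 < M)%R -> (0 <= t1)%R -> (0 <= t2)%R -> (0 <= t3)%R ->
  (t1 + t2 + t3 = 1)%R -> (p * (t1 + t2) = 1)%R -> (r * (t1 + t3) = 1)%R ->
  \int[mu]_(w in B) (f w `^ p)%:E <= 2%:E ->
  \int[mu]_(w in B) (kap z w `^ (- (beta * r)))%:E <= C%:E ->
  Tb beta f z <= (M `^ t1)%:E *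
    ((t1 / M)%:E * \int[mu]_(w in B) (f w `^ p * kap z w `^ (- (beta * r)))%:E +
      (t2 * 2 + t3 * C)%:E).
Proof.
move=> zB M0 h1 h2 h3 h hp hr fp kC.
have mB : measurable B by exact: measurable_unit_ball.
apply: (@le_trans _ _ (\int[mu]_(w in B) ((M `^ t1)%:E *
   ((t1 / M)%:E * (f w `^ p * kap z w `^ (- (beta * r)))%:E + t2%:E * (f w `^ p)%:E +
     t3%:E * (kap z w `^ (- (beta * r)))%:E)))).
  apply: ge0_le_integral_mono => w wB; first by rewrite lee_fin mulr_ge0 ?powR_ge0.
  rewrite -[leRHS]/((M `^ t1 * (t1 / M * (f w `^ p * kap z w `^ (- (beta * r))) +
    t2 * f w `^ p + t3 * kap z w `^ (- (beta * r))))%:E) lee_fin.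
  have k0 : (0 < kap z w `^ (- beta))%R by rewrite powR_gt0// kap_gt0.
  have := young3 (f0 w) k0 M0 h1 h2 h3 h hp hr.
  rewrite -powRrM mulNr => H; apply: le_trans H _.
  by rewrite le_eqVlt; apply/orP; left; apply/eqP; congr (_ * (_ + _ + _))%R; ring.
have m1 : measurable_fun B (fun w => (f w `^ p * kap z w `^ (- (beta * r)))%:E).
  apply/measurable_EFinP/measurable_funM; apply/measurable_EFinP.
    exact: measurable_powR_fun.
  exact: measurable_kapl.
have m2 : measurable_fun B (fun w => (f w `^ p)%:E) by exact: measurable_powR_fun.
have m3 : measurable_fun B (fun w => (kap z w `^ (- (beta * r)))%:E) by exact: measurable_kapl.
have p1 w : 0 <= (f w `^ p * kap z w `^ (- (beta * r)))%:E.
  by rewrite lee_fin mulr_ge0 ?powR_ge0.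
have p2 w : 0 <= (f w `^ p)%:E by rewrite lee_fin powR_ge0.
have p3 w : 0 <= (kap z w `^ (- (beta * r)))%:E by rewrite lee_fin powR_ge0.
have c1 : 0 <= (t1 / M)%:E by rewrite lee_fin divr_ge0// ltW.
have c2 : 0 <= t2%:E by rewrite lee_fin.
have c3 : 0 <= t3%:E by rewrite lee_fin.
rewrite ge0_integralZl//; last 3 first.
- by do 2?[apply: emeasurable_funD]; exact: measurable_funeM.
- by move=> w _; rewrite !adde_ge0// mule_ge0.
- by rewrite lee_fin powR_ge0.
rewrite ge0_integralD//; last 4 first.
- by move=> w _; rewrite !adde_ge0// mule_ge0.
- by apply: emeasurable_funD; exact: measurable_funeM.
- by move=> w _; rewrite mule_ge0.
- exact: measurable_funeM.
rewrite ge0_integralD//; last 4 first.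
- by move=> w _; rewrite mule_ge0.
- exact: measurable_funeM.
- by move=> w _; rewrite mule_ge0.
- exact: measurable_funeM.
rewrite !ge0_integralZl//.
apply: lee_wpmul2l; first by rewrite lee_fin powR_ge0.
rewrite -addeA leeD// EFinD EFinM (EFinM t3).
by apply: leeD; exact: lee_wpmul2l.
Qed.

End boundedness.

(** * Norms of complex functions *)

Section sequences_fast.
Context {R : realType}.

(** From index n on, adding 2 * 2^-k makes the sequence nonincreasing and subtracting it makes it
    nondecreasing. The first of these converges, being bounded below by the start of the second, and
    the correction tends to 0. *)
Lemma fast_cvg (a : nat -> R) (n : nat) :
  (forall k, (n <= k)%N -> `|a k - a k.+1| <= 2^-1 ^+ k) -> cvgn a.
Proof.
move=> H; pose b k := a (k + n)%N + 2 * 2^-1 ^+ (k + n).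
pose c k := a (k + n)%N - 2 * 2^-1 ^+ (k + n).
have e0 k : 0 < 2^-1 ^+ k :> R by rewrite exprn_gt0.
have step k : `|a (k + n)%N - a (k.+1 + n)%N| <= 2^-1 ^+ (k + n).
  by rewrite addSn; apply: H; rewrite leq_addl.
have bS k : b k.+1 <= b k.
  have := step k; rewrite ler_norml /b addSn exprS; lra.
have cS k : c k <= c k.+1.
  have := step k; rewrite ler_norml /c addSn exprS; lra.
have cb k : c 0%N <= b k.
  apply: (@le_trans _ _ (c k)).
    by elim: k => // k IH; apply: le_trans IH (cS k).
  by rewrite /c /b; have := e0 (k + n)%N; lra.
have bcv : cvgn b.
  apply: nonincreasing_is_cvgn; first exact/nonincreasing_seqP.
  by exists (c 0%N) => _ [k _ <-].
have ecv : (fun k => 2 * 2^-1 ^+ (k + n)) @ \oo --> (0 : R).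
  have h : `|2^-1 : R| < 1 by rewrite ger0_norm ?invr_ge0//; lra.
  have := @cvg_geometric R 2 2^-1 h.
  by rewrite -(cvg_shiftn n).
apply/cvg_ex; exists (lim (b @ \oo)).
rewrite -(cvg_shiftn n).
have -> : [sequence a (k + n)%N]_k = (fun k => b k - 2 * 2^-1 ^+ (k + n)).
  by apply/funext => k; rewrite /b /=; ring.
have := cvgB bcv ecv; rewrite subr0; exact.
Qed.

Lemma limn_einf_ub (u : (\bar R)^nat) (c : \bar R) : (forall k, u k <= c)%E ->
  (limn_einf u <= c)%E.
Proof.
move=> uc; rewrite limn_einf_lim; apply: lime_le; first exact: is_cvg_einfs.
apply: nearW => k; apply: le_trans (uc k).
by apply: ereal_inf_lbound; exists k => //=.
Qed.

Lemma limn_einf_ge0 (u : (\bar R)^nat) : (forall k, 0 <= u k)%E ->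
  (0 <= limn_einf u)%E.
Proof.
move=> u0; rewrite limn_einf_lim; apply: lime_ge; first exact: is_cvg_einfs.
by apply: nearW => k; apply: le_ereal_inf_tmp => _ [j _ <-].
Qed.

Lemma powR_le_limn_einf (x : nat -> R) (l r : R) : 0 < r -> (forall k, 0 <= x k) ->
  x @ \oo --> l -> ((l `^ r)%:E <= limn_einf (fun k => (x k `^ r)%:E))%E.
Proof.
move=> r0 x0 xl.
have l0 : 0 <= l.
  have cx : cvgn x by apply/cvg_ex; exists l.
  by rewrite -(cvg_lim _ xl)//; apply: limr_ge => //; apply: nearW.
(* At l = 0 the claim is only nonnegativity; the continuity argument below goes through
   differentiability of the power and needs l > 0. *)
have [->|ln0] := eqVneq l 0.
  rewrite powR0 ?gt_eqF//; apply: limn_einf_ge0 => k.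
  by rewrite lee_fin powR_ge0.
have lp : 0 < l by rewrite lt_neqAle eq_sym ln0.
have cl : {for l, continuous (fun y : R => y `^ r)}.
  apply/differentiable_continuous/derivable1_diffP.
  by apply: derivable_powR; rewrite in_itv /= lp.
have H : (fun k => (x k `^ r)%:E) @ \oo --> (l `^ r)%:E.
  apply: cvg_EFin; first exact: nearW.
  exact: (cvg_comp _ _ xl cl).
by rewrite (cvg_limn_einf_sup H).1.
Qed.

End sequences_fast.

Section cLnorm_theory.
Context d {T : measurableType d} {R : realType}.
Variable mu : {measure set T -> \bar R}.
Implicit Types (p q : \bar R) (f g : T -> R[i]).

Lemma cLnorm_powerE (r : R) f : 1 <= r ->
  (cLnorm mu r%:E f `^ r = \int[mu]_z (normc (f z) `^ r)%:E)%E.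
Proof.
move=> r1; have r0 : r != 0 by rewrite gt_eqF// (lt_le_trans ltr01 r1).
rewrite /cLnorm (poweR_Lnorm _ _ r0).
by apply: eq_integral => z _; rewrite /= ger0_norm ?normc_ge0// poweR_EFin.
Qed.

Lemma poweR_le_cancel (x y : \bar R) (r : R) : 0 < r -> (0 <= x)%E -> (0 <= y)%E ->
  (x `^ r <= y `^ r)%E -> (x <= y)%E.
Proof.
move=> r0 x0 y0 xy; rewrite leNgt; apply/negP => yx.
have : (y `^ r < x `^ r)%E; last by rewrite ltNge xy.
case: y y0 yx {xy} => [y| |]// y0 yx; last by move: yx; rewrite ltNge leey.
rewrite poweR_EFin; case: x yx x0 => [x| |]// yx x0; last by rewrite poweRyr ?gt_eqF// ltry.
rewrite poweR_EFin lte_fin; rewrite lte_fin in yx.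
by apply: gt0_ltr_powR; rewrite ?nnegrE// -lee_fin.
Qed.

Lemma measurable_normc_comp f : measurable_fun setT f ->
  measurable_fun setT (fun z => normc (f z)).
Proof. exact: (measurableT_comp measurable_normc). Qed.

Lemma cLnorm_ae_le q f g : (1 <= q)%E -> measurable_fun setT f -> measurable_fun setT g ->
  {ae mu, forall x, normc (f x) <= normc (g x)} -> (cLnorm mu q f <= cLnorm mu q g)%E.
Proof.
case: q => [r| |]//.
  rewrite lee_fin => r1 mf mg fg; have r0 : 0 < r by exact: lt_le_trans ltr01 r1.
  apply: (poweR_le_cancel r0); rewrite ?cLnorm_ge0// !cLnorm_powerE//.
  have mp (h : T -> R[i]) : measurable_fun setT h -> measurable_fun setT (fun z => (normc (h z) `^ r)%:E).
    move=> mh; apply/measurable_EFinP; apply: (measurableT_comp (measurable_powR r)).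
    exact: measurable_normc_comp.
  apply: ae_ge0_le_integral => //.
  - by move=> z _; rewrite lee_fin powR_ge0.
  - exact: mp.
  - by move=> z _; rewrite lee_fin powR_ge0.
  - exact: mp.
  - apply: filterS fg => z fg _; rewrite lee_fin.
    by apply: ge0_ler_powR; rewrite ?nnegrE ?normc_ge0//; exact: ltW.
move=> _ mf mg fg; rewrite /cLnorm unlock; case: ifPn => // _.
apply: le_ess_sup; apply: filterS fg => z fg /=.
by rewrite lee_fin !ger0_norm ?normc_ge0.
Qed.

Lemma cLnorm_ae_eq q f g : (1 <= q)%E -> measurable_fun setT f -> measurable_fun setT g ->
  {ae mu, forall x, normc (f x) = normc (g x)} -> cLnorm mu q f = cLnorm mu q g.
Proof.
move=> q1 mf mg fg; apply/eqP; rewrite eq_le; apply/andP; split.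
  by apply: cLnorm_ae_le => //; apply: filterS fg => x ->.
by apply: cLnorm_ae_le => //; apply: filterS fg => x ->.
Qed.

(** A class is read through a chosen representative, so [f] is recovered only almost everywhere. *)
Lemma exists_cLp q (q1 : (1 <= q)%E) f : measurable_fun setT f ->
  (cLnorm mu q f < +oo)%E ->
  exists F : cLp mu q1, {ae mu, forall x, cLp_fun F x = f x}.
Proof.
move=> mf foo.
pose f' : {mfun T >-> R[i]} := mfun_Sub (mem_set mf : f \in mfun).
pose G : {mfun_ mu, T >-> R[i]} := (\pi_(aeEqMfun R[i] mu) f')%qT.
have Gf : {ae mu, forall x, aqEqMfun_to_fun G x = f x}.
  have := reprK G; rewrite {2}/G => /eqP; rewrite eqmodE => /asboolP.
  by apply: filterS => x H; apply: H.
have mG : measurable_fun setT (aqEqMfun_to_fun G) by exact: measurable_funPT.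
have Goo : (cLnorm mu q (aqEqMfun_to_fun G) < +oo)%E.
  by rewrite (cLnorm_ae_eq q1 mG mf)//; apply: filterS Gf => x ->.
by exists (exist _ G (asboolT Goo)).
Qed.

End cLnorm_theory.

(** * Bounds from L^p to L^q for the positive operators *)

Section norm_bounds.
Context {R : realType} {n : nat}.
Local Notation T := (n.+1.-tuple R[i]).
Local Notation mu := (@ball_measure R n.+1).
Local Notation B := (@unit_ball R n.+1).
Local Notation N := (n.+2%:R : R).
Local Open Scope ereal_scope.

(** Hölder's inequality: [r] is conjugate to [p], and beta * r < N keeps the integral of the r-th
    power of the kernel bounded. In [Tb_young_bound] this is t1 = 0, M = 1. *)
Lemma Tb_sup (p beta : R) : (1 <= p)%R -> (0 <= beta)%R -> (beta < N * (1 - p^-1))%R ->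
  exists2 C : R, (0 <= C)%R & forall f : T -> R,
  measurable_fun setT f -> (forall w, 0 <= f w)%R ->
  \int[mu]_(w in B) (f w `^ p)%:E <= 2%:E ->
  forall z, B z -> Tb beta f z <= C%:E.
Proof.
move=> p1 b0 bp.
have p0 : (0 < p)%R by lra.
have N0 : (0 < N)%R by rewrite ltr0n.
have pp : (0 < 1 - p^-1)%R.
  rewrite -(pmulr_rgt0 _ N0); lra.
pose r : R := ((1 - p^-1)^-1)%R.
have r0 : (0 < r)%R by rewrite invr_gt0.
have br0 : (0 <= beta * r)%R by rewrite mulr_ge0// ltW.
have br : (beta * r < N)%R by rewrite /r -ltr_pdivlMr ?invr_gt0// invrK.
have [C C0 HC] := forelli_rudin br0 br.
exists (2 + C)%R; first by lra.
move=> f mf f0 fp z zB.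
have pinv : (p * p^-1 = 1)%R by rewrite mulfV// gt_eqF.
have rinv : (r * (1 - p^-1) = 1)%R by rewrite mulVf// gt_eqF.
have ip : (0 < p^-1)%R by rewrite invr_gt0.
have ip1 : (p^-1 <= 1)%R by rewrite invf_le1.
have := @Tb_young_bound _ _ f mf f0 z beta 1 0 p^-1 (1 - p^-1) p r C zB ltr01.
rewrite !add0r => H; apply: (le_trans (H _ _ _ _ _ _ fp (HC z zB))) => //.
- exact: ltW.
- exact: ltW.
- by rewrite addrCA subrr addr0.
rewrite powRr0 !mul0r mul0e add0e mul1e lee_fin; apply: lerD.
  by rewrite ler_piMl.
by rewrite ler_piMl ?(ltW C0)// gerBl ltW.
Qed.

(** Young's convolution argument, with 1/r = 1 + 1/q - 1/p and weights t1 = 1/q, t2 = 1/p - 1/q, t3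
    = 1 - 1/p. Taking M = 1 + J(z), where J(z) is the integral of f^p times the r-th power of the
    kernel, gives (Tb f)^q <= (3 + C)^q (1 + J). Integrating J in [z] first leaves a Forelli-Rudin
    integral. *)
Lemma Tb_young (p q beta : R) : (1 <= p)%R -> (p <= q)%R -> (0 <= beta)%R ->
  (beta < N * (1 + q^-1 - p^-1))%R ->
  exists2 C : R, (0 <= C)%R & forall f : T -> R,
  measurable_fun setT f -> (forall w, 0 <= f w)%R ->
  \int[mu]_(w in B) (f w `^ p)%:E <= 2%:E ->
  \int[mu]_(z in B) (Tb beta f z `^ q) <= C%:E.
Proof.
move=> p1 pq b0 bpq.
have p0 : (0 < p)%R by lra.
have q0 : (0 < q)%R by lra.
have N0 : (0 < N)%R by rewrite ltr0n.
have ip : (0 < p^-1)%R by rewrite invr_gt0.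
have iq : (0 < q^-1)%R by rewrite invr_gt0.
have ip1 : (p^-1 <= 1)%R by rewrite invf_le1.
have ipq : (q^-1 <= p^-1)%R by rewrite lef_pV2 ?posrE.
pose e : R := (1 + q^-1 - p^-1)%R.
have e0 : (0 < e)%R by rewrite /e; lra.
pose r : R := (e^-1)%R.
have r0 : (0 < r)%R by rewrite invr_gt0.
have br0 : (0 <= beta * r)%R by rewrite mulr_ge0// ltW.
have br : (beta * r < N)%R by rewrite /r -ltr_pdivlMr ?invr_gt0// invrK.
have [C C0 HC] := forelli_rudin br0 br.
exists ((3 + C) `^ q * (1 + 2 * C))%R.
  by rewrite mulr_ge0 ?powR_ge0// addr_ge0// mulr_ge0// ltW.
move=> f mf f0 fp.
have mB : measurable B by exact: measurable_unit_ball.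
pose h (x : T * T) : \bar R := (f x.2 `^ p * kap x.1 x.2 `^ (- (beta * r)))%:E.
have mh : measurable_fun setT h.
  apply/measurable_EFinP/measurable_funM; last exact: measurable_kap_pair.
  apply: (measurableT_comp (measurable_powR p)).
  exact: measurableT_comp mf measurable_snd.
have h0 x : 0 <= h x by rewrite lee_fin mulr_ge0 ?powR_ge0.
pose J z := \int[mu]_(w in B) h (z, w).
have J0 z : 0 <= J z by exact: integral_ge0.
have mJ : measurable_fun B J by apply: measurable_funTS; exact: measurable_ball_integral.
have C3 : (0 < 3 + C)%R by rewrite addr_gt0.
have ptw z : B z -> Tb beta f z `^ q <= ((3 + C) `^ q)%:E * (1 + J z).
  move=> zB; have [Jy|Jfin] := eqVneq (J z) +oo.
    by rewrite Jy addey// gt0_muley ?leey// lte_fin powR_gt0.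
  have JE : J z = (fine (J z))%:E by rewrite fineK// ge0_fin_numE// ltey.
  have j0 : (0 <= fine (J z))%R by exact: fine_ge0.
  have M0 : (0 < 1 + fine (J z))%R by rewrite ltr_wpDr.
  (* This M makes the term (t1 / M) J(z) at most 1, and its summand 1 keeps it positive; the three
     terms are then at most 1, 2 and C. *)
  have := @Tb_young_bound _ _ f mf f0 z beta (1 + fine (J z)) q^-1 (p^-1 - q^-1)
     (1 - p^-1) p r C zB M0.
  have -> : (q^-1 + (p^-1 - q^-1) = p^-1)%R by ring.
  have -> : (p^-1 + (1 - p^-1) = 1)%R by ring.
  have -> : (q^-1 + (1 - p^-1) = e)%R by rewrite /e; ring.
  rewrite mulfV ?gt_eqF// mulVf ?gt_eqF// -/h -/(J z).
  rewrite subr_ge0 ipq subr_ge0 ip1 => /(_ (ltW iq) isT isT erefl erefl erefl fp (HC z zB)) H.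
  have {}H : Tb beta f z <= ((1 + fine (J z)) `^ q^-1 * (3 + C))%:E.
    apply: le_trans H _.
    rewrite [X in _ <= X]EFinM lee_wpmul2l ?lee_fin ?powR_ge0//.
    rewrite -/(J z) JE -EFinM -EFinD lee_fin.
    have a1 : (q^-1 / (1 + fine (J z)) * fine (J z) <= 1)%R.
      rewrite -mulrA mulr_ile1 ?(ltW iq)//.
      - by rewrite mulr_ge0// invr_ge0 ltW.
      - exact: le_trans ipq ip1.
      - by rewrite mulrC ler_pdivrMr// mul1r lerDr.
    have a2 : ((1 - p^-1) * C <= C)%R by rewrite ler_piMl ?(ltW C0)// gerBl ltW.
    by move: iq; lra.
  have T0 : 0 <= Tb beta f z by exact: Tb_ge0.
  apply: (@le_trans _ _ ((((1 + fine (J z)) `^ q^-1 * (3 + C)) `^ q)%:E)).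
    rewrite -poweR_EFin; apply: gt0_ler_poweR => //; first exact: ltW.
    - by rewrite in_itv/= leey T0.
    - by rewrite in_itv/= leey (le_trans T0 H).
  rewrite JE -EFinD -EFinM lee_fin powRM ?powR_ge0//; last exact: ltW.
  by rewrite -powRrM mulVf ?gt_eqF// powRr1 ?(ltW M0)// mulrC.
apply: (@le_trans _ _ (\int[mu]_(z in B) (((3 + C) `^ q)%:E * (1 + J z)))).
  by apply: ge0_le_integral_mono => z zB; [exact: poweR_ge0|exact: ptw].
rewrite ge0_integralZl//; last 3 first.
- exact: emeasurable_funD.
- by move=> z _; rewrite adde_ge0.
- by rewrite lee_fin powR_ge0.
rewrite EFinM lee_wpmul2l ?lee_fin ?powR_ge0//.
rewrite ge0_integralD//= EFinD; apply: leeD.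
  rewrite integral_cst// mul1e -[leRHS](ball_measureT n.+1).
  by apply: le_measure; rewrite ?inE.
rewrite /J ball_tonelli//.
apply: (@le_trans _ _ (\int[mu]_(w in B) ((f w `^ p)%:E * C%:E))).
  apply: ge0_le_integral_mono => w wB; first exact: integral_ge0.
  rewrite /h /=.
  under eq_integral do rewrite EFinM kapC.
  rewrite ge0_integralZl ?lee_fin ?powR_ge0//;
    [|exact: measurable_kapl|by move=> x _; rewrite lee_fin powR_ge0].
  by rewrite lee_wpmul2l ?lee_fin ?powR_ge0// HC.
rewrite ge0_integralZr ?lee_fin ?(ltW C0)//;
  [|exact: measurable_powR_fun|by move=> x _; rewrite lee_fin powR_ge0].
by rewrite EFinM lee_wpmul2r ?lee_fin ?(ltW C0).
Qed.

(** By [kap_ge], the excess kap^-(2t) is at most c(z) = ((1 - |z|^2) / 2)^-(2t), leaving the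
    subcritical exponent N - t, which is bounded on L^p. Young's inequality with exponents P = p /
    (p - q) and p / q splits (c Tb f)^q into c^(qP), integrable for small t, and (Tb f)^p. *)
Lemma Tb_weight (p q : R) : (1 <= q)%R -> (q < p)%R -> exists2 t : R, (0 < t)%R &
  exists2 C : R, (0 <= C)%R & forall f : T -> R,
  measurable_fun setT f -> (forall w, 0 <= f w)%R ->
  \int[mu]_(w in B) (f w `^ p)%:E <= 2%:E ->
  \int[mu]_(z in B) (Tb (N + t) f z `^ q) <= C%:E.
Proof.
move=> q1 qp.
have q0 : (0 < q)%R by lra.
have p0 : (0 < p)%R by lra.
have N1 : (1 <= N)%R by rewrite ler1n.
pose P : R := (p / (p - q))%R.
have P1 : (0 < P)%R by rewrite divr_gt0//; lra.
(* Small enough both for 2 t q P < 1/2, the range of [shell_integral], and for t <= 1/8, so that N -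
   t >= 0. *)
pose t : R := (8 * q * P + 8)^-1%R.
have qP : (0 < q * P)%R by rewrite mulr_gt0.
have D0 : (0 < 8 * q * P + 8)%R by rewrite -mulrA; lra.
have t0 : (0 < t)%R by rewrite invr_gt0.
have t1 : (t <= 8^-1)%R by rewrite lef_pV2 ?posrE//; lra.
have tu : (2 * t * q * P < 2^-1)%R.
  have : (t * (8 * q * P + 8) = 1)%R by rewrite mulVf// gt_eqF.
  by move: t0; lra.
exists t => //.
have u0 : (0 <= 2 * t * q * P)%R by rewrite -mulrA mulr_ge0 ?(ltW qP)// mulr_ge0// ltW.
have [C1 C10 HC1] := shell_integral n u0 tu.
have b0 : (0 <= N - t)%R by lra.
have bN : (N - t < N * (1 + p^-1 - p^-1))%R by lra.
have p1 : (1 <= p)%R by lra.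
have [C2 C20 HC2] := Tb_young p1 (lexx p) b0 bN.
exists (2 `^ (2 * t * q * P) * C1 + C2)%R.
  by rewrite addr_ge0// mulr_ge0 ?powR_ge0// ltW.
move=> f mf f0 fp.
have mB : measurable B by exact: measurable_unit_ball.
pose c (z : T) : R := (((1 - sqn z) / 2) `^ (- (2 * t)))%R.
have c0 z : (0 <= c z)%R by exact: powR_ge0.
have mT : measurable_fun setT (Tb (N - t) f) by exact: measurable_Tb.
have T0 z : 0 <= Tb (N - t) f z by exact: Tb_ge0.
have ptw z : B z -> Tb (N + t) f z `^ q <=
    (2 `^ (2 * t * q * P) * (1 - sqn z) `^ (- (2 * t * q * P)))%:E + Tb (N - t) f z `^ p.
  move=> zB; have zs : (sqn z < 1)%R by rewrite -unit_ballP.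
  have zB1 : (0 < (1 - sqn z) / 2)%R by rewrite divr_gt0// subr_gt0.
  have cz0 : (0 < c z)%R by rewrite powR_gt0.
  have H : Tb (N + t) f z <= (c z)%:E * Tb (N - t) f z.
    rewrite /Tb -ge0_integralZl//; last 3 first.
    - apply/measurable_EFinP; apply: measurable_funM; first exact: measurable_funTS.
      apply: measurable_funTS; apply: (measurableT_comp (measurable_powR _)).
      exact: measurable_kap.
    - by move=> w _; rewrite lee_fin mulr_ge0 ?powR_ge0.
    - by rewrite lee_fin.
    apply: ge0_le_integral_mono => w wB; first by rewrite lee_fin mulr_ge0 ?powR_ge0.
    rewrite -EFinM lee_fin mulrCA ler_wpM2l// /c.
    have k0 := kap_gt0 zB wB.
    have -> : (- (N + t) = - (2 * t) + - (N - t))%R by ring.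
    rewrite powRD; last by apply/implyP => _; rewrite gt_eqF.
    rewrite ler_wpM2r ?powR_ge0// !powRN lef_pV2 ?posrE ?powR_gt0//.
    apply: ge0_ler_powR; rewrite ?nnegrE; [|exact: ltW|exact: ltW|exact: kap_ge].
    by rewrite mulr_ge0// ltW.
  have [Ty|Tfin] := eqVneq (Tb (N - t) f z) +oo.
    by rewrite Ty poweRyr ?gt_eqF// addey// leey.
  have TE : Tb (N - t) f z = (fine (Tb (N - t) f z))%:E.
    by rewrite fineK// ge0_fin_numE// ltey.
  move: H; rewrite TE; set x := fine _ => H.
  have x0 : (0 <= x)%R by exact: fine_ge0.
  apply: (@le_trans _ _ (((c z * x) `^ q)%:E)).
    rewrite -poweR_EFin; apply: gt0_ler_poweR => //; first exact: ltW.
    - by rewrite in_itv/= leey Tb_ge0.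
    - by rewrite in_itv/= leey lee_fin mulr_ge0.
  rewrite poweR_EFin -EFinD lee_fin powRM//.
  have PQ : (P^-1 + (p / q)^-1 = 1)%R.
    by rewrite /P !invf_div -mulrDl subrK mulfV// gt_eqF.
  have pq0 : (0 < p / q)%R by rewrite divr_gt0.
  have pq1 : (1 <= p / q)%R by rewrite ler_pdivlMr// mul1r ltW.
  have P11 : (1 <= P)%R by rewrite ler_pdivlMr ?subr_gt0// mul1r gerBl ltW.
  apply: le_trans (conjugate_powR _ _ P1 pq0 PQ) _; rewrite ?powR_ge0//.
  apply: lerD.
    rewrite ler_pdivrMr//; apply: (@le_trans _ _ ((c z `^ q) `^ P)%R); last first.
      have -> : ((c z `^ q) `^ P = 2 `^ (2 * t * q * P) *
          (1 - sqn z) `^ (- (2 * t * q * P)))%R.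
        transitivity (((1 - sqn z) / 2) `^ (- (2 * t * q * P)))%R.
          by rewrite /c -!powRrM; congr (_ `^ _)%R; ring.
        rewrite powRM ?invr_ge0//; last by rewrite subr_ge0 ltW.
        have h2 : (2^-1 = 2 `^ (-1) :> R)%R by rewrite powR_inv1.
        by rewrite h2 -powRrM mulN1r opprK mulrC.
      by rewrite ler_peMr// mulr_ge0 ?powR_ge0.
    by [].
  rewrite -powRrM mulrCA mulfV ?gt_eqF// mulr1 ler_pdivrMr//.
  by rewrite ler_peMr// powR_ge0.
apply: (@le_trans _ _ (\int[mu]_(z in B)
   ((2 `^ (2 * t * q * P))%:E * ((1 - sqn z) `^ (- (2 * t * q * P)))%:E +
     Tb (N - t) f z `^ p))).
  apply: ge0_le_integral_mono => z zB; first exact: poweR_ge0.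
  by rewrite -EFinM; exact: ptw.
have ms : measurable_fun B (fun z => ((1 - sqn z) `^ (- (2 * t * q * P)))%:E).
  apply/measurable_EFinP; apply: measurable_funTS.
  apply: (measurableT_comp (measurable_powR _)).
  by apply: measurable_funB => //; exact: measurable_sqn.
rewrite ge0_integralD//; last 4 first.
- by move=> z _; rewrite mule_ge0 ?lee_fin ?powR_ge0.
- exact: measurable_funeM.
- by move=> z _; exact: poweR_ge0.
- by apply: measurable_funTS; exact: (measurableT_comp (measurable_poweR p) mT).
rewrite EFinD; apply: leeD; last exact: HC2.
rewrite ge0_integralZl//; last by move=> z _; rewrite lee_fin powR_ge0.
by rewrite EFinM lee_wpmul2l ?lee_fin ?powR_ge0.
Qed.

Lemma powR1r (r : R) : (1 `^ r = 1 :> R)%R.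
Proof. by rewrite powR1. Qed.

Lemma mu_ball_gt0 : 0 < mu [set: T].
Proof. by rewrite [ltRHS](ball_measureT n.+1). Qed.

Lemma poweR_le1 (x : \bar R) (r : R) : (0 < r)%R -> 0 <= x -> (x `^ r <= 1) = (x <= 1).
Proof.
move=> r0; case: x => [x| |]// x0; last by rewrite poweRyr ?gt_eqF.
rewrite lee_fin in x0; rewrite poweR_EFin !lee_fin.
have [xle|xgt] := leP x 1%R.
  rewrite -(powR1r r); apply: ge0_ler_powR; rewrite ?nnegrE//; exact: ltW.
apply/negP => H; have : (1 `^ r < x `^ r)%R by apply: gt0_ltr_powR; rewrite ?nnegrE.
by rewrite powR1 ltNge H.
Qed.

(** For finite p, |F|^s <= 1 + |F|^p and the ball has measure 1. This allows p to be lowered, in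
    particular from +oo to a finite exponent. *)
Lemma cLnorm_le1_power (p : \bar R) (s : R) (F : T -> R[i]) : (1 <= s)%R -> s%:E <= p ->
  measurable_fun setT F -> cLnorm mu p F <= 1 ->
  \int[mu]_(w in B) (normc (F w) `^ s)%:E <= 2%:E.
Proof.
move=> s1 sp mF Fp.
have mB : measurable B by exact: measurable_unit_ball.
have mp (r : R) (D : set T) : measurable_fun D (fun w => (normc (F w) `^ r)%:E).
  apply/measurable_EFinP; apply: measurable_funTS; apply: (measurableT_comp (measurable_powR r)).
  exact: measurable_normc_comp.
have int1 : \int[mu]_(w in B) 1%:E <= 1.
  rewrite integral_cst// mul1e -[leRHS](ball_measureT n.+1).
  by apply: le_measure; rewrite ?inE.
case: p sp Fp => [r| |]; rewrite ?leeNye_eq// => sr Fp.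
  rewrite lee_fin in sr.
  have r1 : (1 <= r)%R by lra.
  have Fr : \int[mu]_z (normc (F z) `^ r)%:E <= 1.
    by rewrite -cLnorm_powerE// poweR_le1 ?cLnorm_ge0//; lra.
  apply: (@le_trans _ _ (\int[mu]_(w in B) (1%:E + (normc (F w) `^ r)%:E))).
    apply: ge0_le_integral_mono => w _; first by rewrite lee_fin powR_ge0.
    rewrite -EFinD lee_fin; have [f1|f1] := leP (normc (F w)) 1%R.
      rewrite -[leLHS]addr0 lerD ?powR_ge0// -(powR1r s).
      by apply: ge0_ler_powR; rewrite ?nnegrE ?normc_ge0//; lra.
    rewrite -[leLHS]add0r lerD//.
    by apply: ler_powR => //; exact: ltW.
  rewrite ge0_integralD//; last by move=> w _; rewrite lee_fin powR_ge0.
  rewrite (_ : 2%:E = 1 + 1); last by rewrite -EFinD.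
  apply: leeD => //; apply: le_trans Fr; rewrite ball_integralE//.
  by move=> w; rewrite lee_fin powR_ge0.
have Fae : \forall w \ae mu, (normc (F w) <= 1)%R.
  move: Fp; rewrite /cLnorm unlock mu_ball_gt0 => /ess_supP.
  by apply: filterS => w; rewrite /= lee_fin ger0_norm ?normc_ge0.
apply: (@le_trans _ _ (\int[mu]_(w in B) 1%:E)); last first.
  by apply: le_trans int1 _; rewrite lee_fin; lra.
apply: ae_ge0_le_integral => //.
  by move=> w _; rewrite lee_fin powR_ge0.
apply: filterS Fae => w Fw _; rewrite lee_fin -(powR1r s).
by apply: ge0_ler_powR; rewrite ?nnegrE ?normc_ge0//; lra.
Qed.

(* An L^q bound for extended-real functions: on the q-th power of the norm when
   q is finite, and on every value, rather than almost every one, when q = +oo. *)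
Definition norm_bounded (q : \bar R) (g : T -> \bar R) (C : R) : Prop :=
  match q with
  | r%:E => \int[mu]_(z in B) (g z `^ r) <= C%:E
  | _ => forall z, B z -> g z <= C%:E
  end.

(** For finite r, C <= 1 + C <= (1 + C)^r; using 1 + C instead of the r-th root of C yields one
    bound for all q. *)
Lemma cLnorm_le_norm_bounded (q : \bar R) (g : T -> \bar R) (C t : R) (H : T -> R[i]) :
  1 <= q -> (0 <= C)%R -> (0 <= t)%R -> measurable_fun setT H ->
  measurable_fun setT g -> (forall z, 0 <= g z) ->
  (forall z, B z -> (normc (H z))%:E <= t%:E * g z) ->
  norm_bounded q g C -> cLnorm mu q H <= (t * (1 + C))%:E.
Proof.
move=> q1 C0 t0 mH mg g0 Hg.
have mB : measurable B by exact: measurable_unit_ball.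
case: q q1 => [r| |]//; last first.
  move=> _ /= gC; rewrite /cLnorm unlock mu_ball_gt0; apply/ess_supP.
  apply: ae_unit_ball => z zB /=; rewrite ger0_norm ?normc_ge0//.
  apply: le_trans (Hg z zB) _; apply: (@le_trans _ _ (t%:E * C%:E)).
    by rewrite lee_wpmul2l ?gC.
  by rewrite lee_fin mulrDr mulr1 lerDr.
rewrite lee_fin => r1 /= gC.
have r0 : (0 < r)%R by lra.
have X0 : 0 <= cLnorm mu r%:E H by exact: cLnorm_ge0.
have Y0 : 0 <= (t * (1 + C))%:E by rewrite lee_fin mulr_ge0// addr_ge0.
suff : cLnorm mu r%:E H `^ r <= (t * (1 + C))%:E `^ r.
  move=> XY; rewrite leNgt; apply/negP => YX.
  have : (t * (1 + C))%:E `^ r < cLnorm mu r%:E H `^ r.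
    case: (cLnorm mu r%:E H) YX X0 {XY} => [x| |]//.
      rewrite lte_fin lee_fin !poweR_EFin lte_fin => YX x0.
      by apply: gt0_ltr_powR; rewrite ?nnegrE// -lee_fin.
    by move=> _ _; rewrite poweRyr ?gt_eqF// poweR_EFin ltry.
  by rewrite ltNge XY.
rewrite cLnorm_powerE// -ball_integralE; last 2 first.
- apply/measurable_EFinP; apply: (measurableT_comp (measurable_powR r)).
  exact: measurable_normc_comp.
- by move=> z; rewrite lee_fin powR_ge0.
apply: (@le_trans _ _ (\int[mu]_(z in B) ((t `^ r)%:E * g z `^ r))).
  apply: ge0_le_integral_mono => z zB; first by rewrite lee_fin powR_ge0.
  rewrite -!poweR_EFin -poweRM ?lee_fin//; apply: gt0_ler_poweR; first exact: ltW.
  - by rewrite in_itv/= leey lee_fin normc_ge0.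
  - by rewrite in_itv/= leey mule_ge0.
  - exact: Hg.
rewrite ge0_integralZl//; last 3 first.
- by apply: measurable_funTS; exact: (measurableT_comp (measurable_poweR r) mg).
- by move=> z _; exact: poweR_ge0.
- by rewrite lee_fin powR_ge0.
apply: (@le_trans _ _ ((t `^ r)%:E * C%:E)).
  by rewrite lee_wpmul2l// lee_fin powR_ge0.
rewrite poweR_EFin -EFinM lee_fin powRM//; last by rewrite addr_ge0.
rewrite ler_wpM2l ?powR_ge0//; apply: (@le_trans _ _ (1 + C)%R); first by lra.
by apply: le1r_powR => //; lra.
Qed.

(** The majorant for a difference of two images: one term for each kernel shift, and the constant 1
    for the uniform error of the coding. For finite r, the sum of three terms is at most three times
    their maximum. *)
Lemma norm_bounded_sum (q : \bar R) (g1 g2 : T -> \bar R) (C : R) :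
  1 <= q -> (0 <= C)%R -> measurable_fun setT g1 -> measurable_fun setT g2 ->
  (forall z, 0 <= g1 z) -> (forall z, 0 <= g2 z) ->
  norm_bounded q g1 C -> norm_bounded q g2 C ->
  norm_bounded q (fun z => g1 z + g2 z + 1)
    (if q is r%:E then (3 `^ r * (2 * C + 1)) else 2 * C + 1)%R.
Proof.
move=> q1 C0 m1 m2 g10 g20.
have mB : measurable B by exact: measurable_unit_ball.
case: q q1 => [r| |]//; last first.
  move=> _ /= h1 h2 z zB; rewrite EFinD leeD//.
  apply: le_trans (leeD (h1 _ zB) (h2 _ zB)) _.
  by rewrite -EFinD lee_fin; lra.
rewrite lee_fin => r1 /= h1 h2.
have r0 : (0 < r)%R by lra.
have mr g : measurable_fun setT g -> measurable_fun B (fun z => g z `^ r).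
  by move=> mg; apply: measurable_funTS; exact: (measurableT_comp (measurable_poweR r) mg).
apply: (@le_trans _ _ (\int[mu]_(z in B) ((3 `^ r)%:E * (g1 z `^ r + g2 z `^ r + 1)))).
  apply: ge0_le_integral_mono => z zB; first exact: poweR_ge0.
  pose m := Order.max (Order.max (g1 z) (g2 z)) 1.
  have m0 : 0 <= m by rewrite /m le_max lee01 orbT.
  have g1m : g1 z <= m by rewrite /m !le_max lexx.
  have g2m : g2 z <= m by rewrite /m !le_max lexx orbT.
  have m1' : 1 <= m by rewrite /m le_max lexx orbT.
  have le1 : g1 z + g2 z + 1 <= 3%:E * m.
    apply: (@le_trans _ _ (m + m + m)); first by do 2?[apply: leeD].
    have -> : 3%:E = 1 + 1 + 1 :> \bar R by rewrite -!EFinD; congr EFin; lra.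
    by rewrite !ge0_muleDl ?mul1e// ?adde_ge0.
  apply: (@le_trans _ _ ((3%:E * m) `^ r)).
    apply: gt0_ler_poweR => //; first exact: ltW.
    - by rewrite in_itv/= leey !adde_ge0.
    - by rewrite in_itv/= leey mule_ge0.
  rewrite poweRM// poweR_EFin lee_wpmul2l ?lee_fin ?powR_ge0//.
  have p1 : 0 <= g1 z `^ r by exact: poweR_ge0.
  have p2 : 0 <= g2 z `^ r by exact: poweR_ge0.
  rewrite {1}/m; case: (leP (Order.max (g1 z) (g2 z)) 1) => [_|_].
    by rewrite poweR1r leeDr// adde_ge0.
  case: (leP (g1 z) (g2 z)) => _.
    by rewrite -addeA; apply: (@le_trans _ _ (g2 z `^ r + 1)); [exact: leeDl|exact: leeDr].
  by rewrite -addeA; apply: leeDl; rewrite adde_ge0.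
have mm1 := mr _ m1; have mm2 := mr _ m2.
have mm : measurable_fun B (fun z => g1 z `^ r + g2 z `^ r) by exact: emeasurable_funD.
have pp z : 0 <= g1 z `^ r + g2 z `^ r by rewrite adde_ge0 ?poweR_ge0.
rewrite ge0_integralZl//; last 2 first.
- exact: emeasurable_funD.
- by move=> z _; rewrite adde_ge0.
rewrite EFinM lee_wpmul2l ?lee_fin ?powR_ge0//.
rewrite ge0_integralD// ge0_integralD//; last 2 first.
- by move=> z _; exact: poweR_ge0.
- by move=> z _; exact: poweR_ge0.
rewrite EFinD; apply: leeD.
  apply: le_trans (leeD h1 h2) _; rewrite -EFinD lee_fin; lra.
rewrite integral_cst// mul1e -[leRHS](ball_measureT n.+1).
by apply: le_measure; rewrite ?inE.
Qed.

End norm_bounds.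

(** * The exponent condition *)

Section exponents.
Context {R : realType}.
Implicit Types p q : \bar R.

(* 1 / p; in \bar R the inverse of +oo is 0. *)
Definition iexp p : R := fine (p^-1)%E.

Lemma iexpy : iexp +oo%E = 0.
Proof. by []. Qed.

Lemma iexp_EFin (r : R) : 1 <= r -> iexp r%:E = r^-1.
Proof. by move=> r1; rewrite /iexp inver gt_eqF//; lra. Qed.

Lemma iexpE p : (1 <= p)%E -> (p^-1 = (iexp p)%:E)%E.
Proof.
case: p => [r| |]//.
by rewrite lee_fin => r1; rewrite iexp_EFin// inver gt_eqF//; lra.
Qed.

Lemma iexp_ge0 p : (1 <= p)%E -> 0 <= iexp p.
Proof.
case: p => [r| |]//.
by rewrite lee_fin => r1; rewrite iexp_EFin// invr_ge0; lra.
Qed.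

Lemma iexp_gt0 p : (1 <= p)%E -> (0 < iexp p) = (p < +oo)%E.
Proof.
case: p => [r| |]//.
by rewrite lee_fin ltry => r1; rewrite iexp_EFin// invr_gt0; apply/idP; lra.
Qed.

Section critical.
Variables (d : nat) (alpha : R).
Hypothesis alpha_range : 0 < alpha <= d.+1%:R.
Local Notation N := (d.+1%:R : R).

Let N0 : 0 < N. Proof. by rewrite ltr0n. Qed.

(** The quantity 1/p + alpha/N - 1 decreases in p and vanishes at the critical exponent. For alpha =
    N it is just 1/p, and the critical exponent is +oo. *)
Lemma critical_exponent_cmp p : (1 <= p)%E ->
  ((p < critical_exponent d alpha)%E <-> 0 < iexp p + alpha / N - 1) /\
  (p = critical_exponent d alpha <-> iexp p + alpha / N - 1 = 0) /\
  ((critical_exponent d alpha < p)%E <-> iexp p + alpha / N - 1 < 0).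
Proof.
move: alpha_range => /andP[a0 aN] p1.
have [aE|aneN] := eqVneq alpha N.
  have -> : critical_exponent d alpha = +oo%E.
    by rewrite /critical_exponent aE subrr inve0 gt0_muley// lte_fin.
  have -> : iexp p + alpha / N - 1 = iexp p by rewrite aE mulfV ?gt_eqF//; ring.
  rewrite -(iexp_gt0 p1); split; [|split] => //.
    case: p p1 => [r| |]// p1.
    have H : 0 < iexp r%:E by rewrite iexp_gt0// ltry.
    by split => [//|h]; move: H; rewrite h ltxx.
  split; first by rewrite ltNge leey.
  by rewrite ltNge (iexp_ge0 p1).
have alN : alpha < N by rewrite lt_neqAle aneN.
have Na : 0 < N - alpha by lra.
have -> : critical_exponent d alpha = (N / (N - alpha))%:E.
  by rewrite /critical_exponent inver gt_eqF.
case: p p1 => [r| |]//; last first.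
  move=> _; rewrite iexpy.
  have : alpha / N < 1 by rewrite ltr_pdivrMr// mul1r.
  rewrite add0r => h; split; [|split].
  - rewrite ltNge leey; split => [//|H].
    by move: H; rewrite subr_gt0 ltNge (ltW h).
  - split => [//|/eqP]; rewrite subr_eq0 => /eqP H.
    by move: h; rewrite H ltxx.
  - by rewrite ltry subr_lt0 h.
rewrite lee_fin => r1; have r0 : 0 < r by lra.
rewrite iexp_EFin//.
have E : r^-1 + alpha / N - 1 = (N - r * (N - alpha)) / (r * N).
  by field; rewrite !gt_eqF.
have rN : 0 < r * N by rewrite mulr_gt0.
rewrite E !lte_fin; split; [|split].
- by rewrite ltr_pdivlMr// pmulr_lgt0 ?invr_gt0// subr_gt0.
- split => [[->]|/eqP]; first by rewrite mulfVK ?gt_eqF// subrr mul0r.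
  rewrite mulf_eq0 invr_eq0 (gt_eqF rN) orbF subr_eq0 => /eqP h.
  by congr EFin; rewrite [X in _ = X / _]h mulfK// gt_eqF.
- by rewrite ltr_pdivrMr// pmulr_llt0 ?invr_gt0// subr_lt0.
Qed.

(** By the sign of 1/p + alpha/N - 1: negative is (d), zero is (c), where 1/q > 0 says q < +oo, and
    positive is (b), or (a) when p = 1, where the quantity reduces to alpha/N. *)
Lemma compactness_conditionE p q : (1 <= p)%E -> (1 <= q)%E ->
  ([\/ (p = 1 /\ q < (N / alpha)%:E),
       ((1 < p < critical_exponent d alpha) /\
          q^-1 > p^-1 + (alpha / N)%:E - 1),
       (p = critical_exponent d alpha /\ q < +oo) |
       (critical_exponent d alpha < p <= +oo)])%E <->
  iexp p + alpha / N - 1 < iexp q.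
Proof.
move=> p1 q1; have [cl [ce cg]] := critical_exponent_cmp p1.
move: (alpha_range) => /andP[a0 aN].
have iq0 := iexp_ge0 q1.
have aN0 : 0 < alpha / N by rewrite divr_gt0.
have mid : (p^-1 + (alpha / N)%:E - 1 < q^-1)%E = (iexp p + alpha / N - 1 < iexp q).
  by rewrite !iexpE.
have e1 : iexp 1 = 1 :> R by rewrite /iexp inve1.
have one : (q < (N / alpha)%:E)%E = (alpha / N < iexp q).
  case: q q1 {iq0 mid} => [s| |]//; last first.
    by move=> _; transitivity false; [rewrite ltNge leey|rewrite iexpy ltNge (ltW aN0)].
  rewrite lee_fin => s1; rewrite iexp_EFin// lte_fin -[in RHS]invf_div ltf_pV2//.
  - by rewrite posrE divr_gt0.
  - by rewrite posrE; lra.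
move: mid one aN0 cl ce cg; move: (alpha / N) => c mid one aN0 cl ce cg.
split.
- case => [[p1E]|[_]|[/ce -> qy]|/andP[/cg c0 _]].
  + by rewrite one p1E e1; lra.
  + by rewrite mid.
  + by rewrite iexp_gt0.
  + by lra.
- move=> H; have [c0|c0|c0] := ltgtP (iexp p + c - 1) 0.
  + by apply: Or44; apply/andP; split; [exact: (cg.2 c0)|exact: leey].
  + have [p1E|pn1] := eqVneq p 1%E.
      by apply: Or41; split => //; rewrite one; move: H; rewrite p1E e1; lra.
    apply: Or42; rewrite mid; split => //; rewrite lt_neqAle eq_sym pn1 p1 /=.
    exact: (cl.2 c0).
  + by apply: Or43; split; [exact: (ce.2 c0)|rewrite -iexp_gt0//; lra].
Qed.

End critical.
End exponents.

Section main_estimate.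
Context {R : realType} {n : nat}.
Local Notation T := (n.+1.-tuple R[i]).
Local Notation mu := (@ball_measure R n.+1).
Local Notation B := (@unit_ball R n.+1).
Local Notation N := (n.+2%:R : R).

(** For p = q = +oo a finite exponent is needed in [Tb_sup]; this one puts its threshold halfway
    between [a] and [M]. *)
Lemma conjugate_midpoint (M a : R) : 0 < M -> 0 < M - a ->
  M * (1 - (2 * M / (M - a))^-1) = (M + a) / 2.
Proof. by move=> M0 Ma; field; rewrite !gt_eqF. Qed.

(** Three regimes: [Tb_sup] for q = +oo, [Tb_young] for p <= q < +oo, [Tb_weight] for q < p. In the
    first two, s is at most half the gap below the critical kernel exponent. The cap s <= 1 is what
    [kernel_shift_dist] needs. *)
Lemma norm_bounded_Tb (p q : \bar R) (alpha : R) : (1 <= p)%E -> (1 <= q)%E ->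
  0 < alpha <= N -> iexp p + alpha / N - 1 < iexp q ->
  exists2 s : R, 0 < s <= 1 & exists2 C : R, 0 <= C & forall F : T -> R[i],
  measurable_fun setT F -> (cLnorm mu p F <= 1)%E ->
  norm_bounded q (Tb (alpha + s) (fun w => normc (F w))) C.
Proof.
move=> p1 q1 /andP[a0 aN] cond.
have N0 : 0 < N by rewrite ltr0n.
have mF (F : T -> R[i]) : measurable_fun setT F -> measurable_fun setT (fun w : T => normc (F w)) by exact (@measurable_normc_comp _ _ R F).
have condE : alpha < N * (1 + iexp q - iexp p).
  by rewrite mulrC -ltr_pdivrMr//; move: (alpha / N) cond => c; lra.
case: q q1 cond condE => [r| |]//; last first.
  rewrite iexpy => _ _; rewrite addr0 => condE.
  have [P P1 [Pp aP]] : exists2 P : R, 1 <= P & (P%:E <= p)%E /\ alpha < N * (1 - P^-1).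
    case: p p1 condE => [P| |]//.
      by rewrite lee_fin => P1; rewrite iexp_EFin// => h; exists P.
    rewrite iexpy subr0 mulr1 => _ aN'.
    have Na : 0 < N - alpha by lra.
    exists (2 * N / (N - alpha)); first by rewrite ler_pdivlMr//; lra.
    rewrite leey; split => //.
    by rewrite conjugate_midpoint//; lra.
  pose s := Num.min 1 ((N * (1 - P^-1) - alpha) / 2).
  have s0 : 0 < s by rewrite lt_min ltr01 divr_gt0// subr_gt0.
  have s1 : s <= 1 by rewrite ge_min lexx.
  have s2 : s <= (N * (1 - P^-1) - alpha) / 2 by rewrite ge_min lexx orbT.
  exists s; first by rewrite s0 s1.
  have b0 : 0 <= alpha + s by lra.
  have b1 : alpha + s < N * (1 - P^-1) by lra.
  have [C C0 HC] := @Tb_sup R n P _ P1 b0 b1.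
  exists C => // F mF' Fp /=; apply: HC; [exact: mF|by move=> w; exact: normc_ge0|].
  exact: (cLnorm_le1_power P1 Pp).
rewrite lee_fin => r1 _; rewrite iexp_EFin// => condE.
have r0 : 0 < r by lra.
have [pr|rp] := leP p r%:E.
  case: p p1 condE pr => [P| |]//; rewrite lee_fin => P1.
  rewrite iexp_EFin// lee_fin => condE Pr.
  pose s := Num.min 1 ((N * (1 + r^-1 - P^-1) - alpha) / 2).
  have s0 : 0 < s by rewrite lt_min ltr01 divr_gt0// subr_gt0.
  have s1 : s <= 1 by rewrite ge_min lexx.
  have s2 : s <= (N * (1 + r^-1 - P^-1) - alpha) / 2 by rewrite ge_min lexx orbT.
  exists s; first by rewrite s0 s1.
  have b0 : 0 <= alpha + s by lra.
  have b1 : alpha + s < N * (1 + r^-1 - P^-1) by lra.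
  have [C C0 HC] := @Tb_young R n P r _ P1 Pr b0 b1.
  exists C => // F mF' Fp /=; apply: HC; [exact: mF|by move=> w; exact: normc_ge0|].
  exact: (cLnorm_le1_power P1 (lexx _)).
have [P rP Pp] : exists2 P : R, r < P & (P%:E <= p)%E.
  case: p p1 condE rp => [P| |]//; first by rewrite lte_fin => _ _ rP; exists P.
  by move=> _ _ _; exists (r + 1); rewrite ?leey//; lra.
have P1 : 1 <= P by lra.
have [t t0 [C C0 HC]] := @Tb_weight R n P r r1 rP.
pose s := Num.min 1 t.
have s0 : 0 < s by rewrite lt_min ltr01 t0.
have s1 : s <= 1 by rewrite ge_min lexx.
have st : s <= t by rewrite ge_min lexx orbT.
exists s; first by rewrite s0 s1.
(* Since alpha + s <= N + t and kap <= 2, lowering the kernel exponent from N + t to alpha + s costs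
   this factor. *)
pose c := 2 `^ (N + t - (alpha + s)).
exists (c `^ r * C); first by rewrite mulr_ge0 ?powR_ge0.
move=> F mF' Fp /=.
have fp := cLnorm_le1_power P1 Pp mF' Fp.
have mf := mF _ mF'.
have f0 w : 0 <= normc (F w) by exact: normc_ge0.
have {}HC := HC _ mf f0 fp.
have c0 : 0 <= c by exact: powR_ge0.
have cE : (0 <= c%:E)%E by rewrite lee_fin.
have crE : (0 <= (c `^ r)%:E)%E by rewrite lee_fin powR_ge0.
have Tle z : B z -> (Tb (alpha + s) (fun w => normc (F w)) z <=
    c%:E * Tb (N + t) (fun w => normc (F w)) z)%E.
  move=> zB; rewrite /Tb -ge0_integralZl//; last 3 first.
  - exact: measurable_unit_ball.
  - apply/measurable_EFinP; apply: measurable_funM; first exact: measurable_funTS.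
    apply: measurable_funTS; apply: (measurableT_comp (measurable_powR _)).
    exact: measurable_kap.
  - by move=> w _; rewrite lee_fin mulr_ge0 ?powR_ge0.
  apply: ge0_le_integral_mono => w wB; first by rewrite lee_fin mulr_ge0 ?powR_ge0.
  rewrite -EFinM lee_fin mulrCA ler_wpM2l//.
  have k0 := kap_gt0 zB wB.
  have -> : - (alpha + s) = (N + t - (alpha + s)) + - (N + t) by ring.
  rewrite powRD; last by apply/implyP => _; rewrite gt_eqF.
  rewrite ler_wpM2r ?powR_ge0//; apply: ge0_ler_powR; rewrite ?nnegrE//.
  - by lra.
  - exact: ltW.
  - exact: kap_le2.
have mT : measurable_fun setT (Tb (N + t) (fun w => normc (F w))) by exact: measurable_Tb.
apply: (@le_trans _ _ (\int[mu]_(z in B) ((c `^ r)%:E *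
    Tb (N + t) (fun w => normc (F w)) z `^ r))%E).
  apply: ge0_le_integral_mono => z zB; first exact: poweR_ge0.
  rewrite -poweR_EFin -poweRM//; last exact: Tb_ge0.
  apply: gt0_ler_poweR; [exact: ltW| | |exact: Tle].
  - by rewrite in_itv/= leey Tb_ge0.
  - by rewrite in_itv/= leey mule_ge0// Tb_ge0.
rewrite ge0_integralZl//; last 3 first.
- exact: measurable_unit_ball.
- by apply: measurable_funTS; exact: (measurableT_comp (measurable_poweR r) mT).
- by move=> z _; exact: poweR_ge0.
by rewrite EFinM lee_wpmul2l.
Qed.

End main_estimate.

(** * Approximation of the operator *)

Section kernel_integrals.
Context {R : realType} {n : nat}.
Local Notation T := (n.+1.-tuple R[i]).
Local Notation mu := (@ball_measure R n.+1).
Local Notation B := (@unit_ball R n.+1).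

Definition Cint (kr ki : T -> R) (F : T -> R[i]) : R[i] :=
  Complex (Rintegral mu B (fun w => cRe (F w) * kr w - cIm (F w) * ki w))
          (Rintegral mu B (fun w => cRe (F w) * ki w + cIm (F w) * kr w)).

Lemma measurable_cRe (F : T -> R[i]) : measurable_fun setT F ->
  measurable_fun setT (fun w => cRe (F w)).
Proof. by move=> /measurable_fun_complexP[]. Qed.

Lemma measurable_cIm (F : T -> R[i]) : measurable_fun setT F ->
  measurable_fun setT (fun w => cIm (F w)).
Proof. by move=> /measurable_fun_complexP[]. Qed.

Lemma integrable_kernel (F : T -> R[i]) (g k : T -> R) (A M : R) :
  measurable_fun setT F -> (\int[mu]_(w in B) (normc (F w))%:E <= A%:E)%E ->
  measurable_fun setT g -> (forall w, `|g w| <= normc (F w)) ->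
  measurable_fun setT k -> (forall w, B w -> `|k w| <= M) ->
  mu.-integrable B (EFin \o (fun w => g w * k w)).
Proof.
move=> mF FA mg gF mk kM.
have mB : measurable B by exact: measurable_unit_ball.
have mgk : measurable_fun B (fun w => g w * k w).
  by apply: measurable_funTS; exact: measurable_funM.
apply/integrableP; split; first exact/measurable_EFinP.
apply: (@le_lt_trans _ _ (\int[mu]_(w in B) (`|M|%:E * (normc (F w))%:E))%E).
  apply: ge0_le_integral_mono => w wB; first exact: abse_ge0.
  rewrite /= -EFinM lee_fin normrM mulrC; apply: ler_pM => //.
  exact: le_trans (kM w wB) (ler_norm _).
rewrite ge0_integralZl//; last 2 first.
- by apply/measurable_EFinP; apply: measurable_funTS; exact (@measurable_normc_comp _ _ R F mF).
- by move=> w _; rewrite lee_fin normc_ge0.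
apply: (@le_lt_trans _ _ (`|M|%:E * A%:E)%E); first exact: lee_wpmul2l.
by rewrite -EFinM ltry.
Qed.

Lemma Rintegral_bound (h : T -> R) (m : T -> R) : measurable_fun setT h ->
  (forall w, B w -> `|h w| <= m w) ->
  (`|Rintegral mu B h|%:E <= \int[mu]_(w in B) (m w)%:E)%E.
Proof.
move=> mh hm; have mB : measurable B by exact: measurable_unit_ball.
apply: (@le_trans _ _ (`|\int[mu]_(w in B) (h w)%:E|)%E).
  rewrite /Rintegral; case: (\int[mu]_(w in B) (h w)%:E)%E => [x| |] /=;
  by rewrite ?normr0 ?leey.
apply: le_trans (le_abse_integral mu mB _) _.
  by apply/measurable_EFinP; exact: measurable_funTS.
by apply: ge0_le_integral_mono => w wB; rewrite ?lee_fin// hm.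
Qed.

(** The constant 4 counts the four real products in the two components. The bound [M] only
    guarantees that the integrals can be subtracted, and it is absent from the estimate. *)
Lemma Cint_dist (F : T -> R[i]) (kr ki kr' ki' m : T -> R) (A M : R) :
  measurable_fun setT F -> (\int[mu]_(w in B) (normc (F w))%:E <= A%:E)%E ->
  measurable_fun setT kr -> measurable_fun setT ki ->
  measurable_fun setT kr' -> measurable_fun setT ki' -> measurable_fun setT m ->
  (forall w, B w -> `|kr w| <= M) -> (forall w, B w -> `|ki w| <= M) ->
  (forall w, B w -> `|kr' w| <= M) -> (forall w, B w -> `|ki' w| <= M) ->
  (forall w, B w -> `|kr w - kr' w| <= m w) ->
  (forall w, B w -> `|ki w - ki' w| <= m w) ->
  ((normc (Cint kr ki F - Cint kr' ki' F))%:E <=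
    4%:E * \int[mu]_(w in B) (normc (F w) * m w)%:E)%E.
Proof.
move=> mF FA mkr mki mkr' mki' mm bkr bki bkr' bki' dr di.
have mB : measurable B by exact: measurable_unit_ball.
have mRe := measurable_cRe mF; have mIm := measurable_cIm mF.
have I1 (k : T -> R) : measurable_fun setT k -> (forall w, B w -> `|k w| <= M) ->
    mu.-integrable B (EFin \o (fun w => cRe (F w) * k w)).
  by move=> mk kM; apply: (integrable_kernel mF FA mRe _ mk kM) => w; exact: normc_Re.
have I2 (k : T -> R) : measurable_fun setT k -> (forall w, B w -> `|k w| <= M) ->
    mu.-integrable B (EFin \o (fun w => cIm (F w) * k w)).
  by move=> mk kM; apply: (integrable_kernel mF FA mIm _ mk kM) => w; exact: normc_Im.
have IB (f g : T -> R) : mu.-integrable B (EFin \o f) -> mu.-integrable B (EFin \o g) ->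
    mu.-integrable B (EFin \o (fun w => f w - g w)).
  by move=> If Ig; exact: (integrableB mB If Ig).
have ID (f g : T -> R) : mu.-integrable B (EFin \o f) -> mu.-integrable B (EFin \o g) ->
    mu.-integrable B (EFin \o (fun w => f w + g w)).
  by move=> If Ig; exact: (integrableD mB If Ig).
rewrite /Cint; set z := _ - _.
have dRe : (`|cRe z|%:E <= \int[mu]_(w in B) (2 * (normc (F w) * m w))%:E)%E.
  rewrite /z /= -RintegralB//; last 2 first.
  - by apply: IB; [exact: I1|exact: I2].
  - by apply: IB; [exact: I1|exact: I2].
  apply: Rintegral_bound.
    by apply: measurable_funB; apply: measurable_funB; exact: measurable_funM.
  move=> w wB.
  have -> : cRe (F w) * kr w - cIm (F w) * ki w - (cRe (F w) * kr' w - cIm (F w) * ki' w)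
    = cRe (F w) * (kr w - kr' w) - cIm (F w) * (ki w - ki' w) by ring.
  apply: le_trans (ler_normB _ _) _; rewrite !normrM mulr_natl mulr2n; apply: lerD.
    by apply: ler_pM => //; [exact: normc_Re|exact: dr].
  by apply: ler_pM => //; [exact: normc_Im|exact: di].
have dIm : (`|cIm z|%:E <= \int[mu]_(w in B) (2 * (normc (F w) * m w))%:E)%E.
  rewrite /z /= -RintegralB//; last 2 first.
  - by apply: ID; [exact: I1|exact: I2].
  - by apply: ID; [exact: I1|exact: I2].
  apply: Rintegral_bound.
    by apply: measurable_funB; apply: measurable_funD; exact: measurable_funM.
  move=> w wB.
  have -> : cRe (F w) * ki w + cIm (F w) * kr w - (cRe (F w) * ki' w + cIm (F w) * kr' w)
    = cRe (F w) * (ki w - ki' w) + cIm (F w) * (kr w - kr' w) by ring.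
  apply: le_trans (ler_normD _ _) _; rewrite !normrM mulr_natl mulr2n; apply: lerD.
    by apply: ler_pM => //; [exact: normc_Re|exact: di].
  by apply: ler_pM => //; [exact: normc_Im|exact: dr].
apply: (@le_trans _ _ (`|cRe z|%:E + `|cIm z|%:E)%E).
  by rewrite -EFinD lee_fin normc_ReIm.
apply: le_trans (leeD dRe dIm) _.
set X := (\int[mu]_(w in B) (2 * (normc (F w) * m w))%:E)%E.
set Y := (\int[mu]_(w in B) (normc (F w) * m w)%:E)%E.
have m0 w : B w -> 0 <= m w by move=> wB; exact: le_trans (normr_ge0 _) (dr w wB).
have Y0 : (0 <= Y)%E.
  by apply: integral_ge0 => w wB; rewrite lee_fin mulr_ge0 ?normc_ge0 ?m0.
have XY : X = (2%:E * Y)%E.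
  rewrite /Y -ge0_integralZl//; last 2 first.
  - apply/measurable_EFinP; apply: measurable_funTS; apply: measurable_funM => //.
    exact (@measurable_normc_comp _ _ R F mF).
  - by move=> w wB; rewrite lee_fin mulr_ge0 ?normc_ge0 ?m0.
by rewrite XY -ge0_muleDl// -EFinD -natrD.
Qed.

Variable alpha : R.
Hypothesis alpha0 : 0 <= alpha.

(* Real and imaginary parts of (1 + h - <z,w>)^-alpha. *)
Definition kRe (h : R) (z w : T) : R :=
  kerR alpha (cRe (1 - cdot z w) + h) (cIm (1 - cdot z w)).
Definition kIm (h : R) (z w : T) : R :=
  kerI alpha (cRe (1 - cdot z w) + h) (cIm (1 - cdot z w)).

Definition Kop (h : R) (F : T -> R[i]) (z : T) : R[i] :=
  Cint (kRe h z) (kIm h z) F.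

Lemma measurable_kernel d' (S : measurableType d') (f g : S -> T) (h : R) :
  measurable_fun setT f -> measurable_fun setT g ->
  measurable_fun setT (fun x => kRe h (f x) (g x)) /\
  measurable_fun setT (fun x => kIm h (f x) (g x)).
Proof.
move=> mf mg.
have mc : measurable_fun setT (fun x => 1 - cdot (f x) (g x)).
  by apply: measurable_funB_complex => //; exact: measurable_cdot.
have [mr mi] := (measurable_fun_complexP _).1 mc.
by apply: measurable_kerRI => //; exact: measurable_funD.
Qed.

Lemma measurable_kRe h z : measurable_fun setT (kRe h z).
Proof. by have [] := @measurable_kernel _ T (fun=> z) id h (measurable_cst z) (@measurable_id _ _ _). Qed.

Lemma measurable_kIm h z : measurable_fun setT (kIm h z).
Proof. by have [] := @measurable_kernel _ T (fun=> z) id h (measurable_cst z) (@measurable_id _ _ _). Qed.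

Lemma kapE (z w : T) :
  kap z w = Num.sqrt (cRe (1 - cdot z w) ^+ 2 + cIm (1 - cdot z w) ^+ 2).
Proof. by rewrite /kap; case: (1 - cdot z w). Qed.

Lemma kernel_bound h z w (e : R) : 0 < e -> e <= cRe (1 - cdot z w) + h ->
  `|kRe h z w| <= e `^ (- alpha) /\ `|kIm h z w| <= e `^ (- alpha).
Proof.
move=> e0 eh; have x0 : 0 < cRe (1 - cdot z w) + h by lra.
have H := ker_normE alpha (cRe (1 - cdot z w) + h) (cIm (1 - cdot z w)).
have mle : Num.sqrt ((cRe (1 - cdot z w) + h) ^+ 2 + cIm (1 - cdot z w) ^+ 2) `^ (- alpha)
    <= e `^ (- alpha).
  have := le_modulus (cIm (1 - cdot z w)) x0; set m := Num.sqrt _ => xm.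
  have m0 : 0 < m by lra.
  rewrite !powRN lef_pV2 ?posrE ?powR_gt0//.
  by apply: ge0_ler_powR => //; rewrite ?nnegrE; lra.
split; apply: le_trans mle; rewrite -H.
  exact: (normc_Re (Complex (kRe h z w) (kIm h z w))).
exact: (normc_Im (Complex (kRe h z w) (kIm h z w))).
Qed.

Lemma K_opE (F : T -> R[i]) (z : T) : B z -> K_op alpha F z = Kop 0 F z.
Proof.
move=> zB; rewrite /K_op /cintegral /Kop /Cint.
have E w : B w -> F w / cpow (1 - cdot z w) alpha =
    F w * Complex (kRe 0 z w) (kIm 0 z w).
  move=> wB; congr (_ * _); have := cRe1B_gt0 zB wB; rewrite /kRe /kIm addr0.
  by case: (1 - cdot z w) => a b /= a0; exact: cpowV.
congr Complex; apply: eq_Rintegral => w /set_mem wB /=; rewrite E//;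
  by case: (F w) => a b.
Qed.

(** The positive and negative parts of each integrand have integrals measurable in [z] by Tonelli,
    and [Rintegral] is [fine] of their difference. *)
Lemma measurable_Kop h (F : T -> R[i]) : measurable_fun setT F ->
  measurable_fun setT (Kop h F).
Proof.
move=> mF.
have mparam (g : T * T -> R) : measurable_fun setT g ->
    measurable_fun setT (fun z => Rintegral mu B (fun w => g (z, w))).
  move=> mg.
  have mE : measurable_fun setT (fun x => (g x)%:E) by exact/measurable_EFinP.
  have mp := measurable_ball_integral (measurable_funepos mE) (funepos_ge0 _).
  have mn := measurable_ball_integral (measurable_funeneg mE) (funeneg_ge0 _).
  rewrite (_ : (fun z => _) = fine \o (fun z =>
     (\int[mu]_(w in B) (fun x => (g x)%:E)^\+ (z, w)) -
     (\int[mu]_(w in B) (fun x => (g x)%:E)^\- (z, w)))%E).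
    apply: (measurableT_comp (@fine_measurable R setT measurableT)).
    exact: emeasurable_funB.
  apply/funext => z; rewrite /Rintegral integralE /=; congr (fine (_ - _)%E);
  by apply: eq_integral => w _; rewrite ?funeposE ?funenegE.
have mRe := measurable_cRe mF; have mIm := measurable_cIm mF.
have [mkr mki] := @measurable_kernel _ (T * T)%type fst snd h measurable_fst measurable_snd.
have mRe2 : measurable_fun setT (fun x : T * T => cRe (F x.2)).
  exact: (measurableT_comp mRe measurable_snd).
have mIm2 : measurable_fun setT (fun x : T * T => cIm (F x.2)).
  exact: (measurableT_comp mIm measurable_snd).
apply/measurable_fun_complexP; split.
  apply: (mparam (fun x => cRe (F x.2) * kRe h x.1 x.2 - cIm (F x.2) * kIm h x.1 x.2)).
  by apply: measurable_funB; exact: measurable_funM.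
apply: (mparam (fun x => cRe (F x.2) * kIm h x.1 x.2 + cIm (F x.2) * kRe h x.1 x.2)).
by apply: measurable_funD; exact: measurable_funM.
Qed.

End kernel_integrals.

Lemma exists_small_ratio (R : realType) (a t : R) : 0 <= a -> 0 < t ->
  exists2 m : nat, (0 < m)%N & a / m%:R <= t.
Proof.
move=> a0 t0; exists (Num.bound (a / t)).+1 => //.
rewrite ler_pdivrMr ?ltr0n// mulrC -ler_pdivrMr//.
apply: ltW; apply: (@lt_le_trans _ _ (Num.bound (a / t))%:R).
  by apply: archi_boundP; rewrite divr_ge0// ltW.
by rewrite ler_nat.
Qed.

(** Equal integer parts after scaling by m put the values within 1/m. The bound 2 M m <= k keeps
    both integer parts in the range where [inord] is faithful. *)
Lemma truncn_code (R : realType) (u u' M : R) (m k : nat) : (0 < m)%N ->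
  `|u| <= M -> `|u'| <= M -> 2 * M * m%:R <= k%:R ->
  inord (Num.truncn ((u + M) * m%:R)) = inord (Num.truncn ((u' + M) * m%:R)) :> 'I_k.+1 ->
  `|u - u'| <= m%:R^-1.
Proof.
move=> m0 uM uM' Mk.
have mp : 0 < m%:R :> R by rewrite ltr0n.
have H (v : R) : `|v| <= M -> 0 <= (v + M) * m%:R /\
    (Num.truncn ((v + M) * m%:R) < k.+1)%N.
  rewrite ler_norml => /andP[v1 v2].
  have y0 : 0 <= (v + M) * m%:R by rewrite mulr_ge0 ?ler0n//; lra.
  split => //; have /andP[k1 k2] := truncn_itv y0.
  rewrite ltnS -(ler_nat R); apply: le_trans k1 _; apply: le_trans Mk.
  by rewrite ler_wpM2r ?ler0n//; lra.
have [y0 yk] := H _ uM; have [y0' yk'] := H _ uM'.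
move=> /(congr1 val); rewrite /= !inordK// => E.
have /andP[a1 a2] := truncn_itv y0; have /andP[b1 b2] := truncn_itv y0'.
rewrite E in a1 a2.
have -> : u - u' = ((u + M) * m%:R - (u' + M) * m%:R) / m%:R by field; rewrite gt_eqF.
rewrite normrM [X in _ * X]gtr0_norm ?invr_gt0// ler_piMl ?invr_ge0 ?ler0n//.
move: a1 a2 b1 b2; rewrite -addn1 natrD.
move: (Num.truncn _)%:R => t a1 a2 b1 b2.
by rewrite ler_norml; apply/andP; split; lra.
Qed.

(** * Moving the kernel off its singularity and coding its values on a grid *)

Section kernel_approximation.
Context {R : realType} {n : nat}.
Local Notation T := (n.+1.-tuple R[i]).
Local Notation mu := (@ball_measure R n.+1).
Local Notation B := (@unit_ball R n.+1).
Variable alpha : R.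
Hypothesis alpha0 : 0 <= alpha.

Local Notation kRe := (kRe alpha).
Local Notation kIm := (kIm alpha).
Local Notation Kop := (Kop alpha).

(** With u = h / kap, the difference is at most kap^-alpha times both 4 alpha u and 2. As 0 < s <=
    1, u <= u^s for u <= 1 and 1 <= u^s for u >= 1, so (4 alpha + 2) u^s covers both ranges. *)
Lemma kernel_shift_dist (h s : R) (z w : T) : 0 < h -> 0 < s <= 1 -> B z -> B w ->
  normc (Complex (kRe 0 z w - kRe h z w) (kIm 0 z w - kIm h z w)) <=
    (4 * alpha + 2) * h `^ s * kap z w `^ (- (alpha + s)).
Proof.
move=> h0 /andP[s0 s1] zB wB; have a0 := cRe1B_gt0 zB wB; have k0 := kap_gt0 zB wB.
rewrite /kRe /kIm addr0; set a := cRe _; set b := cIm _.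
have kE : Num.sqrt (a ^+ 2 + b ^+ 2) = kap z w by rewrite kapE.
have ha0 : 0 <= alpha by exact: alpha0.
have H1 := ker_shift ha0 b a0 (ltW h0).
rewrite -/a -/b kE in H1.
have ah0 : 0 < a + h by rewrite addr_gt0.
have m1 := modulus_gt0 b a0.
have m2 := modulus_gt0 b ah0.
have mo2 : Num.sqrt ((a + h) ^+ 2 + b ^+ 2) `^ (- alpha) <= kap z w `^ (- alpha).
  rewrite -kE !powRN lef_pV2 ?posrE ?powR_gt0//.
  apply: ge0_ler_powR; rewrite ?nnegrE ?sqrtr_ge0//.
  rewrite ler_sqrt ?addr_ge0 ?sqr_ge0// lerD2r.
  by apply: lerXn2r; rewrite ?nnegrE ?lerDl; exact: ltW.
set P := kap z w `^ (- alpha) in H1 mo2 *.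
have P0 : 0 <= P by exact: powR_ge0.
have H2 : normc (Complex (kerR alpha a b - kerR alpha (a + h) b)
    (kerI alpha a b - kerI alpha (a + h) b)) <= 2 * P.
  have := le_normcD (Complex (kerR alpha a b) (kerI alpha a b))
    (- Complex (kerR alpha (a + h) b) (kerI alpha (a + h) b)).
  rewrite normcN !ker_normE kE => H; apply: le_trans H _.
  by rewrite mulr_natl mulr2n lerD2l.
rewrite opprD powRD; last by apply/implyP => _; rewrite gt_eqF.
rewrite -/P.
have -> : (4 * alpha + 2) * h `^ s * (P * kap z w `^ (- s)) =
    (4 * alpha + 2) * P * (h / kap z w) `^ s.
  rewrite powRM; [|exact: ltW|by rewrite invr_ge0 ltW].
  have -> : (kap z w)^-1 `^ s = kap z w `^ (- s).
    by rewrite -powR_inv1 ?(ltW k0)// -powRrM mulN1r.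
  by ring.
have u0 : 0 < h / kap z w by rewrite divr_gt0.
have [u1|/ltW u1] := leP (h / kap z w) 1.
  apply: le_trans H1 _.
  have us : h / kap z w <= (h / kap z w) `^ s.
    by apply: ger1_powR => //; rewrite u0.
  apply: ler_pM => //.
  - by rewrite !mulr_ge0.
  - exact: ltW.
  - by rewrite ler_wpM2r// lerDl.
apply: le_trans H2 _; rewrite -[leLHS]mulr1; apply: ler_pM => //.
- by rewrite mulr_ge0.
- by rewrite ler_wpM2r// lerDr mulr_ge0.
- by rewrite -(powR1r s); apply: ge0_ler_powR; rewrite ?nnegrE//; exact: ltW.
Qed.

Lemma Kop_shift_dist (h s A : R) (F : T -> R[i]) (z : T) : 0 < h -> 0 < s <= 1 ->
  measurable_fun setT F -> (\int[mu]_(w in B) (normc (F w))%:E <= A%:E)%E -> B z ->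
  ((normc (Kop 0 F z - Kop h F z))%:E <=
    (4 * ((4 * alpha + 2) * h `^ s))%:E * Tb (alpha + s) (fun w => normc (F w)) z)%E.
Proof.
move=> h0 s01 mF FA zB.
have z1 : 0 < (1 - sqn z) / 2 by rewrite divr_gt0// subr_gt0.
pose M := ((1 - sqn z) / 2) `^ (- alpha).
pose c := (4 * alpha + 2) * h `^ s.
have c0 : 0 <= c by rewrite mulr_ge0 ?powR_ge0// addr_ge0// mulr_ge0.
have kb h' : 0 <= h' -> forall w, B w -> `|kRe h' z w| <= M /\ `|kIm h' z w| <= M.
  move=> h0' w wB; apply: kernel_bound => //.
  have := cRe1B_ge z w; move: wB; rewrite unit_ballP; move: h0'; clear; lra.
have mkap : measurable_fun setT (fun w => c * kap z w `^ (- (alpha + s))).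
  apply: measurable_funM => //; apply: (measurableT_comp (measurable_powR _)).
  exact: measurable_kap.
have h0' := ltW h0.
apply: le_trans (@Cint_dist R n F (kRe 0 z) (kIm 0 z) (kRe h z) (kIm h z)
   (fun w => c * kap z w `^ (- (alpha + s))) A M mF FA
   (measurable_kRe alpha 0 z) (measurable_kIm alpha 0 z) (measurable_kRe alpha h z)
   (measurable_kIm alpha h z) mkap _ _ _ _ _ _) _.
- by move=> w wB; have [] := kb 0 (lexx _) w wB.
- by move=> w wB; have [] := kb 0 (lexx _) w wB.
- by move=> w wB; have [] := kb h h0' w wB.
- by move=> w wB; have [] := kb h h0' w wB.
- by move=> w wB; apply: le_trans (kernel_shift_dist h0 s01 zB wB); exact:
    (normc_Re (Complex (kRe 0 z w - kRe h z w) (kIm 0 z w - kIm h z w))).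
- by move=> w wB; apply: le_trans (kernel_shift_dist h0 s01 zB wB); exact:
    (normc_Im (Complex (kRe 0 z w - kRe h z w) (kIm 0 z w - kIm h z w))).
have mB : measurable B by exact: measurable_unit_ball.
rewrite (eq_integral (fun w => (c%:E * (normc (F w) * kap z w `^ (- (alpha + s)))%:E)%E));
  last by move=> w _; rewrite -EFinM; congr EFin; ring.
rewrite ge0_integralZl//; last 2 first.
- apply/measurable_EFinP; apply: measurable_funTS; apply: measurable_funM.
    exact (@measurable_normc_comp _ _ R F mF).
  by apply: (measurableT_comp (measurable_powR _)); exact: measurable_kap.
- by move=> w _; rewrite lee_fin mulr_ge0 ?normc_ge0 ?powR_ge0.
by rewrite muleA -EFinM.
Qed.

Lemma truncn_grid (x : R) (m : nat) : (0 < m)%N -> `|x| <= 1 ->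
  exists k : 'I_(2 * m).+1, `|x - (k%:R / m%:R - 1)| <= m%:R^-1.
Proof.
move=> m0; rewrite ler_norml => /andP[x1 x2].
have mp : 0 < m%:R :> R by rewrite ltr0n.
have y0 : 0 <= (x + 1) * m%:R by rewrite mulr_ge0 ?ler0n//; lra.
have /andP[k1 k2] := truncn_itv y0.
have k3 : (Num.truncn ((x + 1) * m%:R) < (2 * m).+1)%N.
  rewrite ltnS -(ler_nat R) natrM; apply: le_trans k1 _.
  by rewrite ler_wpM2r ?ler0n//; lra.
exists (Ordinal k3) => /=; set k := Num.truncn _ in k1 k2 *.
have -> : x - (k%:R / m%:R - 1) = ((x + 1) * m%:R - k%:R) / m%:R.
  by field; rewrite gt_eqF.
rewrite normrM [X in _ * X]gtr0_norm ?invr_gt0// ler_piMl ?invr_ge0 ?ler0n//.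
rewrite ger0_norm ?subr_ge0//.
by move: k2; rewrite -addn1 natrD; lra.
Qed.

(** Coordinates run over a mesh of [-1, 1], so a grid point may lie outside the ball; this is why
    [Kop_bound] and [Kop_lipschitz] ask only for positivity near such a point, derived from a nearby
    point of the ball. *)
Definition grid_point (m : nat) (kk : {ffun 'I_n.+1 -> 'I_(2 * m).+1 * 'I_(2 * m).+1}) : T :=
  [tuple Complex ((kk i).1%:R / m%:R - 1) ((kk i).2%:R / m%:R - 1) | i < n.+1].

Lemma grid_approx (m : nat) (z : T) : (0 < m)%N -> B z ->
  exists kk, forall w, B w ->
    normc (cdot z w - cdot (@grid_point m kk) w) <= 2 * n.+1%:R / m%:R :> R.
Proof.
move=> m0 zB.
have zj j : `|cRe (tnth z j)| <= 1 /\ `|cIm (tnth z j)| <= 1.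
  have := unit_ball_coord j zB; have := normc_Re (tnth z j); have := normc_Im (tnth z j).
  by split; lra.
have ex j : exists kk : 'I_(2 * m).+1 * 'I_(2 * m).+1,
   `|cRe (tnth z j) - (kk.1%:R / m%:R - 1)| <= m%:R^-1 /\
   `|cIm (tnth z j) - (kk.2%:R / m%:R - 1)| <= m%:R^-1.
  have [k1 H1] := truncn_grid m0 (zj j).1.
  have [k2 H2] := truncn_grid m0 (zj j).2.
  by exists (k1, k2).
have [f Hf] := choice ex.
exists [ffun j => f j] => w wB.
have -> : cdot z w - cdot (@grid_point m [ffun j => f j]) w =
    \sum_(j < n.+1) (tnth z j - tnth (@grid_point m [ffun j => f j]) j) * conjc (tnth w j).
  by rewrite /cdot -sumrB; apply: eq_bigr => j _; rewrite mulrBl.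
apply: le_trans (normc_sum _ _) _.
apply: (@le_trans _ _ (\sum_(j < n.+1) (2 / m%:R))).
  apply: ler_sum => j _; rewrite normcM normc_conjc.
  apply: (@le_trans _ _ (normc (tnth z j - tnth (@grid_point m [ffun j => f j]) j))).
    by rewrite ler_piMr ?normc_ge0// ltW// unit_ball_coord.
  apply: le_trans (normc_ReIm _) _; rewrite tnth_mktuple ffunE cReD cImD cReN cImN /=.
  have [h1 h2] := Hf j.
  have -> : 2 / m%:R = m%:R^-1 + m%:R^-1 :> R by ring.
  exact: lerD.
rewrite sumr_const card_ord -[leLHS]mulr_natl.
by rewrite le_eqVlt; apply/orP; left; apply/eqP; ring.
Qed.

Definition L1_bounded (F : T -> R[i]) : Prop :=
  measurable_fun setT F /\ (\int[mu]_(w in B) (normc (F w))%:E <= 2%:E)%E.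

Lemma Cint0 (F : T -> R[i]) : Cint (fun=> 0) (fun=> 0) F = 0.
Proof.
rewrite /Cint.
have Z (f : T -> R) : (forall w, f w = 0) -> Rintegral mu B f = 0.
  move=> f0; rewrite /Rintegral integral0_eq//= => w _; by rewrite f0.
by rewrite !Z// => w; rewrite !mulr0 ?subr0 ?addr0.
Qed.

Lemma integral_normc_cst (F : T -> R[i]) (c : R) : L1_bounded F -> 0 <= c ->
  (4%:E * \int[mu]_(w in B) (normc (F w) * c)%:E <= (8 * c)%:E)%E.
Proof.
move=> [mF F2] c0.
have mB : measurable B by exact: measurable_unit_ball.
rewrite (eq_integral (fun w => (normc (F w))%:E * c%:E)%E); last by move=> w _; rewrite EFinM.
rewrite ge0_integralZr//; last 2 first.
- by apply/measurable_EFinP; apply: measurable_funTS; exact (@measurable_normc_comp _ _ R F mF).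
- by move=> w _; rewrite lee_fin normc_ge0.
apply: (@le_trans _ _ (4%:E * (2%:E * c%:E))%E).
  by apply: lee_wpmul2l => //; apply: lee_wpmul2r.
by rewrite -!EFinM lee_fin; lra.
Qed.

Lemma Kop_bound (F : T -> R[i]) (h e : R) (z : T) : L1_bounded F -> 0 < e ->
  (forall w, B w -> e <= cRe (1 - cdot z w) + h) ->
  normc (Kop h F z) <= 8 * e `^ (- alpha).
Proof.
move=> F1 e0 eh; have [mF F2] := F1.
have M0 : 0 <= e `^ (- alpha) by exact: powR_ge0.
have kb w : B w -> `|kRe h z w| <= e `^ (- alpha) /\ `|kIm h z w| <= e `^ (- alpha).
  by move=> wB; apply: kernel_bound => //; exact: eh.
rewrite -lee_fin -[Kop h F z]subr0 -(Cint0 F).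
apply: le_trans (integral_normc_cst F1 M0).
have H := @Cint_dist R n F (kRe h z) (kIm h z) (fun=> 0) (fun=> 0) (fun=> e `^ (- alpha))
  2 (e `^ (- alpha)) mF F2 (measurable_kRe alpha h z) (measurable_kIm alpha h z)
  (measurable_cst _) (measurable_cst _) (measurable_cst _).
by apply: H => w wB; rewrite ?subr0 ?normr0//; have [] := kb w wB.
Qed.

(** A perturbation of <z,w> by at most h / 2 leaves real parts at least h / 2 after the shift by h,
    where [ker_lipschitz] applies uniformly in w. The constant depends on F only through its L^1
    bound. *)
Lemma Kop_lipschitz (h : R) : 0 < h -> exists2 L : R, 0 <= L &
  forall F z p delta, L1_bounded F -> B z -> delta <= h / 2 ->
  (forall w, B w -> normc (cdot z w - cdot p w) <= delta) ->
  normc (Kop h F z - Kop h F p) <= L * delta.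
Proof.
move=> h0; have h20 : 0 < h / 2 by rewrite divr_gt0.
have [L L0 HL] := ker_lipschitz alpha0 (1 + h) h20.
exists (16 * L); first by rewrite mulr_ge0.
move=> F z p delta F1 zB dh zp; have [mF F2] := F1.
have [w0 w0B] : exists w, B w by exists z.
have d0 : 0 <= delta by exact: le_trans (normc_ge0 _) (zp _ w0B).
have dE w : cRe (1 - cdot z w) - cRe (1 - cdot p w) = - cRe (cdot z w - cdot p w) /\
            cIm (1 - cdot z w) - cIm (1 - cdot p w) = - cIm (cdot z w - cdot p w).
  by rewrite !cReD !cImD !cReN !cImN; split; ring.
have hz w : B w -> h / 2 <= cRe (1 - cdot z w) + h.
  by move=> wB; have := cRe1B_gt0 zB wB; move: h0; clear; lra.
have hp w : B w -> h / 2 <= cRe (1 - cdot p w) + h.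
  move=> wB; have [E _] := dE w; have := cRe1B_gt0 zB wB.
  have := ler_norm (- cRe (cdot z w - cdot p w)); have := normc_Re (cdot z w - cdot p w).
  rewrite normrN; have := zp w wB; move: E dh h0; clear.
  move: (cRe (1 - cdot z w)) (cRe (1 - cdot p w)) (cRe (_ - _)) (normc _) => a b c q.
  lra.
have Imz (v w : T) : cIm (1 - cdot v w) = - cIm (cdot v w) by rewrite cImD cImN /= add0r.
have iz w : B w -> `|cIm (1 - cdot z w)| <= 1 + h.
  move=> wB; rewrite Imz normrN; have := normc_Im (cdot z w).
  have := normc_cdot_half z w; move: zB wB; rewrite !unit_ballP; move: h0; clear; lra.
have ip w : B w -> `|cIm (1 - cdot p w)| <= 1 + h.
  move=> wB; rewrite Imz normrN; have := normc_Im (cdot z w).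
  have := normc_Im (cdot z w - cdot p w); rewrite cImD cImN.
  have := ler_normB (cIm (cdot z w)) (cIm (cdot z w) - cIm (cdot p w)).
  rewrite opprB addrC subrK.
  have := normc_cdot_half z w; have := zp w wB.
  move: zB wB; rewrite !unit_ballP; move: h0 dh; clear; lra.
have M0 : 0 <= L * (2 * delta) by rewrite !mulr_ge0.
rewrite -lee_fin.
have -> : 16 * L * delta = 8 * (L * (2 * delta)) by ring.
apply: le_trans (integral_normc_cst F1 M0).
have kb v : (forall w, B w -> h / 2 <= cRe (1 - cdot v w) + h) -> forall w, B w ->
    `|kRe h v w| <= (h / 2) `^ (- alpha) /\ `|kIm h v w| <= (h / 2) `^ (- alpha).
  by move=> hv w wB; apply: kernel_bound => //; exact: hv.
have kd w : B w -> `|kRe h z w - kRe h p w| <= L * (2 * delta) /\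
    `|kIm h z w - kIm h p w| <= L * (2 * delta).
  move=> wB; have [d1 d2] := dE w.
  have [k1 k2] := HL _ _ _ _ (hz w wB) (hp w wB) (iz w wB) (ip w wB).
  have D : `|cRe (1 - cdot z w) + h - (cRe (1 - cdot p w) + h)| +
      `|cIm (1 - cdot z w) - cIm (1 - cdot p w)| <= 2 * delta.
    rewrite d2 normrN.
    have -> : cRe (1 - cdot z w) + h - (cRe (1 - cdot p w) + h) = - cRe (cdot z w - cdot p w).
      by rewrite -d1; ring.
    rewrite normrN mulr_natl mulr2n; apply: lerD; apply: le_trans (zp w wB).
      exact: normc_Re.
    exact: normc_Im.
  by split; [apply: le_trans k1 _|apply: le_trans k2 _]; exact: ler_wpM2l.
have H := @Cint_dist R n F (kRe h z) (kIm h z) (kRe h p) (kIm h p) (fun=> L * (2 * delta))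
  2 ((h / 2) `^ (- alpha)) mF F2 (measurable_kRe alpha h z) (measurable_kIm alpha h z)
  (measurable_kRe alpha h p) (measurable_kIm alpha h p) (measurable_cst _).
apply: H => w wB.
- by have [] := kb z hz w wB.
- by have [] := kb z hz w wB.
- by have [] := kb p hp w wB.
- by have [] := kb p hp w wB.
- by have [] := kd w wB.
- by have [] := kd w wB.
Qed.

(* The code of F rounds the values of the operator on F at the points of a
   finite grid. *)
Lemma Kop_finite_code (h e : R) : 0 < h -> 0 < e ->
  exists (K : finType) (code : (T -> R[i]) -> K), forall F F',
  L1_bounded F -> L1_bounded F' -> code F = code F' ->
  forall z, B z -> normc (Kop h F z - Kop h F' z) <= e.
Proof.
move=> h0 e0; have [L L0 HL] := Kop_lipschitz h0.
have h40 : 0 < h / 2 by rewrite divr_gt0.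
(* Grid mesh: h / 2 is the range of [Kop_lipschitz], and the other term makes L * t <= e / 3, with L
   + 1 because L may be 0. *)
pose t := Num.min (h / 2) (e / (3 * (L + 1))).
have L1 : 0 < 3 * (L + 1) by rewrite mulr_gt0//; lra.
have t0 : 0 < t by rewrite lt_min h40 divr_gt0.
have th : t <= h / 2 by rewrite ge_min lexx.
have Lt : L * t <= e / 3.
  apply: (@le_trans _ _ (L * (e / (3 * (L + 1))))).
    by rewrite ler_wpM2l// ge_min lexx orbT.
  rewrite mulrA ler_pdivrMr//.
  have -> : e / 3 * (3 * (L + 1)) = (L + 1) * e by field.
  by rewrite ler_wpM2r ?lerDl// ltW.
have n0 : 0 <= 2 * n.+1%:R :> R by rewrite mulr_ge0.
have [m m0 mt] := exists_small_ratio n0 t0.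
pose M := 8 * (h / 2) `^ (- alpha).
have M0 : 0 <= M by rewrite mulr_ge0 ?powR_ge0.
have e60 : 0 < e / 6 by rewrite divr_gt0.
(* Rounding each of the real and imaginary parts to within e / 6 costs e / 3 in modulus. *)
have [m2 m20 m2e] := exists_small_ratio ler01 e60.
pose k := (Num.truncn (2 * M * m2%:R)).+1.
have Mk : 2 * M * m2%:R <= k%:R.
  have y0 : 0 <= 2 * M * m2%:R by apply: mulr_ge0 => //; apply: mulr_ge0.
  by have /andP[_ /ltW] := truncn_itv y0.
pose G : finType := {ffun 'I_n.+1 -> 'I_(2 * m).+1 * 'I_(2 * m).+1}.
pose code (F : T -> R[i]) : {ffun G -> 'I_k.+1 * 'I_k.+1} :=
  [ffun kk => (inord (Num.truncn ((cRe (Kop h F (grid_point kk)) + M) * m2%:R)),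
               inord (Num.truncn ((cIm (Kop h F (grid_point kk)) + M) * m2%:R)))].
exists {ffun G -> 'I_k.+1 * 'I_k.+1}, code => F F' F1 F1' FF' z zB.
have [kk Hkk] := grid_approx m0 zB.
set p := grid_point kk in Hkk.
have Hp w : B w -> normc (cdot z w - cdot p w) <= t.
  by move=> wB; apply: le_trans (Hkk w wB) mt.
have zp (E : T -> R[i]) : L1_bounded E -> normc (Kop h E z - Kop h E p) <= e / 3.
  by move=> E1; apply: le_trans Lt; exact: HL.
have pM (E : T -> R[i]) : L1_bounded E -> normc (Kop h E p) <= M.
  move=> E1; apply: Kop_bound => // w wB.
  have := cRe1B_gt0 zB wB.
  have := normc_Re (cdot z w - cdot p w); have := Hp w wB.
  have := ler_norm (- cRe (cdot z w - cdot p w)); rewrite normrN.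
  rewrite !cReD !cReN; move: th; clear.
  move: (cRe (cdot z w)) (cRe (cdot p w)) (normc _) (`| _ |) (cRe 1) => a b c q o.
  lra.
have [cr ci] : `|cRe (Kop h F p) - cRe (Kop h F' p)| <= m2%:R^-1 /\
    `|cIm (Kop h F p) - cIm (Kop h F' p)| <= m2%:R^-1.
  move: FF' => /ffunP/(_ kk); rewrite !ffunE => -[c1 c2]; split.
    apply: (truncn_code m20 _ _ Mk c1).
      exact: le_trans (normc_Re _) (pM _ F1).
    exact: le_trans (normc_Re _) (pM _ F1').
  apply: (truncn_code m20 _ _ Mk c2).
    exact: le_trans (normc_Im _) (pM _ F1).
  exact: le_trans (normc_Im _) (pM _ F1').
have pp : normc (Kop h F p - Kop h F' p) <= e / 3.
  apply: le_trans (normc_ReIm _) _; rewrite cReD cImD cReN cImN.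
  by move: m2e; rewrite mul1r; move: cr ci; clear; lra.
have tri (a b a' b' : R[i]) : normc (a - b) <= e / 3 -> normc (b - b') <= e / 3 ->
    normc (a' - b') <= e / 3 -> normc (a - a') <= e.
  have -> : a - a' = (a - b) + (b - b') - (a' - b') by ring.
  have := le_normcD (a - b) (b - b'); have := le_normcD (a - b + (b - b')) (- (a' - b')).
  by rewrite normcN; clear; lra.
exact: tri (zp _ F1) pp (zp _ F1').
Qed.

End kernel_approximation.

(** * Completeness and precompactness in L^p *)

Section cLp_complete.
Context d {T : measurableType d} {R : realType}.
Variable mu : {measure set T -> \bar R}.
Implicit Types (p q : \bar R) (f g : T -> R[i]).

Lemma measurable_normc_powR (r : R) f : measurable_fun setT f ->
  measurable_fun setT (fun z => (normc (f z) `^ r)%:E).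
Proof.
move=> mf; apply/measurable_EFinP; apply: (measurableT_comp (measurable_powR r)).
exact: measurable_normc_comp.
Qed.

(** Chebyshev gives t^r mu <= (t^2)^r, so mu <= t^r <= t because t < 1 <= r. Measuring the norm by
    t^2 thus gives a bound independent of q. *)
Lemma cLnorm_markov q f (t : R) : (1 <= q)%E -> measurable_fun setT f ->
  0 < t < 1 -> (cLnorm mu q f <= (t ^+ 2)%:E)%E ->
  (mu [set z | (t <= normc (f z))%R] <= t%:E)%E.
Proof.
move=> q1 mf t01; have [t0 t1] := andP t01.
have mE : measurable [set z | (t <= normc (f z))%R].
  rewrite -[X in measurable X]setTI.
  exact: (measurable_fun_le _ (measurable_cst t) (measurable_normc_comp mf)).
case: q q1 => [r| |]//; last first.
  move=> _; rewrite /cLnorm unlock; case: ifPn => [_ /ess_supP H|m0 _]; last first.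
    rewrite -leNgt in m0; apply: le_trans (le_trans _ m0) _; last by rewrite lee_fin ltW.
    by apply: le_measure; rewrite ?inE.
  suff -> : mu [set z | (t <= normc (f z))%R] = 0%E by rewrite lee_fin ltW.
  apply: measure_negligible => //; apply: negligibleS H => z /= tz.
  rewrite lee_fin ger0_norm ?normc_ge0// => H.
  have : t <= t ^+ 2 by exact: le_trans tz H.
  by nra.
rewrite lee_fin => r1 ft.
have r0 : 0 < r by exact: lt_le_trans ltr01 r1.
have tr : 0 < t `^ r by exact: powR_gt0.
have mr k : 0 <= k -> (cLnorm mu r%:E f <= k%:E)%E ->
    (\int[mu]_z (normc (f z) `^ r)%:E <= (k `^ r)%:E)%E.
  move=> k0 fk; rewrite -cLnorm_powerE// -poweR_EFin; apply: gt0_ler_poweR => //.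
  - exact: ltW.
  - by rewrite in_itv/= leey cLnorm_ge0.
  - by rewrite in_itv/= leey lee_fin k0.
have H : ((t `^ r)%:E * mu [set z | (t <= normc (f z))%R] <= ((t ^+ 2) `^ r)%:E)%E.
  apply: (@le_trans _ _ (\int[mu]_z `|(normc (f z) `^ r)%:E|)%E); last first.
    under eq_integral do rewrite gee0_abs ?lee_fin ?powR_ge0//.
    by apply: mr => //; rewrite exprn_ge0// ltW.
  apply: (le_trans _ (@le_integral_abse _ _ _ mu setT measurableT _ _ (measurable_normc_powR r mf) tr)).
  rewrite lee_pmul2l ?lte_fin//; apply: le_measure; rewrite ?inE//.
    rewrite setTI -[X in measurable X]setTI.
    have := measurable_fun_le measurableT (measurable_cst (t `^ r))
      (measurableT_comp (measurable_powR r) (measurable_normc_comp mf)).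
    by congr (measurable (_ `&` _)); apply/seteqP; split => z /=; rewrite lee_fin ger0_norm ?powR_ge0.
  move=> z /= tz; split => //=; rewrite lee_fin ger0_norm ?powR_ge0//.
  by apply: ge0_ler_powR; rewrite ?nnegrE ?normc_ge0//; exact: ltW.
rewrite -(@lee_pmul2l _ (t `^ r)%:E) ?lte_fin// (le_trans H)// -EFinM lee_fin.
rewrite expr2 powRM; [|exact: ltW..].
rewrite ler_wpM2l ?powR_ge0//; apply: ge1r_powR => //.
by rewrite t0 ltW.
Qed.

(** Fatou's lemma for finite q; for q = +oo the exceptional null sets of all terms are discarded
    together. *)
Lemma cLnorm_le_limit q (x : nat -> T -> R[i]) f (c : R) : (1 <= q)%E -> 0 <= c ->
  (forall m, measurable_fun setT (x m)) -> measurable_fun setT f ->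
  {ae mu, forall z, normc (x m z) @[m --> \oo] --> normc (f z)} ->
  (forall m, (cLnorm mu q (x m) <= c%:E)%E) -> (cLnorm mu q f <= c%:E)%E.
Proof.
move=> q1 c0 mx mf xf xc; case: q q1 xc => [r| |]//; last first.
  move=> _; rewrite /cLnorm unlock; case: ifPn => // _ xc.
  apply/ess_supP.
  have H m : {ae mu, forall z, normc (x m z) <= c}.
    by have /ess_supP := xc m; apply: filterS => z /=; rewrite lee_fin ger0_norm ?normc_ge0.
  have := ae_foralln H; apply: filterS2 xf => z cv H'.
  rewrite /= lee_fin ger0_norm ?normc_ge0//.
  rewrite -(cvg_lim _ cv)//; apply: limr_le; first by apply/cvg_ex; eexists; exact: cv.
  exact: nearW.
rewrite lee_fin => r1 xc; have r0 : 0 < r by exact: lt_le_trans ltr01 r1.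
apply: (poweR_le_cancel r0); rewrite ?cLnorm_ge0 ?lee_fin// cLnorm_powerE//.
have mp := measurable_normc_powR r.
apply: (@le_trans _ _ (\int[mu]_z limn_einf (fun m => (normc (x m z) `^ r)%:E))%E).
  apply: ae_ge0_le_integral => //.
  - by move=> z _; rewrite lee_fin powR_ge0.
  - exact: mp.
  - by move=> z _; apply: limn_einf_ge0 => m; rewrite lee_fin powR_ge0.
  (* [limn_einf] is by definition the opposite of the [limn_esup] of the opposites, so measurability
     is proved for the latter. *)
  - have ml : measurable_fun setT
        (fun z => limn_esup (fun m => - (normc (x m z) `^ r)%:E)%E).
      apply: measurable_fun_limn_esup => m.
      exact: (measurableT_comp (@oppe_measurable R setT) (mp _ (mx m))).
    exact: (measurableT_comp (@oppe_measurable R setT) ml).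
  - apply: filterS xf => z cv _; apply: powR_le_limn_einf => // m; exact: normc_ge0.
apply: (le_trans (fatou mu measurableT (fun m => mp _ (mx m)) _)).
  by move=> m z _; rewrite lee_fin powR_ge0.
apply: limn_einf_ub => m; rewrite -cLnorm_powerE//.
apply: gt0_ler_poweR => //.
- exact: ltW.
- by rewrite in_itv/= leey cLnorm_ge0.
- by rewrite in_itv/= leey lee_fin c0.
Qed.

Lemma normc_cvg (u : nat -> R[i]) (a b : R) :
  cRe (u k) @[k --> \oo] --> a -> cIm (u k) @[k --> \oo] --> b ->
  normc (u k) @[k --> \oo] --> normc (Complex a b).
Proof.
move=> ua ub; rewrite (_ : (fun k => normc (u k)) =
  (fun k => Num.sqrt (cRe (u k) ^+ 2 + cIm (u k) ^+ 2))); last first.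
  by apply/funext => k; case: (u k).
apply: (@cvg_comp _ _ _ _ Num.sqrt _ (nbhs (a ^+ 2 + b ^+ 2))); last exact: sqrt_continuous.
apply: cvgD; rewrite expr2; under eq_fun do rewrite expr2; exact: cvgM.
Qed.

(* Consecutive terms differ by at least 2^-(k+1) only on a set of measure at
   most 2^-(k+1), so by Borel-Cantelli they converge almost everywhere. *)
Lemma cLp_complete q (q1 : (1 <= q)%E) (x : nat -> cLp mu q1) :
  (forall k, cLp_dist (x k) (x k.+1) <= 4^-1 ^+ k.+1) ->
  exists y, forall k, cLp_dist (x k) y <= 4^-1 ^+ k.
Proof.
move=> dx; pose u k := cLp_fun (x k).
have mu_ k : measurable_fun setT (u k) by exact: measurable_cLp.
have muB f g : measurable_fun setT f -> measurable_fun setT g -> measurable_fun setT (f \- g).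
  exact: measurable_funB_complex.
pose E k := [set z | 2^-1 ^+ k.+1 <= normc ((u k \- u k.+1) z)].
have mE k : measurable (E k).
  rewrite -[X in measurable X]setTI.
  exact: (measurable_fun_le _ (measurable_cst _) (measurable_normc_comp (muB _ _ (mu_ k) (mu_ k.+1)))).
have muE k : (mu (E k) <= (2^-1 ^+ k.+1)%:E)%E.
  apply: (cLnorm_markov q1) => //; first exact: muB.
    by rewrite exprn_gt0//= exprn_ilt1//; lra.
  rewrite -exprM mulnC exprM -cLp_distE lee_fin (_ : 2^-1 ^+ 2 = 4^-1); first exact: dx.
  by lra.
pose N := lim_sup_set E.
have mN : measurable N.
  by apply: bigcap_measurable => // k _; apply: bigcup_measurable => j _; exact: mE.
have N0 : mu N = 0%E.
  apply: lim_sup_set_cvg0 => //.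
  apply: (@le_lt_trans _ _ (\sum_(k <oo) (2^-1 * 2^-1 ^+ k)%:E)%E).
    by apply: lee_nneseries => k _ //; rewrite -exprS.
  apply: le_lt_trans (nneseries_geometric_le _ _) _; rewrite ?ltry//; lra.
have cv z : ~ N z -> cvgn (fun k => cRe (u k z)) /\ cvgn (fun k => cIm (u k z)).
  move=> /existsNP[n /not_implyP[_ Nz]].
  have H k : (n <= k)%N -> normc (u k z - u k.+1 z) <= 2^-1 ^+ k.
    move=> nk; apply/ltW/(@lt_le_trans _ _ (2^-1 ^+ k.+1)).
      by rewrite ltNge; apply/negP => H; apply: Nz; exists k.
    by rewrite exprS ler_piMl ?exprn_ge0//; lra.
  split; apply: (@fast_cvg _ _ n) => k nk; apply: le_trans (H k nk).
    by rewrite -cReN -cReD; exact: normc_Re.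
  by rewrite -cImN -cImD; exact: normc_Im.
(* Setting the terms to 0 on the null set makes the limit exist at every point, so that it is
   measurable. *)
pose v k z := if z \in N then 0 else u k z.
pose f z := Complex (limn (fun k => cRe (v k z))) (limn (fun k => cIm (v k z))).
have vcv z : (fun k => cRe (v k z)) @ \oo --> cRe (f z) /\ (fun k => cIm (v k z)) @ \oo --> cIm (f z).
  rewrite /f /v; case: (boolP (z \in N)) => /= [_|].
    by split; exact: is_cvg_cst.
  by rewrite notin_setE => /cv[].
have mv k : measurable_fun setT (v k).
  have /measurable_fun_complexP[mr mi] := mu_ k.
  have mNC : measurable_fun setT (\1_(~` N) : T -> R) by apply: measurable_indic; exact: measurableC.
  have vE z : v k z = Complex (cRe (u k z) * \1_(~` N) z) (cIm (u k z) * \1_(~` N) z).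
    rewrite /v indicE; have [zN|zN] := boolP (z \in N).
      by rewrite memNset ?mulr0//= => /(_ (set_mem zN)).
    rewrite mem_set; last by move=> /= Nz; move: zN; rewrite mem_set.
    by rewrite !mulr1; case: (u k z).
  apply/measurable_fun_complexP; split.
  - rewrite (_ : _ \o _ = (cRe \o u k) \* \1_(~` N)); first exact: measurable_funM.
    by apply/funext => z /=; rewrite vE.
  - rewrite (_ : _ \o _ = (cIm \o u k) \* \1_(~` N)); first exact: measurable_funM.
    by apply/funext => z /=; rewrite vE.
have mf : measurable_fun setT f.
  apply/measurable_fun_complexP; split.
  - apply: (@measurable_fun_cvg _ _ _ _ (fun k => cRe \o v k)) => [k|z _].
      by have /measurable_fun_complexP[] := mv k.
    by have [] := vcv z.
  - apply: (@measurable_fun_cvg _ _ _ _ (fun k => cIm \o v k)) => [k|z _].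
      by have /measurable_fun_complexP[] := mv k.
    by have [] := vcv z.
have ucv : {ae mu, forall z, cRe (u k z) @[k --> \oo] --> cRe (f z) /\ cIm (u k z) @[k --> \oo] --> cIm (f z)}.
  have : mu.-negligible N by exact/negligibleP.
  apply: negligibleS => z /= H; apply: contrapT => Nz; apply: H.
  have zN : (z \in N) = false by exact: memNset.
  by have := vcv z; rewrite /f /v zN.
have dm k m : cLp_dist (x k) (x (k + m)%N) <= 4^-1 ^+ k.
  (* The stronger telescoping bound is inductive: each step adds 4^-(j+1), which is at most 4^-j -
     4^-(j+1). *)
  suff : cLp_dist (x k) (x (k + m)%N) <= 4^-1 ^+ k - 4^-1 ^+ (k + m).
    by move=> /le_trans; apply; rewrite gerBl exprn_ge0.
  elim: m => [|m IH]; first by rewrite addn0 subrr /cLp_dist cLnormBxx.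
  rewrite -lee_fin cLp_distE; apply: le_trans (@cLnorm_triangle _ _ _ mu q (u k) (u (k + m)%N) (u (k + m.+1)%N) q1 (mu_ k) (mu_ (k + m)%N) (mu_ (k + m.+1)%N)) _.
  rewrite -!cLp_distE -EFinD lee_fin addnS.
  have := dx (k + m)%N; rewrite [X in _ <= X]exprS.
  have : 0 <= 4^-1 ^+ (k + m) :> R by rewrite exprn_ge0.
  rewrite exprS; lra.
have uf k : (cLnorm mu q (u k \- f)%R <= (4^-1 ^+ k)%:E)%E.
  apply: (@cLnorm_le_limit q (fun m => u k \- u (k + m)%N)) => //.
  - by move=> m; exact: muB.
  - exact: muB.
  - apply: filterS ucv => z [ur ui].
    have E' (a b : R[i]) : a - b = Complex (cRe a - cRe b) (cIm a - cIm b).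
      by case: a => ? ?; case: b.
    rewrite [X in _ --> normc X]E'.
    apply: normc_cvg.
      rewrite (_ : (fun m => _) = (fun m => cRe (u k z) - cRe (u (m + k)%N z))); last first.
        by apply/funext => m; rewrite /= cReD cReN addnC.
      apply: cvgB; first exact: cvg_cst.
      by rewrite (cvg_shiftn k (fun m => cRe (u m z))).
    rewrite (_ : (fun m => _) = (fun m => cIm (u k z) - cIm (u (m + k)%N z))); last first.
      by apply/funext => m; rewrite /= cImD cImN addnC.
    apply: cvgB; first exact: cvg_cst.
    by rewrite (cvg_shiftn k (fun m => cIm (u m z))).
  - by move=> m; rewrite -cLp_distE lee_fin; exact: dm.
have foo : (cLnorm mu q f < +oo)%E.
  have m0 : measurable_fun setT (fun _ : T => 0 : R[i]) by [].
  have -> : cLnorm mu q f = cLnorm mu q (f \- (fun=> 0))%R.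
    by congr cLnorm; apply/funext => z /=; rewrite subr0.
  apply: le_lt_trans (@cLnorm_triangle _ _ _ mu q f (u 0%N) (fun=> 0) q1 mf (mu_ 0%N) m0) _.
  rewrite cLnormBC lte_add_pinfty//; first by apply: le_lt_trans (uf 0%N) _; rewrite ltry.
  rewrite (_ : _ \- _ = u 0%N) ?cLnorm_cLp_lty//.
  by apply/funext => z /=; rewrite subr0.
have [y yf] := exists_cLp q1 mf foo.
exists y => k; rewrite -lee_fin cLp_distE; apply: le_trans (uf k).
apply: cLnorm_ae_le => //; [exact/muB/measurable_cLp|exact: muB|].
by apply: filterS yf => z /= ->.
Qed.

End cLp_complete.

Section cLp_precompact.
Context d {T : measurableType d} {R : realType}.
Variable mu : {measure set T -> \bar R}.
Variables (q : \bar R) (q1 : (1 <= q)%E).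
Implicit Types x y z : cLp mu q1.

Lemma cLp_ballE x (e : R) : ball x e = [set y | cLp_dist x y < e].
Proof. exact: ballEmdist. Qed.

Lemma cLp_distC x y : cLp_dist x y = cLp_dist y x.
Proof. by rewrite /cLp_dist cLnormBC. Qed.

Lemma cLp_dist_triangle y x z : cLp_dist x z <= cLp_dist x y + cLp_dist y z.
Proof.
rewrite -lee_fin EFinD !cLp_distE.
by apply: cLnorm_triangle => //; exact: measurable_cLp.
Qed.

(* An ultrafilter on the closure selects a piece of diameter 4^-(k+1) for every
   k; points in the successive intersections form a fast Cauchy sequence. *)
Lemma precompact_pieces (S : set (cLp mu q1)) :
  (forall e : R, 0 < e -> exists (K : finType) (P : K -> set (cLp mu q1)),
    S `<=` \bigcup_k P k /\ forall k x y, P k x -> P k y -> cLp_dist x y <= e) ->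
  precompact S.
Proof.
move=> HS; rewrite precompactE compact_ultra => F UF FS.
have small (e : R) : 0 < e -> exists2 A, F A & forall x y, A x -> A y -> cLp_dist x y <= e.
  move=> e0; have e3 : 0 < e / 3 by rewrite divr_gt0.
  have [K [P [SP dP]]] := HS _ e3.
  (* Enlarging the pieces by e / 3 lets them cover the closure of S, while their diameter stays at
     most e. *)
  pose Q k := [set x | exists2 y, P k y & cLp_dist x y <= e / 3].
  have [[k Fk]|noQ] := pselect (exists k, F (Q k)).
    exists (Q k) => // x y [x' Px xx'] [y' Py yy'].
    have := cLp_dist_triangle x' x y; have := cLp_dist_triangle y' x' y.
    by have := dP _ _ _ Px Py; rewrite (cLp_distC y'); lra.
  (* An ultrafilter missing every enlarged piece contains all their complements; the index type
     being finite, it contains their intersection, which would have to meet the closure of S. *)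
  have FQ k : F (~` Q k).
    by have [Fk|//] := in_ultra_setVsetC (Q k) UF; case: noQ; exists k.
  have : F (closure S `&` [set x | forall k, ~ Q k x]).
    by apply: filterI => //; apply: filter_forall => k; exact: FQ.
  move=> /filter_ex[x [Sx nQ]].
  have [y [Sy xy]] := Sx _ (nbhsx_ballx x _ e3).
  have [k _ Pk] := SP _ Sy; case: (nQ k); exists y => //.
  by move: xy; rewrite cLp_ballE => /ltW.
have e4 k : 0 < 4^-1 ^+ k :> R by rewrite exprn_gt0.
have /choice[A HA] k : exists A, F A /\ forall x y, A x -> A y -> cLp_dist x y <= 4^-1 ^+ k.+1.
  by have [A FA dA] := small _ (e4 k.+1); exists A.
have FB n : F [set x | forall k, (k <= n)%N -> A k x].
  elim: n => [|n IH].
    by apply: filterS (HA 0%N).1 => x Ax k; rewrite leqn0 => /eqP ->.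
  apply: filterS2 IH (HA n.+1).1 => x H Ax k.
  by rewrite leq_eqVlt => /predU1P[->//|]; exact: H.
have /choice[x Bx] n : exists x, forall k, (k <= n)%N -> A k x by exact: filter_ex (FB n).
have dx k : cLp_dist (x k) (x k.+1) <= 4^-1 ^+ k.+1.
  by apply: (HA k).2; exact: Bx.
have [y xy] := cLp_complete dx.
have Fy : F --> y.
  move=> U /= /nbhs_ballP[e /= e0 yU].
  have [k ke] : exists k, 2 * 4^-1 ^+ k < e.
    have [k _ /(_ k (leqnn k))] : \forall k \near \oo, 2 * 4^-1 ^+ k < e.
      have h : `|4^-1 : R| < 1 by rewrite ger0_norm ?invr_ge0//; lra.
      exact: (@cvgr_lt _ _ _ _ (geometric 2 4^-1) 0 (@cvg_geometric R 2 4^-1 h) e e0).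
    by exists k.
  apply: filterS (HA k).1 => a Aa; apply: yU; rewrite cLp_ballE /=.
  have := cLp_dist_triangle (x k) y a; rewrite (cLp_distC y (x k)).
  have := xy k; have := (HA k).2 _ _ (Bx k k (leqnn k)) Aa; rewrite exprS.
  by have := e4 k; lra.
exists y; split => //.
apply: (@closed_cvg _ _ F _ id) => //; exact: closed_closure.
Qed.

End cLp_precompact.

Section cLnorm_scale.
Context d {T : measurableType d} {R : realType}.
Variable mu : {measure set T -> \bar R}.

Lemma cLnorm_scale_le1 (p : \bar R) (f g : T -> R[i]) (c : R) : (1 <= p)%E -> 0 < c ->
  measurable_fun setT f -> measurable_fun setT g ->
  (forall z, normc (f z) = c * normc (g z)) -> (cLnorm mu p f <= c%:E)%E ->
  (cLnorm mu p g <= 1)%E.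
Proof.
move=> p1 c0 mf mg fg; case: p p1 => [r| |]//; last first.
  move=> _; rewrite /cLnorm unlock; case: ifPn => // _ /ess_supP H.
  apply/ess_supP; apply: filterS H => z /=.
  by rewrite !lee_fin !ger0_norm ?normc_ge0// fg -{2}(mulr1 c) ler_pM2l.
rewrite lee_fin => r1 fc; have r0 : 0 < r by exact: lt_le_trans ltr01 r1.
rewrite -(@poweR_le1 R _ r)// ?cLnorm_ge0// cLnorm_powerE//.
have cr : 0 < c `^ r by exact: powR_gt0.
rewrite -(@lee_pmul2l _ (c `^ r)%:E) ?lte_fin// mule1.
rewrite -ge0_integralZl//; last 3 first.
- exact: measurable_normc_powR.
- by move=> z _; rewrite lee_fin powR_ge0.
- by rewrite lee_fin ltW.
have -> : (\int[mu]_z ((c `^ r)%:E * (normc (g z) `^ r)%:E) = cLnorm mu r%:E f `^ r)%E.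
  rewrite cLnorm_powerE//; apply: eq_integral => z _.
  by rewrite fg powRM ?normc_ge0// ltW.
rewrite -poweR_EFin; apply: gt0_ler_poweR => //.
- exact: ltW.
- by rewrite in_itv/= leey cLnorm_ge0.
- by rewrite in_itv/= leey lee_fin ltW.
Qed.

End cLnorm_scale.

(** * Sufficiency *)

Section sufficiency.
Context {R : realType} {n : nat}.
Local Notation T := (n.+1.-tuple R[i]).
Local Notation B := (@unit_ball R n.+1).
Local Notation mu := (@ball_measure R n.+1).
Local Notation N := (n.+2%:R : R).
Variable alpha : R.
Hypothesis alpha_range : 0 < alpha <= N.

Let alpha0 : 0 < alpha. Proof. by case/andP: alpha_range. Qed.

(** kap <= 2 gives kap^-alpha <= 2^s kap^-(alpha+s); the factor 4 is that of [Cint_dist] against the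
    zero kernel. The bound for [Tb] thus also shows that K maps L^p into L^q. *)
Lemma Kop_le_Tb (s : R) (F : T -> R[i]) (z : T) : 0 < s ->
  measurable_fun setT F -> (\int[mu]_(w in B) (normc (F w))%:E < +oo)%E -> B z ->
  ((normc (Kop alpha 0 F z))%:E <=
    (4 * 2 `^ s)%:E * Tb (alpha + s) (fun w => normc (F w)) z)%E.
Proof.
move=> s0 mF Foo zB.
have mB : measurable B by exact: measurable_unit_ball.
have mk (b : R) : measurable_fun setT (fun w : T => kap z w `^ b).
  by apply: (measurableT_comp (measurable_powR b)); exact: measurable_kap.
have mnF : measurable_fun setT (fun w : T => normc (F w)) by exact (@measurable_normc_comp _ _ R F mF).
have z1 : 0 < (1 - sqn z) / 2 by rewrite divr_gt0// subr_gt0.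
pose m w := 2 `^ s * kap z w `^ (- (alpha + s)).
have kle w : B w -> kap z w `^ (- alpha) <= m w.
  move=> wB; have k0 := kap_gt0 zB wB.
  have -> : - alpha = s + - (alpha + s) by ring.
  rewrite /m powRD; last by rewrite (gt_eqF k0) implybT.
  apply: ler_wpM2r; first exact: powR_ge0.
  apply: ge0_ler_powR; rewrite ?nnegrE; [exact: ltW|exact: ltW|by []|exact: kap_le2].
have kb w : B w -> `|kRe alpha 0 z w| <= kap z w `^ (- alpha) /\
    `|kIm alpha 0 z w| <= kap z w `^ (- alpha).
  move=> wB; have := ker_normE alpha (cRe (1 - cdot z w) + 0) (cIm (1 - cdot z w)).
  rewrite {3}addr0 -kapE => <-; split.
    exact: (normc_Re (Complex (kRe alpha 0 z w) (kIm alpha 0 z w))).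
  exact: (normc_Im (Complex (kRe alpha 0 z w) (kIm alpha 0 z w))).
pose M := ((1 - sqn z) / 2) `^ (- alpha).
have kM w : B w -> kap z w `^ (- alpha) <= M.
  move=> wB; rewrite /M !powRN lef_pV2 ?posrE ?powR_gt0//; last exact: kap_gt0.
  apply: ge0_ler_powR; rewrite ?nnegrE; [exact: ltW|exact: ltW|exact: ltW (kap_gt0 zB wB)|].
  exact: kap_ge.
have F0 : (0 <= \int[mu]_(w in B) (normc (F w))%:E)%E.
  by apply: integral_ge0 => w _; rewrite lee_fin normc_ge0.
have [A FA] : exists A, (\int[mu]_(w in B) (normc (F w))%:E <= A%:E)%E.
  by exists (fine (\int[mu]_(w in B) (normc (F w))%:E)); rewrite fineK// ge0_fin_numE.
rewrite -[Kop _ _ _ _]subr0 -(Cint0 F).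
apply: (@le_trans _ _ (4%:E * \int[mu]_(w in B) (normc (F w) * m w)%:E)%E).
  apply: (@Cint_dist R n F (kRe alpha 0 z) (kIm alpha 0 z) (fun=> 0) (fun=> 0) m A M) => //.
  - exact: measurable_kRe.
  - exact: measurable_kIm.
  - by apply: measurable_funM => //; exact: mk.
  - by move=> w wB; apply: le_trans (kM w wB); have [] := kb w wB.
  - by move=> w wB; apply: le_trans (kM w wB); have [] := kb w wB.
  - by move=> w wB; rewrite normr0 powR_ge0.
  - by move=> w wB; rewrite normr0 powR_ge0.
  - by move=> w wB; rewrite subr0; apply: le_trans (kle w wB); have [] := kb w wB.
  - by move=> w wB; rewrite subr0; apply: le_trans (kle w wB); have [] := kb w wB.
have mI : measurable_fun B (fun w => (normc (F w) * kap z w `^ (- (alpha + s)))%:E).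
  by apply/measurable_EFinP; apply: measurable_funTS; apply: measurable_funM => //; exact: mk.
have I0 w : B w -> (0 <= (normc (F w) * kap z w `^ (- (alpha + s)))%:E)%E.
  by rewrite lee_fin mulr_ge0 ?normc_ge0 ?powR_ge0.
have s20 : (0 <= (2 `^ s)%:E :> \bar R)%E by rewrite lee_fin powR_ge0.
rewrite EFinM -muleA; apply: lee_wpmul2l => //.
rewrite /Tb -(@ge0_integralZl _ _ _ mu B mB _ mI _ I0 s20).
apply: ge0_le_integral_mono => w _.
  by rewrite lee_fin !mulr_ge0 ?normc_ge0 ?powR_ge0.
by rewrite -EFinM lee_fin /m mulrCA.
Qed.

Lemma normc_scale (c : R) (z : R[i]) : 0 < c ->
  normc z = c * normc (Complex (c^-1 * cRe z) (c^-1 * cIm z)).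
Proof.
case: z => a b c0; rewrite /= !exprMn -mulrDr sqrtrM ?sqr_ge0// sqrtr_sqr.
by rewrite ger0_norm ?invr_ge0 ?mulVKf ?gt_eqF// ltW.
Qed.

Variables (p q : \bar R) (p1 : (1 <= p)%E) (q1 : (1 <= q)%E).
Hypothesis cond : iexp p + alpha / N - 1 < iexp q.

Let ballKop (F : T -> R[i]) z : R[i] := if z \in B then Kop alpha 0 F z else 0.

Let measurable_ballKop F : measurable_fun setT F -> measurable_fun setT (ballKop F).
Proof.
move=> mF; apply: measurable_fun_if => //.
- apply: (measurable_fun_bool true); rewrite setTI (_ : _ @^-1` _ = B); first exact: measurable_unit_ball.
  by apply/seteqP; split => z /= zB; [exact: set_mem|exact: mem_set].
- by apply: measurable_funTS; exact: measurable_Kop.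
Qed.

Let K_op_ballKop F : {ae mu, forall z, ballKop F z = K_op alpha F z}.
Proof.
apply: ae_unit_ball => z zB; rewrite /ballKop mem_set//.
by rewrite K_opE.
Qed.

Let L1_ball F : measurable_fun setT F -> (cLnorm mu p F <= 1)%E -> L1_bounded F.
Proof.
move=> mF Fp; split => //.
have := @cLnorm_le1_power R n p 1 F (lexx _) p1 mF Fp.
by under eq_integral do rewrite powRr1 ?normc_ge0//.
Qed.

Let ballKop_lty F : measurable_fun setT F -> (cLnorm mu p F < +oo)%E ->
  (cLnorm mu q (ballKop F) < +oo)%E.
Proof.
move=> mF Foo.
have [s /andP[s0 s1] [C C0 HC]] := norm_bounded_Tb p1 q1 alpha_range cond.
(* The norm bounds are stated for the unit ball, so F is divided by c; the 1 keeps c positive when F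
   has norm 0. *)
pose c := fine (cLnorm mu p F) + 1.
have Fge0 := cLnorm_ge0 mu p F.
have c0 : 0 < c by rewrite ltr_wpDl// fine_ge0.
have Fc : (cLnorm mu p F <= c%:E)%E.
  by rewrite EFinD fineK ?ge0_fin_numE// leeDl.
pose F' z := Complex (c^-1 * cRe (F z)) (c^-1 * cIm (F z)).
have FF' z : normc (F z) = c * normc (F' z) by exact: normc_scale.
have mF' : measurable_fun setT F'.
  have /measurable_fun_complexP[mr mi] := mF.
  by apply/measurable_fun_complexP; split; apply: (@measurable_funM _ _ _ _ (cst c^-1)).
have F'1 : (cLnorm mu p F' <= 1)%E by exact: (cLnorm_scale_le1 p1 c0 mF mF' FF' Fc).
have mnF' : measurable_fun setT (fun w : T => normc (F' w)) by exact (@measurable_normc_comp _ _ R F' mF').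
have mB : measurable B by exact: measurable_unit_ball.
have intZ (g : T -> R) : measurable_fun setT g -> (forall w, 0 <= g w) ->
    (\int[mu]_(w in B) (normc (F w) * g w)%:E = c%:E * \int[mu]_(w in B) (normc (F' w) * g w)%:E)%E.
  move=> mg g0.
  have mI : measurable_fun B (fun w => (normc (F' w) * g w)%:E).
    by apply/measurable_EFinP; apply: measurable_funTS; apply: measurable_funM.
  have I0 w : B w -> (0 <= (normc (F' w) * g w)%:E)%E.
    by rewrite lee_fin mulr_ge0 ?normc_ge0.
  have c0' : (0 <= c%:E)%E by rewrite lee_fin ltW.
  rewrite -(@ge0_integralZl _ _ _ mu B mB _ mI _ I0 c0'); apply: eq_integral => w _.
  by rewrite FF' -EFinM mulrA.
have F1oo : (\int[mu]_(w in B) (normc (F w))%:E < +oo)%E.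
  have := intZ (fun=> 1) (measurable_cst _) (fun=> ler01).
  under eq_integral do rewrite mulr1; move=> ->.
  under eq_integral do rewrite mulr1.
  have [_ F'2] := L1_ball mF' F'1.
  apply: (@le_lt_trans _ _ (c%:E * 2%:E)%E); last by rewrite -EFinM ltry.
  by apply: lee_wpmul2l => //; rewrite lee_fin ltW.
have t0 : 0 <= 4 * 2 `^ s * c by rewrite !mulr_ge0 ?powR_ge0// ltW.
apply: (@le_lt_trans _ _ ((4 * 2 `^ s * c) * (1 + C))%:E); last by rewrite ltry.
apply: (@cLnorm_le_norm_bounded R n q (Tb (alpha + s) (fun w => normc (F' w))) C _ (ballKop F) q1 C0 t0).
- exact: measurable_ballKop.
- by apply: measurable_Tb => // w; exact: normc_ge0.
- by move=> z; apply: Tb_ge0 => w; exact: normc_ge0.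
- move=> z zB; rewrite /ballKop mem_set//; apply: (le_trans (Kop_le_Tb s0 mF F1oo zB)).
  rewrite [X in (_ <= X * _)%E]EFinM -muleA; apply: lee_wpmul2l; first by rewrite lee_fin mulr_ge0 ?powR_ge0.
  rewrite /Tb -intZ//; last by move=> w; exact: powR_ge0.
  by apply: (measurableT_comp (measurable_powR _)); exact: measurable_kap.
- exact: HC.
Qed.

Lemma K_op_compact : compact_operator mu p1 q1 (K_op alpha).
Proof.
have a2 : 0 < 4 * alpha + 2 by have := alpha0; lra.
have /choice[K' HK'] (F : cLp mu p1) : exists G : cLp mu q1,
    {ae mu, forall x, cLp_fun G x = ballKop (cLp_fun F) x}.
  apply: exists_cLp; first exact: (measurable_ballKop (measurable_cLp F)).
  exact: (ballKop_lty (measurable_cLp F) (cLnorm_cLp_lty F)).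
exists K' => [F|].
  by apply: filterS2 (HK' F) (K_op_ballKop (cLp_fun F)) => z -> -> _.
apply: precompact_pieces => e e0.
have [s /andP[s0 s1] [C C0 HC]] := norm_bounded_Tb p1 q1 alpha_range cond.
pose C' := if q is r%:E then 3 `^ r * (2 * C + 1) else 2 * C + 1.
have C'0 : 0 <= C'.
  have C1 : 0 <= 2 * C + 1 by lra.
  by rewrite /C'; case: (q) => [r| |]//; rewrite mulr_ge0 ?powR_ge0.
have C'1 : 0 < 1 + C' by rewrite ltr_wpDr.
pose t := e / (1 + C').
have t0 : 0 < t by rewrite divr_gt0.
have [h h0 ht] : exists2 h : R, 0 < h & 4 * ((4 * alpha + 2) * h `^ s) <= t.
  have a40 : 0 < 4 * (4 * alpha + 2) by exact: mulr_gt0.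
  (* Solves 4 (4 alpha + 2) h^s = t. *)
  exists ((t / (4 * (4 * alpha + 2))) `^ s^-1); first by rewrite powR_gt0// divr_gt0.
  rewrite -powRrM mulVf ?gt_eqF// powRr1; last by rewrite ltW// divr_gt0.
  by rewrite mulrA mulrCA mulfV ?gt_eqF// mulr1.
have [K [code Hcode]] := @Kop_finite_code R n alpha (ltW alpha0) h t h0 t0.
(* One piece for each code: two functions in the unit ball with the same code have images within
   e. *)
exists K, (fun k => K' @` [set F | (cLnorm mu p (cLp_fun F) <= 1)%E /\ code (cLp_fun F) = k]).
split.
  by move=> _ [F F1 <-]; exists (code (cLp_fun F)) => //; exists F.
move=> k _ _ [F [F1 <-] <-] [G [G1 FG] <-].
pose f := cLp_fun F; pose g := cLp_fun G.
have mf : measurable_fun setT f by exact: measurable_cLp.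
have mg : measurable_fun setT g by exact: measurable_cLp.
have [_ f2] := L1_ball mf F1; have [_ g2] := L1_ball mg G1.
have Tm (u : T -> R[i]) : measurable_fun setT u -> measurable_fun setT (Tb (alpha + s) (fun w => normc (u w))).
  move=> mu'; apply: measurable_Tb => [|w]; last exact: normc_ge0.
  exact (@measurable_normc_comp _ _ R u mu').
have T0 (u : T -> R[i]) z : (0 <= Tb (alpha + s) (fun w => normc (u w)) z)%E.
  by apply: Tb_ge0 => w; exact: normc_ge0.
have eE : e = t * (1 + C') by rewrite /t divfK// gt_eqF.
rewrite -lee_fin cLp_distE eE.
rewrite (@cLnorm_ae_eq _ _ _ mu q _ (ballKop f \- ballKop g) q1); last 3 first.
- by apply: measurable_funB_complex; exact: measurable_cLp.
- by apply: measurable_funB_complex; exact: measurable_ballKop.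
- by apply: filterS2 (HK' F) (HK' G) => z /= -> ->.
apply: (@cLnorm_le_norm_bounded R n q (fun z => Tb (alpha + s) (fun w => normc (f w)) z +
  Tb (alpha + s) (fun w => normc (g w)) z + 1)%E C' t (ballKop f \- ballKop g) q1 C'0 (ltW t0)).
- by apply: measurable_funB_complex; exact: measurable_ballKop.
- by apply: emeasurable_funD => //; apply: emeasurable_funD; exact: Tm.
- by move=> z; apply: adde_ge0 => //; apply: adde_ge0; exact: T0.
- move=> z zB; rewrite /ballKop /= mem_set//.
  have s01 : 0 < s <= 1 by rewrite s0.
  have shift (u : T -> R[i]) : measurable_fun setT u -> (\int[mu]_(w in B) (normc (u w))%:E <= 2%:E)%E ->
      ((normc (Kop alpha 0 u z - Kop alpha h u z))%:E <=
        t%:E * Tb (alpha + s) (fun w => normc (u w)) z)%E.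
    move=> mu' u2; apply: le_trans (Kop_shift_dist (ltW alpha0) h0 s01 mu' u2 zB) _.
    by apply: lee_wpmul2r => //; rewrite lee_fin.
  have fg := Hcode f g (L1_ball mf F1) (L1_ball mg G1) (esym FG) z zB.
  rewrite ge0_muleDr; [|exact: (adde_ge0 (T0 _ _) (T0 _ _))|by []].
  rewrite ge0_muleDr; [|exact: T0|exact: T0]; rewrite mule1.
  apply: (@le_trans _ _ ((normc (Kop alpha 0 f z - Kop alpha h f z))%:E +
    (normc (Kop alpha 0 g z - Kop alpha h g z))%:E +
    (normc (Kop alpha h f z - Kop alpha h g z))%:E)%E).
    rewrite -!EFinD lee_fin.
    have -> : Kop alpha 0 f z - Kop alpha 0 g z = (Kop alpha 0 f z - Kop alpha h f z) -
      (Kop alpha 0 g z - Kop alpha h g z) + (Kop alpha h f z - Kop alpha h g z) by ring.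
    apply: le_trans (le_normcD _ _) _; rewrite lerD2r.
    by apply: le_trans (le_normcD _ _) _; rewrite normcN.
  by apply: leeD; [apply: leeD; exact: shift|rewrite lee_fin].
- apply: norm_bounded_sum => //; [exact: Tm|exact: Tm|exact: HC|exact: HC].
Qed.

End sufficiency.

(** * Necessity *)

Section boundary_box.
Context {R : realType} {n : nat}.
Local Notation T := (n.+1.-tuple R[i]).
Local Notation B := (@unit_ball R n.+1).
Local Notation mu := (@ball_measure R n.+1).
Local Notation N := (n.+2%:R : R).

(* Small enough for alpha |arg (1 - <z,w>)| <= 1/4 on the boxes. *)
Let c : R := (16 * N)^-1.

Let N2 : 2 <= N. Proof. by rewrite ler_nat. Qed.

Let c0 : 0 < c. Proof. by rewrite invr_gt0 mulr_gt0// ltr0n. Qed.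

Let cN : c * N = 16^-1.
Proof. by rewrite /c invfM -mulrA mulVf ?mulr1// gt_eqF// ltr0n. Qed.

Let c32 : c <= 32^-1.
Proof. by rewrite -(@ler_pM2r _ N) ?ltr0n// cN; have := N2; lra. Qed.

(** A box in the tangential geometry of the sphere at (1, 0, ..., 0), centred at distance e inside,
    so that 1 - <z,w> is close to 2 e for all pairs of its points. *)
Definition boundary_box (e : R) : set T :=
  cbox n.+1 (fun i => if i is 0 then 1 - e else 0) (fun=> 0)
    (fun i => if i is 0 then c * e else c * Num.sqrt e).

Lemma measurable_boundary_box e : measurable (boundary_box e).
Proof. exact: measurable_cbox. Qed.

Let abs_mul (x y s r : R) : `|x| <= s -> `|y| <= r -> `|x * y| <= s * r.
Proof. by move=> xs yr; rewrite normrM; apply: ler_pM. Qed.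

Let boundary_tail e z w (i : 'I_n) : 0 <= e -> boundary_box e z -> boundary_box e w ->
  `|cRe (tnth z (lift ord0 i)) * cRe (tnth w (lift ord0 i))| <= c ^+ 2 * e /\
  `|cIm (tnth z (lift ord0 i)) * cIm (tnth w (lift ord0 i))| <= c ^+ 2 * e /\
  `|cIm (tnth z (lift ord0 i)) * cRe (tnth w (lift ord0 i))| <= c ^+ 2 * e /\
  `|cRe (tnth z (lift ord0 i)) * cIm (tnth w (lift ord0 i))| <= c ^+ 2 * e.
Proof.
move=> e0 /(_ (lift ord0 i)) /=; rewrite !subr0 => -[z1 z2].
move=> /(_ (lift ord0 i)) /=; rewrite !subr0 => -[w1 w2].
have -> : c ^+ 2 * e = (c * Num.sqrt e) * (c * Num.sqrt e).
  by rewrite mulrACA -!expr2 sqr_sqrtr.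
by do ![split]; exact: abs_mul.
Qed.

Let sum_bound (F : 'I_n -> R) (m t : R) : 0 <= t -> m = 2 * (c * t) ->
  (forall i, `|F i| <= m) -> `|\sum_(i < n) F i| <= t / 8.
Proof.
move=> t0 mE Fm; apply: le_trans (ler_norm_sum _ _ _) _.
apply: (@le_trans _ _ (\sum_(i < n) m)); first exact: ler_sum.
rewrite sumr_const card_ord -mulr_natr mE.
have : c * n%:R <= c * N by rewrite ler_pM2l// ler_nat; apply: ltnW.
rewrite cN => H; have := ler_wpM2l t0 H; lra.
Qed.

(** At the centre 1 - (1 - e)^2 = 2 e - e^2. Moving the first coordinates costs O(c e); each other
    coordinate contributes at most O((c sqrt e)^2), and since c N = 1/16 these add up to at most c e
    / 8. *)
Lemma boundary_box_cdot e z w : 0 < e <= 2^-1 -> boundary_box e z -> boundary_box e w ->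
  e <= cRe (1 - cdot z w) <= 3 * e /\ `|cIm (1 - cdot z w)| <= 4 * (c * e).
Proof.
move=> /andP[e0 e2] zE wE.
have t0 : 0 < c * e by exact: mulr_gt0.
have te : c * e <= e / 32 by rewrite mulrC ler_pM2l.
have S1 : `|\sum_(i < n) (cRe (tnth z (lift ord0 i)) * cRe (tnth w (lift ord0 i)) +
    cIm (tnth z (lift ord0 i)) * cIm (tnth w (lift ord0 i)))| <= c * e / 8.
  apply: (@sum_bound _ (2 * (c * (c * e)))) => // [|i]; first exact: ltW.
  have [a1 [a2 _]] := boundary_tail i (ltW e0) zE wE.
  by apply: le_trans (ler_normD _ _) _; move: a1 a2; rewrite expr2; lra.
have S2 : `|\sum_(i < n) (cIm (tnth z (lift ord0 i)) * cRe (tnth w (lift ord0 i)) -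
    cRe (tnth z (lift ord0 i)) * cIm (tnth w (lift ord0 i)))| <= c * e / 8.
  apply: (@sum_bound _ (2 * (c * (c * e)))) => // [|i]; first exact: ltW.
  have [_ [_ [a1 a2]]] := boundary_tail i (ltW e0) zE wE.
  by apply: le_trans (ler_normB _ _) _; move: a1 a2; rewrite expr2; lra.
have [z1 z2] := zE ord0; have [w1 w2] := wE ord0.
rewrite cReD cImD cReN cImN cRe_cdot cIm_cdot !big_ord_recl /= add0r normrN.
move: z1 z2 w1 w2 S1 S2; rewrite /= !subr0.
set a := cRe (tnth z ord0); set b := cIm (tnth z ord0).
set a' := cRe (tnth w ord0); set b' := cIm (tnth w ord0).
set s := \sum_(i < n) _; set s' := \sum_(i < n) _.
move: (c * e) t0 te => t t0 te au bt au' bt' ss ss'.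
move: au bt au' bt' ss ss'; clear -t0 te e0 e2 abs_mul.
move: a b a' b' s s' => a b a' b' s s' au bt au' bt' ss ss'.
have a1 : `|a| <= 1 by move: au; rewrite !ler_norml => /andP[? ?]; apply/andP; split; lra.
have a1' : `|a'| <= 1 by move: au'; rewrite !ler_norml => /andP[? ?]; apply/andP; split; lra.
have uu := abs_mul au au'; have bb := abs_mul bt bt'.
have e1 : `|1 - e| <= 1 by rewrite ler_norml; apply/andP; split; lra.
have eu := abs_mul e1 au; have eu' := abs_mul e1 au'.
have ba := abs_mul bt a1'; have ab := abs_mul a1 bt'.
have tt : t * t <= t * 64^-1 by rewrite ler_pM2l//; lra.
have ee : e * e <= e * 2^-1 by rewrite ler_pM2l.
have ee0 : 0 <= e * e by apply: mulr_ge0; exact: ltW.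
have E1 : a * a' = 1 - 2 * e + e * e + (1 - e) * (a - (1 - e)) + (1 - e) * (a' - (1 - e)) +
  (a - (1 - e)) * (a' - (1 - e)) by ring.
rewrite {}E1; split; [apply/andP; split|];
  move: uu bb eu eu' ba ab ss ss'; rewrite !ler_norml ?mul1r ?mulr1;
  move=> /andP[? ?] /andP[? ?] /andP[? ?] /andP[? ?] /andP[? ?] /andP[? ?] /andP[? ?] /andP[? ?].
- lra.
- lra.
- by apply/andP; split; lra.
Qed.

(** [boundary_box_cdot] at w = z, since Re <z,z> = |z|^2. *)
Lemma boundary_box_sqn e z : 0 < e <= 2^-1 -> boundary_box e z -> e <= 1 - sqn z.
Proof.
move=> e12 zE; have [/andP[+ _] _] := boundary_box_cdot e12 zE zE.
rewrite cReD cReN cRe_cdot /=; congr (_ <= 1 - _).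
by apply: eq_bigr => i _; rewrite normc_sqE !expr2.
Qed.

Lemma sub_boundary_box e : 0 < e <= 2^-1 -> boundary_box e `<=` B.
Proof.
move=> e12 z zE; have := boundary_box_sqn e12 zE.
by rewrite unit_ballP; move: e12 => /andP[+ _]; lra.
Qed.

(** The modulus of 1 - <z,w> is at most 4 e, and alpha times its argument is at most N * 4 c = 1/4
    in absolute value, so the cosine is at least 3/4. Without this control the integrand could
    oscillate and cancel. *)
Lemma boundary_box_kernel alpha e z w : 0 < alpha <= N -> 0 < e <= 2^-1 ->
  boundary_box e z -> boundary_box e w ->
  2^-1 * (4 * e) `^ (- alpha) <= kRe alpha 0 z w.
Proof.
move=> /andP[a0 aN] e12 zE wE; have [/andP[x1 x3] y4] := boundary_box_cdot e12 zE wE.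
have /andP[e0 e2] := e12; rewrite /kRe /kerR addr0.
move: (cRe _) (cIm _) x1 x3 y4 => x y x1 x3 y4.
have x0 : 0 < x by lra.
have ce : c * e <= e / 32 by rewrite mulrC ler_pM2l.
have m0 : 0 < Num.sqrt (x ^+ 2 + y ^+ 2) by rewrite sqrtr_gt0 ltr_pwDl// ?exprn_gt0 ?sqr_ge0.
have m4 : Num.sqrt (x ^+ 2 + y ^+ 2) <= 4 * e.
  apply: (le_trans (normc_ReIm (Complex x y))) => /=; rewrite gtr0_norm//; lra.
have cs : 2^-1 <= cos (alpha * atan (y / x)).
  have A : `|alpha * atan (y / x)| <= 4^-1.
    have := atan_lipschitz (y / x) 0; rewrite atan0 !subr0 => H.
    rewrite normrM gtr0_norm//; apply: (@le_trans _ _ (N * (4 * c))).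
      apply: ler_pM => //; first exact: ltW.
      apply: (le_trans H); rewrite normrM normfV (gtr0_norm x0) ler_pdivrMr//.
      apply: (le_trans y4); rewrite mulrA ler_pM2l// mulr_gt0//.
    by rewrite mulrCA (mulrC N) cN; lra.
  have := cos_lipschitz (alpha * atan (y / x)) 0; rewrite cos0 subr0 ler_norml => /andP[H _].
  by lra.
rewrite mulrC; apply: ler_pM => //; first exact: powR_ge0.
rewrite !powRN lef_pV2 ?posrE ?powR_gt0//; last by rewrite mulr_gt0.
by apply: ge0_ler_powR; rewrite ?nnegrE; [exact: ltW|exact: ltW|rewrite mulr_ge0// ltW|].
Qed.

(** The first coordinate contributes an area of order e^2, each of the n others an area of order
    e. *)
Lemma boundary_box_measure : exists2 A : R, 0 < A & forall e, 0 < e <= 2^-1 ->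
  mu (boundary_box e) = (A * e `^ N)%:E.
Proof.
have V0 : 0 < fine (lebesgue_complex n.+1 (@unit_ball R n.+1)) by exact: ball_volume_gt0.
exists ((fine (lebesgue_complex n.+1 (@unit_ball R n.+1)))^-1 * ((2 * c) ^+ 2) ^+ n.+1).
  by rewrite mulr_gt0 ?invr_gt0// !exprn_gt0// mulr_gt0.
move=> e e12; rewrite ball_measureE (setIidl (sub_boundary_box e12)).
have /andP[e0 _] := e12.
rewrite lebesgue_complex_cbox; last first.
  by case=> [|i]; rewrite mulr_ge0 ?sqrtr_ge0// ltW.
rewrite -EFinM; congr EFin; rewrite -mulrA; congr (_ * _).
rewrite big_ord_recl /= (eq_bigr (fun=> (2 * c) ^+ 2 * e)); last first.
  by move=> i _; rewrite /= mulrA exprMn sqr_sqrtr// ltW.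
rewrite prodr_const card_ord powR_mulrn; last exact: ltW.
have -> : (2 * (c * e)) ^+ 2 = (2 * c) ^+ 2 * (e * e) by ring.
by move: ((2 * c) ^+ 2) => Q; rewrite exprMn !exprS; ring.
Qed.

End boundary_box.

(** * Normalized indicators and lower bounds for norms *)

Section cLnorm_indicator.
Context d {T : measurableType d} {R : realType}.
Variable mu : {measure set T -> \bar R}.
Variables (E : set T) (m : R).
Hypotheses (mE : measurable E) (muE : mu E = m%:E) (m0 : 0 < m).

Lemma cLnorm_ge_set q (H : T -> R[i]) (c : R) : (1 <= q)%E -> 0 <= c ->
  measurable_fun setT H -> (forall z, E z -> c <= normc (H z)) ->
  ((c * m `^ iexp q)%:E <= cLnorm mu q H)%E.
Proof.
case: q => [r| |]//; last first.
  move=> _ c0 mH HE; rewrite iexpy powRr0 mulr1 leNgt; apply/negP => Hc.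
  have mT : (0 < mu [set: T])%E.
    apply: (@lt_le_trans _ _ (mu E)); first by rewrite muE lte_fin.
    by apply: le_measure; rewrite ?inE.
  move: Hc; rewrite /cLnorm unlock mT => Hc.
  have N0 : mu E = 0%E.
    apply: measure_negligible => //.
    apply: negligibleS (ess_sup_ge mu (abse \o (fun z => (normc (H z))%:E))) => z Ez /=.
    apply/negP; rewrite -ltNge; apply: lt_le_trans Hc _.
    by rewrite lee_fin ger0_norm ?normc_ge0// HE.
  by move: m0; rewrite -lte_fin -muE N0 ltxx.
rewrite lee_fin => r1 c0 mH HE; have r0 : 0 < r by exact: lt_le_trans ltr01 r1.
rewrite iexp_EFin//; apply: (poweR_le_cancel r0); rewrite ?cLnorm_ge0//.
  by rewrite lee_fin mulr_ge0 ?powR_ge0.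
rewrite cLnorm_powerE// poweR_EFin powRM ?powR_ge0// -powRrM mulVf ?gt_eqF// powRr1; last exact: ltW.
rewrite EFinM -muE -integral_cst; last exact: mE.
apply: (@le_trans _ _ (\int[mu]_(z in E) (normc (H z) `^ r)%:E)%E).
  apply: ge0_le_integral_mono => z Ez; rewrite ?lee_fin ?powR_ge0//.
  by apply: ge0_ler_powR; rewrite ?nnegrE; [exact: ltW|by []|exact: normc_ge0|exact: HE].
apply: ge0_subset_integral => //; first exact: measurable_normc_powR.
by move=> z _; rewrite lee_fin powR_ge0.
Qed.

(** With m the measure of E, the factor normalizes the indicator in L^p; for p = +oo the exponent is
    0 and the plain indicator remains. *)
Definition scaled_indic p : T -> R[i] := fun w => Complex (m `^ (- iexp p) * \1_E w) 0.

Lemma normc_scaled_indic p w : normc (scaled_indic p w) = m `^ (- iexp p) * \1_E w.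
Proof.
by rewrite /scaled_indic /= expr0n addr0 sqrtr_sqr ger0_norm// mulr_ge0 ?powR_ge0// indicE.
Qed.

Lemma measurable_scaled_indic p : measurable_fun setT (scaled_indic p).
Proof.
apply/measurable_fun_complexP; split; last by rewrite (_ : _ \o _ = cst 0).
rewrite (_ : _ \o _ = (fun w => m `^ (- iexp p) * \1_E w))//.
by apply: measurable_funM => //; exact: measurable_indic.
Qed.

Lemma cLnorm_scaled_indic p : (1 <= p)%E -> (cLnorm mu p (scaled_indic p) <= 1)%E.
Proof.
case: p => [r| |]//; last first.
  move=> _; rewrite /cLnorm unlock; case: ifPn => // _; apply/ess_supP/nearW => z.
  rewrite -[leLHS]/(`|(normc (scaled_indic +oo%E z))%:E|)%E normc_scaled_indic iexpy oppr0 powRr0 mul1r indicE.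
  by rewrite lee_fin ger0_norm// lern1 leq_b1.
rewrite lee_fin => r1; have r0 : 0 < r by exact: lt_le_trans ltr01 r1.
rewrite -(@poweR_le1 R _ r)// ?cLnorm_ge0// cLnorm_powerE//.
rewrite (eq_integral (fun w => (m^-1)%:E * (\1_E w)%:E)%E); last first.
  move=> w _; rewrite normc_scaled_indic iexp_EFin// -EFinM indicE; congr EFin.
  case: (w \in E); last by rewrite !mulr0 powR0// gt_eqF.
  by rewrite !mulr1 -powRrM mulNr mulVf ?gt_eqF// powRN powRr1//; exact: ltW.
rewrite ge0_integralZl//; last 2 first.
- by apply/measurable_EFinP; exact: measurable_indic.
- by rewrite lee_fin invr_ge0 ltW.
by rewrite integral_indic// setIT [X in (_ * X)%E]muE -EFinM mulVf// gt_eqF.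
Qed.

End cLnorm_indicator.

(** * Separation of the images of the test functions and failure of compactness *)

Section necessity.
Context {R : realType} {n : nat}.
Local Notation T := (n.+1.-tuple R[i]).
Local Notation B := (@unit_ball R n.+1).
Local Notation mu := (@ball_measure R n.+1).
Local Notation N := (n.+2%:R : R).
Variable alpha : R.
Hypothesis alpha_range : 0 < alpha <= N.

Let alpha0 : 0 < alpha. Proof. by case/andP: alpha_range. Qed.

Lemma Kop_ae_eq (F G : T -> R[i]) (z : T) : measurable_fun setT F -> measurable_fun setT G ->
  {ae mu, forall w, F w = G w} -> Kop alpha 0 F z = Kop alpha 0 G z.
Proof.
move=> mF mG FG; have mB : measurable B by exact: measurable_unit_ball.
have mk1 := measurable_kRe alpha 0 z; have mk2 := measurable_kIm alpha 0 z.
have RE (f g : T -> R) : measurable_fun setT f -> measurable_fun setT g ->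
    {ae mu, forall w, f w = g w} -> Rintegral mu B f = Rintegral mu B g.
  move=> mf mg fg; rewrite /Rintegral; congr fine; apply: ae_eq_integral => //.
  - by apply/measurable_EFinP; exact: measurable_funTS.
  - by apply/measurable_EFinP; exact: measurable_funTS.
  - by apply: filterS fg => w -> _.
have [mFr mFi] := (measurable_cRe mF, measurable_cIm mF).
have [mGr mGi] := (measurable_cRe mG, measurable_cIm mG).
rewrite /Kop /Cint; congr Complex; apply: RE; try by apply: filterS FG => w ->.
1,2: by apply: measurable_funB; exact: measurable_funM.
all: by apply: measurable_funD; exact: measurable_funM.
Qed.

(** [Kop_le_Tb] with s = 1, whence 8 and the exponent alpha + 1. This power of t is larger than
    necessary, but t will be fixed while the L^1 norm varies. *)
Lemma Kop_far_bound (F : T -> R[i]) (z : T) (t L : R) : measurable_fun setT F -> B z ->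
  0 < t -> (forall w, B w -> F w != 0 -> t <= kap z w) ->
  (\int[mu]_(w in B) (normc (F w))%:E = L%:E)%E ->
  normc (Kop alpha 0 F z) <= 8 * t `^ (- (alpha + 1)) * L.
Proof.
move=> mF zB t0 Ft FL; have mB : measurable B by exact: measurable_unit_ball.
rewrite -lee_fin; apply: (le_trans (@Kop_le_Tb R n alpha alpha_range 1 F z ltr01 mF _ zB)).
  by rewrite FL ltry.
have mnF : measurable_fun B (fun w => (normc (F w))%:E).
  by apply/measurable_EFinP; apply: measurable_funTS; exact (@measurable_normc_comp _ _ R F mF).
have F0 w : B w -> (0 <= (normc (F w))%:E)%E by rewrite lee_fin normc_ge0.
have t0' : (0 <= (t `^ (- (alpha + 1)))%:E)%E by rewrite lee_fin powR_ge0.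
have -> : (8 * t `^ (- (alpha + 1)) * L)%:E = ((4 * 2 `^ 1)%:E * ((t `^ (- (alpha + 1)))%:E * L%:E))%E.
  by rewrite powRr1// -!EFinM; congr EFin; ring.
apply: lee_wpmul2l; first by rewrite lee_fin mulr_ge0 ?powR_ge0.
rewrite -FL -(@ge0_integralZl _ _ _ mu B mB _ mnF _ F0 t0'); apply: ge0_le_integral_mono => w wB.
  by rewrite lee_fin mulr_ge0 ?normc_ge0 ?powR_ge0.
rewrite -EFinM lee_fin mulrC; have [->|Fn0] := eqVneq (F w) 0; first by rewrite normc0 !mulr0.
apply: ler_wpM2r; first exact: normc_ge0.
rewrite !powRN lef_pV2 ?posrE ?powR_gt0//; last exact: kap_gt0.
have tk := Ft w wB Fn0.
apply: ge0_ler_powR; rewrite ?nnegrE//; [by have := alpha0; lra|exact: ltW|lra].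
Qed.

Section test_function.
Variable p : \bar R.

Definition box_volume (e : R) : R := fine (mu (boundary_box e)).

Definition box_test (e : R) : T -> R[i] := scaled_indic (boundary_box e) (box_volume e) p.

Variables (e : R).
Hypothesis e12 : 0 < e <= 2^-1.

Lemma box_volumeE : mu (boundary_box e) = (box_volume e)%:E.
Proof.
have [A _ HA] := @boundary_box_measure R n.
by rewrite /box_volume HA.
Qed.

Lemma box_volume_gt0 : 0 < box_volume e.
Proof.
have [A A0 HA] := @boundary_box_measure R n; rewrite /box_volume HA//=.
by rewrite mulr_gt0// powR_gt0//; case/andP: e12.
Qed.

Lemma measurable_box_test : measurable_fun setT (box_test e).
Proof. by apply: measurable_scaled_indic; exact: measurable_boundary_box. Qed.

Lemma integral_box_test :
  (\int[mu]_(w in B) (normc (box_test e w))%:E = (box_volume e `^ (1 - iexp p))%:E)%E.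
Proof.
have mB : measurable B by exact: measurable_unit_ball.
have mE : measurable (boundary_box e : set T) by exact: measurable_boundary_box.
under eq_integral do rewrite normc_scaled_indic EFinM.
rewrite ge0_integralZl//; last 2 first.
- by apply/measurable_EFinP; apply: measurable_funTS; exact: measurable_indic.
- by rewrite lee_fin powR_ge0.
rewrite integral_indic// setIidl; last exact: sub_boundary_box.
have m0 := box_volume_gt0.
rewrite [X in (_ * X)%E]box_volumeE -EFinM addrC powRD; last by rewrite (gt_eqF m0) implybT.
by rewrite powRr1// ltW.
Qed.

(** The test function is real and nonnegative, so the real part of its image integrates [kRe]
    against it: the kernel bound on the box multiplies the L^1 norm vol^(1 - 1/p). *)
Lemma box_test_lower z : boundary_box e z ->
  2^-1 * (4 * e) `^ (- alpha) * box_volume e `^ (1 - iexp p) <= normc (Kop alpha 0 (box_test e) z).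
Proof.
move=> zE; apply: (@le_trans _ _ (cRe (Kop alpha 0 (box_test e) z))); last first.
  exact: le_trans (ler_norm _) (normc_Re _).
have zB : B z by exact: sub_boundary_box e12 _ zE.
have mB : measurable B by exact: measurable_unit_ball.
have mE : measurable (boundary_box e : set T) by exact: measurable_boundary_box.
have m0 := box_volume_gt0.
set h := box_volume e `^ (- iexp p); set k0 := 2^-1 * _.
have h0 : 0 <= h by exact: powR_ge0.
have k00 : 0 <= k0 by rewrite mulr_ge0 ?powR_ge0.
have z1 : 0 < (1 - sqn z) / 2 by rewrite divr_gt0// subr_gt0.
pose g w := normc (box_test e w) * kRe alpha 0 z w.
have gE w : g w = h * \1_(boundary_box e) w * kRe alpha 0 z w.
  by rewrite /g normc_scaled_indic.
have -> : cRe (Kop alpha 0 (box_test e) z) = Rintegral mu B g.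
  rewrite /Kop /=; apply: eq_Rintegral => w _.
  by rewrite -[RHS]/(g w) gE /box_test /scaled_indic /= mul0r subr0.
have ig : mu.-integrable B (EFin \o g).
  apply: (@integrable_kernel R n (box_test e) (fun w => normc (box_test e w)) (kRe alpha 0 z) _
    (((1 - sqn z) / 2) `^ (- alpha)) measurable_box_test _ _ _ (measurable_kRe alpha 0 z)).
  - by rewrite integral_box_test.
  - exact (@measurable_normc_comp _ _ R _ measurable_box_test).
  - by move=> w; rewrite ger0_norm ?normc_ge0.
  - move=> w wB; have zw : (1 - sqn z) / 2 <= cRe (1 - cdot z w) + 0.
      by rewrite addr0; have := cRe1B_ge z w; move: wB; rewrite unit_ballP; lra.
    by have [] := kernel_bound (ltW alpha0) z1 zw.
have gI : (\int[mu]_(w in B) (g w)%:E = (Rintegral mu B g)%:E)%E.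
  by rewrite /Rintegral fineK//; exact: integrable_fin_num ig.
rewrite -lee_fin -gI EFinM -integral_box_test.
have mI : measurable_fun B (fun w => (normc (box_test e w))%:E).
  apply/measurable_EFinP; apply: measurable_funTS.
  exact (@measurable_normc_comp _ _ R _ measurable_box_test).
have I0 w : B w -> (0 <= (normc (box_test e w))%:E)%E by rewrite lee_fin normc_ge0.
have k00' : (0 <= k0%:E)%E by rewrite lee_fin.
rewrite -(@ge0_integralZl _ _ _ mu B mB _ mI _ I0 k00').
apply: ge0_le_integral_mono => w wB; first by rewrite mule_ge0// I0.
rewrite -EFinM lee_fin gE normc_scaled_indic indicE.
have [wE|_] := boolP (w \in boundary_box e); last by rewrite mulr0 mulr0 mul0r.
rewrite mulr1 mulrC; apply: ler_wpM2l => //.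
by apply: boundary_box_kernel => //; exact/set_mem.
Qed.

Lemma box_test_far z t : B z -> 0 < t ->
  (forall w, boundary_box e w -> t <= kap z w) ->
  normc (Kop alpha 0 (box_test e) z) <= 8 * t `^ (- (alpha + 1)) * box_volume e `^ (1 - iexp p).
Proof.
move=> zB t0 Ht; apply: Kop_far_bound => //; [exact: measurable_box_test| |exact: integral_box_test].
move=> w wB; rewrite /box_test /scaled_indic indicE.
have [/set_mem wE _|_] := boolP (w \in boundary_box e); first exact: Ht.
by rewrite mulr0 eqxx.
Qed.

End test_function.

Local Notation vol := box_volume.
Variables (p q : \bar R) (p1 : (1 <= p)%E) (q1 : (1 <= q)%E).
Hypothesis cond : iexp q <= iexp p + alpha / N - 1.

Let ball_box_kap (e : R) (z w : T) : 0 < e <= 2^-1 -> boundary_box e w ->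
  B z -> e / 2 <= kap z w.
Proof.
move=> e12 wE zB; rewrite kapC; apply: le_trans (kap_ge _ zB).
by have := boundary_box_sqn e12 wE; lra.
Qed.

Let Kbox e := Kop alpha 0 (box_test p e).

Let mK (e : R) : measurable_fun setT (Kbox e).
Proof. by apply: measurable_Kop; exact: measurable_box_test. Qed.

Let mKB (e e' : R) : measurable_fun setT (Kbox e \- Kbox e').
Proof. exact: measurable_funB_complex. Qed.

Let normc_sub_ge (a b : R[i]) : normc a - normc b <= normc (a - b).
Proof. by rewrite lerBlDr; apply: le_trans (le_normcD _ _); rewrite subrK. Qed.

Let normc_subC (a b : R[i]) : normc (a - b) = normc (b - a).
Proof. by rewrite -normcN opprB. Qed.

Let half_gap (x a b M : R) : x <= a -> b <= M -> 2 * M <= x -> 2^-1 * x <= a - b.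
Proof. by lra. Qed.

Lemma box_test_separated : exists2 c : R, 0 < c & forall e1, 0 < e1 <= 2^-1 ->
  exists2 e0 : R, 0 < e0 & forall e2, 0 < e2 <= 2^-1 -> e2 < e0 ->
  (c%:E <= cLnorm mu q (Kbox e1 \- Kbox e2)%R)%E.
Proof.
have N0 : 0 < N by rewrite ltr0n.
have [A A0 HA] := @boundary_box_measure R n.
have vE e : 0 < e <= 2^-1 -> vol e = A * e `^ N.
  by move=> e12; rewrite /box_volume HA.
pose k := 2^-1 * 4 `^ (- alpha) * A `^ (1 - iexp p).
have k0 : 0 < k by rewrite !mulr_gt0 ?powR_gt0.
(* The exponent of e in the lower bound on the box: the kernel gives e^-alpha and the L^1 norm e^(N
   (1 - 1/p)). *)
pose g := N * (1 - iexp p) - alpha.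
have lowE e : 0 < e <= 2^-1 ->
    2^-1 * (4 * e) `^ (- alpha) * vol e `^ (1 - iexp p) = k * e `^ g.
  move=> e12; have /andP[e0 _] := e12; rewrite vE// !powRM ?powR_ge0 ?(ltW e0) ?(ltW A0)//.
  rewrite -powRrM /k /g (@powRD _ e); last by rewrite (gt_eqF e0) implybT.
  by ring.
(* Half of the lower bound, since up to half of it may be cancelled by the other image. *)
pose c := 2^-1 * (k * A `^ iexp q).
have c0 : 0 < c by rewrite !mulr_gt0 ?powR_gt0.
(* The failing condition multiplied by N. *)
have gq : g + N * iexp q <= 0.
  have := ler_wpM2l (ltW N0) cond.
  rewrite /g mulrBr mulrDr mulrCA mulfV ?gt_eqF// !mulr1 mulrBr mulr1; lra.
exists c => // e1 e11; have /andP[e10 _] := e11.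
have v1 : 0 < vol e1 by exact: box_volume_gt0.
have vE1 : mu (boundary_box e1) = (vol e1)%:E by exact: box_volumeE.
pose D := 8 * (e1 / 2) `^ (- (alpha + 1)).
have e120 : 0 < e1 / 2 by rewrite divr_gt0.
have D0 : 0 < D by rewrite mulr_gt0// powR_gt0.
(* For g < 0 the images blow up, and we look at the smaller box; otherwise g = 0
   and q = +oo, the mass of the second test function tends to 0, and we look at
   the larger box. *)
have [g0|g0] := ltP g 0.
  have anti (x y : R) : 0 < x -> x <= y -> y `^ g <= x `^ g.
    move=> x0 xy; have y0 : 0 < y by exact: lt_le_trans xy.
    have gNN : g = - (- g) by rewrite opprK.
    rewrite {1 2}gNN (powRN y (- g)) (powRN x (- g)) lef_pV2 ?posrE ?powR_gt0//.
    by apply: ge0_ler_powR; rewrite ?nnegrE; [lra|exact: ltW|exact: ltW|].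
  pose M := D * vol e1 `^ (1 - iexp p).
  have M0 : 0 < M by rewrite mulr_gt0// powR_gt0.
  (* The solution of k * e0^g = 2 M. As g < 0, every smaller e2 has k * e2^g >= 2 M, so on its own
     box the image of the second test function is at least twice the first. *)
  exists ((2 * M / k) `^ (g^-1)); first by rewrite powR_gt0// divr_gt0// mulr_gt0.
  move=> e2 e21 e20; have /andP[e2p e2h] := e21.
  have v2 : 0 < vol e2 by exact: box_volume_gt0.
  have vE2 : mu (boundary_box e2) = (vol e2)%:E by exact: box_volumeE.
  have kg : 2 * M <= k * e2 `^ g.
    have Mk : 0 < 2 * M / k by rewrite divr_gt0// mulr_gt0.
    rewrite [leRHS]mulrC -ler_pdivrMr//.
    have -> : 2 * M / k = ((2 * M / k) `^ g^-1) `^ g.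
      by rewrite -powRrM mulVf ?lt_eqF// powRr1// ltW.
    by apply: anti => //; exact: ltW.
  apply: (@le_trans _ _ ((2^-1 * (k * e2 `^ g)) * vol e2 `^ iexp q)%:E).
    rewrite lee_fin vE// powRM ?powR_ge0 ?(ltW A0)// -powRrM /c.
    have -> : 2^-1 * (k * e2 `^ g) * (A `^ iexp q * e2 `^ (N * iexp q)) =
       2^-1 * (k * A `^ iexp q) * e2 `^ (g + N * iexp q).
      by rewrite (@powRD _ e2 g) ?(gt_eqF e2p) ?implybT//; ring.
    rewrite ler_peMr ?(ltW c0)//.
    have e2le1 : 0 < e2 <= 1 by rewrite e2p (le_trans e2h)// invf_le1// ler1n.
    by have := ger_powR e2le1 gq; rewrite powRr0.
  apply: (cLnorm_ge_set (measurable_boundary_box e2) vE2 v2 q1) => //.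
    by rewrite !mulr_ge0 ?powR_ge0 ?(ltW k0).
  move=> z zE; have zB : B z by exact: (sub_boundary_box e21).
  have L := box_test_lower p e21 zE; rewrite lowE// in L.
  have U : normc (Kbox e1 z) <= M.
    apply: box_test_far => // w wE; exact: ball_box_kap.
  rewrite -[leRHS]/(normc (Kbox e1 z - Kbox e2 z)) normc_subC.
  apply: le_trans (normc_sub_ge _ _).
  exact: half_gap L U kg.
have iq0 : iexp q = 0.
  have := iexp_ge0 q1; have : N * iexp q <= 0 by lra.
  by rewrite pmulr_rle0// => h1 h2; apply/eqP; rewrite eq_le h1.
have gE : g = 0 by move: gq; rewrite iq0 mulr0; lra.
have aE : alpha = N * (1 - iexp p) by move: gE; rewrite /g; lra.
(* Now alpha = N (1 - 1/p), so the L^1 norm of the second test function is a multiple of e2^alpha;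
   e2^alpha <= t makes its image on the first box at most k / 2. *)
pose t := k / (2 * D * A `^ (1 - iexp p)).
have DA0 : 0 < 2 * D * A `^ (1 - iexp p) by rewrite !mulr_gt0 ?powR_gt0.
have t0 : 0 < t by rewrite divr_gt0.
exists (t `^ alpha^-1); first exact: powR_gt0.
move=> e2 e21 e20; have /andP[e2p e2h] := e21.
have e2t : e2 `^ alpha <= t.
  have -> : t = (t `^ alpha^-1) `^ alpha.
    by rewrite -powRrM mulVf ?gt_eqF// powRr1// ltW.
  by apply: ge0_ler_powR; rewrite ?nnegrE ?powR_ge0//; exact: ltW.
apply: (@le_trans _ _ ((2^-1 * k) * vol e1 `^ iexp q)%:E).
  by rewrite lee_fin /c iq0 !powRr0 !mulr1.
apply: (cLnorm_ge_set (measurable_boundary_box e1) vE1 v1 q1) => //.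
  by rewrite mulr_ge0// ltW.
move=> z zE; have zB : B z by exact: (sub_boundary_box e11).
have L := box_test_lower p e11 zE; rewrite lowE// gE powRr0 mulr1 in L.
have U : normc (Kbox e2 z) <= D * vol e2 `^ (1 - iexp p).
  apply: box_test_far => // w wE; rewrite kapC; apply: ball_box_kap => //.
  exact: (sub_boundary_box e21).
have V : 2 * (D * vol e2 `^ (1 - iexp p)) <= k.
  rewrite vE// powRM ?powR_ge0 ?(ltW A0)// -powRrM -aE.
  have -> : k = 2 * (D * (A `^ (1 - iexp p) * t)).
    by rewrite /t; field; rewrite !gt_eqF ?powR_gt0.
  by rewrite ler_pM2l// ler_pM2l// ler_pM2l ?powR_gt0.
rewrite -[leRHS]/(normc (Kbox e1 z - Kbox e2 z)).
apply: le_trans (normc_sub_ge _ _).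
exact: half_gap L U V.
Qed.

Lemma K_op_not_compact : ~ compact_operator mu p1 q1 (K_op alpha).
Proof.
move=> [K' HK' pc].
have [c c0 sep] := box_test_separated.
have h12 : 0 < (2^-1 : R) <= 2^-1 by rewrite lexx invr_gt0 ltr0n.
have test (e : R) : 0 < e <= 2^-1 -> exists F : cLp mu p1, (cLnorm mu p (cLp_fun F) <= 1)%E /\
    {ae mu, forall w, cLp_fun F w = box_test p e w}.
  move=> e12; have mb := measurable_box_test p e.
  have b1 : (cLnorm mu p (box_test p e) <= 1)%E.
    apply: (cLnorm_scaled_indic (measurable_boundary_box e) _ _ p1).
      exact: box_volumeE.
    exact: box_volume_gt0.
  have [F FE] := exists_cLp p1 mb (le_lt_trans b1 (ltry 1)).
  exists F; split => //; rewrite (cLnorm_ae_eq p1 (measurable_cLp F) mb)//.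
  by apply: filterS FE => w ->.
(* The choice has to be total in e to define a filter; outside the range of e an arbitrary element
   is taken. *)
have /choice[F HF] (e : R) : exists F : cLp mu p1, 0 < e <= 2^-1 ->
    (cLnorm mu p (cLp_fun F) <= 1)%E /\
    {ae mu, forall w, cLp_fun F w = box_test p e w}.
  have [/test[F HF]|_] := boolP (0 < e <= 2^-1); first by exists F.
  by have [F _] := test _ h12; exists F.
have KE (e : R) : 0 < e <= 2^-1 ->
    {ae mu, forall z, cLp_fun (K' (F e)) z = Kbox e z}.
  move=> e12; have [_ FE] := HF e e12.
  have KB : {ae mu, forall z, K_op alpha (cLp_fun (F e)) z = Kbox e z}.
    apply: ae_unit_ball => z zB; rewrite K_opE//.
    by apply: Kop_ae_eq FE; [exact: measurable_cLp|exact: measurable_box_test].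
  by apply: filterS2 (HK' (F e)) KB => z H1 H2; rewrite H1.
have dK (e1 e2 : R) : 0 < e1 <= 2^-1 -> 0 < e2 <= 2^-1 ->
    (cLp_dist (K' (F e1)) (K' (F e2)))%:E =
    cLnorm mu q (Kbox e1 \- Kbox e2)%R.
  move=> e11 e21; rewrite cLp_distE; apply: cLnorm_ae_eq => //.
  - by apply: measurable_funB_complex; exact: measurable_cLp.
  - apply: filterS2 (KE _ e11) (KE _ e21) => z H1 H2.
    exact: (congr2 (fun a b : R[i] => normc (a - b)) H1 H2).
have small (e : R) : 0 < e -> \forall x \near (0 : R)^'+, 0 < x <= 2^-1 /\ x < e.
  move=> e0; near=> x; split; last by near: x; exact: nbhs_right_lt.
  by apply/andP; split; near: x; [exact: nbhs_right_gt|apply: nbhs_right_le; rewrite invr_gt0].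
rewrite precompactE in pc.
have FS : \forall e \near (0 : R)^'+,
    closure (K' @` [set F | (cLnorm mu p (cLp_fun F) <= 1)%E]) (K' (F e)).
  apply: filterS (small 1 ltr01) => e [/HF[F1 _] _].
  by apply: subset_closure; exists (F e).
have [g [_ gc]] := pc ((fun e => K' (F e)) @ (0 : R)^'+) _ FS.
have c2 : 0 < c / 2 by rewrite divr_gt0.
have pick (e : R) : 0 < e -> exists x, [/\ 0 < x <= 2^-1, x < e & cLp_dist g (K' (F x)) < c / 2].
  move=> e0.
  have [y [[x [x12 xe] <-] gx]] : ((fun x => K' (F x)) @` [set x | 0 < x <= 2^-1 /\ x < e])
      `&` ball g (c / 2) !=set0.
    apply: gc; last exact: nbhsx_ballx.
    by apply: filterS (small e e0) => x xe; exists x.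
  by exists x; split => //; move: gx; rewrite cLp_ballE.
(* The order matters: the threshold e0 depends on e1, and e2 is then picked below it. Both images
   lie within c / 2 of the cluster point, against the separation by c. *)
have [e1 [e11 _ ge1]] := pick 1 ltr01.
have [e0 e00 He0] := sep e1 e11.
have [e2 [e21 e20 ge2]] := pick e0 e00.
have := He0 e2 e21 e20; rewrite -dK// lee_fin leNgt => /negP; apply.
apply: le_lt_trans (cLp_dist_triangle g _ _) _.
by rewrite cLp_distC (splitr c) ltrD.
Unshelve. all: by end_near.
Qed.

End necessity.

Theorem theorem3 (R : realType) (d : nat) (d_gt0 : (1 <= d)%N)
    (alpha : R) (alpha_range : 0 < alpha <= d.+1%:R)
    (p q : \bar R) (p1 : (1 <= p)%E) (q1 : (1 <= q)%E) :
  compact_operator (ball_measure d) p1 q1 (K_op alpha) <->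
  ([\/ (p = 1 /\ q < (d.+1%:R / alpha)%:E),
       ((1 < p < critical_exponent d alpha) /\
          q^-1 > p^-1 + (alpha / d.+1%:R)%:E - 1),
       (p = critical_exponent d alpha /\ q < +oo) |
       (critical_exponent d alpha < p <= +oo)])%E.
Proof.
rewrite compactness_conditionE//.
case: d d_gt0 alpha_range => // n _ alpha_range; split => [K|cond].
  rewrite ltNge; apply/negP => cond.
  exact: (@K_op_not_compact R n alpha alpha_range p q p1 q1 cond K).
exact: (@K_op_compact R n alpha alpha_range p q p1 q1 cond).
Qed.
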